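(* Let $X\in\mathcal{V}$ be a homogeneous quadratic planar vector field. Then $X$ is $C^0$-regularisable if and only if, after an invertible real linear change of the coordinates $(x,y)$, it takes the canonical form $$X=\left(\kappa_1x^2+\kappa_2xy-y^2,\ (\kappa_1+1)xy+\kappa_2y^2\right)$$ where $\kappa_1<0$ and $\kappa_2\in\mathbb{R}$.
   Context: A homogeneous quadratic vector field $X=(P,Q)$ ($P,Q$ real homogeneous polynomials of degree 2) belongs to $\mathcal{V}$ if the origin is an isolated zero of $X$ and all real projective roots of the directional polynomial $xQ(x,y)-yP(x,y)$ have multiplicity one. An invertible linear map $T$ acts on vector fields by $(T\cdot X)(z)=T\,X(T^{-1}z)$. $C^0$-regularisability: let $\varphi$ be the flow of $X$ and $I$ the origin. For a compact smooth 2-dimensional submanifold with boundary $N$, $n=\partial N$, put $n^+=\{p\in n:\exists t>0,\varphi(p,(-t,0))\cap N=\emptyset\}$, $n^-=\{p\in n:\exists t>0,\varphi(p,(0,t))\cap N=\emptyset\}$, $\tau=\{p\in n: X\text{ tangent to }n\text{ at }p\}$, $a^+=\{p\in n^+:\varphi(p,t)\in N\ \forall t\ge0\}$, $a^-=\{p\in n^-:\varphi(p,t)\in N\ \forall t\le0\}$. $N$ is an isolating block for $I$ if $I$ is the maximal invariant set in $N$, $n^+\cap n^-=\tau$ and $\tau$ is a smooth codimension-one submanifold of $n$. Let $\pi:n^+\setminus a^+\to n^-\setminus a^-$ send $p$ to the exit point of its forward orbit from $N$. $X$ is $C^0$-regularisable if for some isolating block $N$ for $I$ the map $\pi$ has a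 unique continuous extension $\overline\pi:n^+\to n^-$. *)

(* Defs.v *)
From HB Require Import structures.
From mathcomp Require Import all_boot all_order all_algebra.
From mathcomp Require Import all_classical all_reals all_analysis.

Set Implicit Arguments.
Unset Strict Implicit.
Unset Printing Implicit Defensive.

Import Order.TTheory GRing.Theory Num.Theory.
Import numFieldNormedType.Exports.

Local Open Scope classical_set_scope.
Local Open Scope ring_scope.

(** Homogeneous polynomials of degree [d] in two real variables, as polynomial
    functions; the zero polynomial is included. *)
Definition form (R : realType) (d : nat) (f : R * R -> R) : Prop :=
  exists a : nat -> R,
    forall z, f z = \sum_(i < d.+1) a i * z.1 ^+ (d - i) * z.2 ^+ i.

(** The projective root [[w.1 : w.2]] of a form [f] of degree [d] has
    multiplicity exactly [m]: [f] is the [m]-th power of the linear form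
    vanishing on the line of [w], times a form that does not vanish at [w]. *)
Definition root_multiplicity (R : realType) (d : nat) (f : R * R -> R)
    (w : R * R) (m : nat) : Prop :=
  (m <= d)%N /\
  exists g : R * R -> R,
    [/\ form (d - m) g, g w != 0 &
        forall z, f z = (w.2 * z.1 - w.1 * z.2) ^+ m * g z].

Definition homogeneous_quadratic (R : realType) (X : R * R -> R * R) : Prop :=
  form 2 (fun z => (X z).1) /\ form 2 (fun z => (X z).2).

Definition directional_polynomial (R : realType) (X : R * R -> R * R)
    (z : R * R) : R :=
  z.1 * (X z).2 - z.2 * (X z).1.

Definition isolated_zero (R : realType) (X : R * R -> R * R) (p : R * R)
    : Prop :=
  X p = 0 /\ \forall z \near p, X z = 0 -> z = p.

Definition class_V (R : realType) (X : R * R -> R * R) : Prop :=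
  [/\ homogeneous_quadratic X,
      isolated_zero X 0 &
      forall w : R * R, w != 0 -> directional_polynomial X w = 0 ->
        root_multiplicity 3 (directional_polynomial X) w 1].

Definition canonical_field (R : realType) (k1 k2 : R) (z : R * R) : R * R :=
  (k1 * z.1 ^+ 2 + k2 * z.1 * z.2 - z.2 ^+ 2,
   (k1 + 1) * z.1 * z.2 + k2 * z.2 ^+ 2).

(** Orbits may blow up in finite time, so the flow is given by its graph:
    [flow X p t q] means that [phi(p, t)] is defined and equal to [q]. *)
Definition flow (R : realType) (X : R * R -> R * R) (p : R * R) (t : R)
    (q : R * R) : Prop :=
  exists (a b : R) (c : R -> R * R),
    [/\ a < 0 < b, a < t < b, c 0 = p, c t = q &
        forall s : R, a < s < b -> is_derive s 1 c (X (c s))].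

Definition invariant (R : realType) (X : R * R -> R * R) (S : set (R * R))
    : Prop :=
  forall p, S p -> forall t : R, exists2 q, flow X p t q & S q.

Definition maximal_invariant (R : realType) (X : R * R -> R * R)
    (N I : set (R * R)) : Prop :=
  [/\ I `<=` N, invariant X I &
      forall S, S `<=` N -> invariant X S -> S `<=` I].

(** [C^oo] on [U] (used for open [U]): all iterated directional derivatives
    exist and are differentiable at the points of [U]. *)
Definition smooth_on (R : realType) (U : set (R * R)) (f : R * R -> R * R)
    : Prop :=
  forall (vs : seq (R * R)) (p : R * R), U p ->
    differentiable (foldr (fun v g => 'D_v g) f vs) p.

Definition diffeomorphism (R : realType) (U V : set (R * R))
    (h k : R * R -> R * R) : Prop :=
  [/\ open U /\ open V, smooth_on U h, smooth_on V k,
      forall p, U p -> V (h p) /\ k (h p) = p &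
      forall q, V q -> U (k q) /\ h (k q) = q].

(** [h] is a smooth chart of the plane with domain [U] that maps [U `&` N] onto
    the part of its image lying in the closed upper half-plane. *)
Definition adapted_chart (R : realType) (N U : set (R * R))
    (h : R * R -> R * R) : Prop :=
  (exists V k, diffeomorphism U V h k) /\
  forall p, U p -> (N p <-> 0 <= (h p).2).

Definition smooth_domain (R : realType) (N : set (R * R)) : Prop :=
  forall p, N p -> exists U h, U p /\ adapted_chart N U h.

Definition boundary (R : realType) (N : set (R * R)) : set (R * R) :=
  [set p | exists U h, [/\ U p, adapted_chart N U h & (h p).2 = 0]].

(** The tangent line to the boundary at [p] is the inverse image under the
    differential of an adapted chart of the horizontal axis. *)
Definition tangent_to_boundary (R : realType) (N : set (R * R)) (p v : R * R)
    : Prop :=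
  exists U h, [/\ U p, adapted_chart N U h, (h p).2 = 0 & ('D_v h p).2 = 0].

(** [S] is a smooth submanifold of codimension one of the boundary [n] of [N]:
    around each of its points it is the slice on which the first coordinate
    vanishes, in a chart of [n] (the first component of an adapted chart). *)
Definition codim1_in_boundary (R : realType) (N S : set (R * R)) : Prop :=
  forall p, S p -> exists U h,
    [/\ U p, adapted_chart N U h &
        forall q, U q -> (S q <-> boundary N q /\ (h q).1 = 0)].

Definition entry_set (R : realType) (X : R * R -> R * R) (N : set (R * R))
    : set (R * R) :=
  [set p | boundary N p /\ exists2 t : R, 0 < t &
     forall s q, - t < s < 0 -> flow X p s q -> ~ N q].

Definition exit_set (R : realType) (X : R * R -> R * R) (N : set (R * R))
    : set (R * R) :=
  [set p | boundary N p /\ exists2 t : R, 0 < t &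
     forall s q, 0 < s < t -> flow X p s q -> ~ N q].

Definition tangency_set (R : realType) (X : R * R -> R * R) (N : set (R * R))
    : set (R * R) :=
  [set p | boundary N p /\ tangent_to_boundary N p (X p)].

Definition forward_asymptotic (R : realType) (X : R * R -> R * R)
    (N : set (R * R)) : set (R * R) :=
  [set p | entry_set X N p /\
     forall t : R, 0 <= t -> exists2 q, flow X p t q & N q].

Definition backward_asymptotic (R : realType) (X : R * R -> R * R)
    (N : set (R * R)) : set (R * R) :=
  [set p | exit_set X N p /\
     forall t : R, t <= 0 -> exists2 q, flow X p t q & N q].

Definition isolating_block (R : realType) (X : R * R -> R * R)
    (I N : set (R * R)) : Prop :=
  [/\ compact N /\ smooth_domain N,
      maximal_invariant X N I,
      entry_set X N `&` exit_set X N = tangency_set X N &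
      codim1_in_boundary N (tangency_set X N)].

(** [q] is the point at which the forward orbit of [p] first exits from [N];
    the exit time [T] is zero when the orbit leaves [N] immediately. *)
Definition exit_point (R : realType) (X : R * R -> R * R) (N : set (R * R))
    (p q : R * R) : Prop :=
  exists T : R,
    [/\ 0 <= T, flow X p T q,
        forall s r, 0 <= s <= T -> flow X p s r -> N r &
        forall e : R, 0 < e -> exists s r,
          [/\ T < s < T + e, flow X p s r & ~ N r]].

(** [f] restricted to [n^+] is a continuous map into [n^-] that extends the
    map [pi], whose graph over [n^+ \ a^+] is [exit_point X N]. *)
Definition continuous_extension (R : realType) (X : R * R -> R * R)
    (N : set (R * R)) (f : R * R -> R * R) : Prop :=
  [/\ forall p, entry_set X N p -> exit_set X N (f p),
      {within entry_set X N, continuous f} &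
      forall p, (entry_set X N `\` forward_asymptotic X N) p ->
        exit_point X N p (f p)].

Definition C0_regularisable (R : realType) (X : R * R -> R * R) : Prop :=
  exists N, isolating_block X [set 0] N /\
    exists f, continuous_extension X N f /\
      forall g, continuous_extension X N g ->
        forall p, entry_set X N p -> g p = f p.

(** The field [T . X], where [T'] is the inverse of [T]. *)
Definition push_field (R : realType) (T T' : {linear (R * R)%type -> (R * R)%type})
    (X : R * R -> R * R) (z : R * R) : R * R :=
  T (X (T' z)).

(* Main.v *)
(* The zeros of the directional polynomial are the invariant lines, and they are simple. If there
   is one, then X is linearly equivalent to [canonical_field k1 k2] with k1 <> 0; if there are
   three, then X is linearly equivalent to the Lotka-Volterra field
   (x (a x + (d + 1) y), y ((a + 1) x + d y)), where a, d and - (a + d + 1) do not vanish and are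
   permuted by the linear symmetries of the family.

   If k1 > 0, or if a, d > 0, an explicit first integral shows that a sector is elliptic: complete
   orbits of arbitrarily small size contradict the maximality of the invariant set {0}, so there
   is no isolating block. If a, d < 0 < a + d + 1, every sector is hyperbolic; orbits entering near
   the positive y axis leave along one or the other of two neighbouring invariant half-lines, so
   the exit map has no continuous extension. If a, d, a + d + 1 < 0, then all orbits near the
   diagonal are asymptotic to the origin, and a continuous extension can be modified along an arc
   of asymptotic entry points, by inserting a loop that starts at an exit point: it is not unique.

   If k1 < 0, the unit disc is an isolating block: r^2 has derivative 2 r^2 (k1 x + k2 y), and
   k1 x + k2 y increases where it vanishes. By a first integral, sg(y) |y|^(- k1) exp(k2 atan(x/y))
   takes the same value at an entry point and at its exit point; being continuous on the circle
   and injective on the exit arc, it forces the exit map to be continuous. The only asymptotic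
   entry point is (1, 0), and it is a limit of other entry points, whence uniqueness. *)
Require Import Defs.
From HB Require Import structures.
From mathcomp Require Import all_boot all_order all_algebra.
From mathcomp Require Import all_classical all_reals all_analysis.
From mathcomp Require Import ring lra.

Set Implicit Arguments.
Unset Strict Implicit.
Unset Printing Implicit Defensive.

Import Order.TTheory GRing.Theory Num.Theory.
Import numFieldNormedType.Exports.

Local Open Scope classical_set_scope.
Local Open Scope ring_scope.

(** * Flows of planar fields *)

(** In the negative cases the block [N] is arbitrary and little is known of it: the origin is
    interior, and each invariant half-line on which the field does not vanish starts with a segment
    of [N] whose end point is a boundary point crossed transversally. Transversality is forced by
    the axiom that the points which are both entry and exit points are exactly the tangency points.
    It fixes the sign of the normal derivative near that end point, and only there are orbits
    followed across the boundary. An asymptotic entry point constrains an extension through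
    continuity alone. So continuity is tested at such a point between two hyperbolic sectors, and
    uniqueness fails at such a point all of whose neighbours are asymptotic. Among the nonzero
    numbers [a], [d], [- (a + d + 1)] two have the same sign, and the symmetries bring these to the
    places of [a] and [d]; hence the three cases suffice. Orbits may blow up, so the flow is
    partial: an orbit is known to be complete only once it has been bounded. *)

Lemma is_derive_cvgP (R : realType) (V W : normedModType R) (f : V -> W)
    (a v : V) (df : W) :
  is_derive a v f df <-> h^-1 *: (f (h *: v + a) - f a) @[h --> 0^'] --> df.
Proof.
split=> [[fd <-]|h]; first exact: fd.
by apply: DeriveDef; [apply/cvg_ex; exists df|exact: (cvg_lim _ h)].
Qed.

Lemma is_derive_pairP (R : realType) (V : normedModType R) (c : V -> R * R)
    (t u : V) (v : R * R) :
  is_derive t u c v <->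
  is_derive t u (fun s => (c s).1) v.1 /\ is_derive t u (fun s => (c s).2) v.2.
Proof.
rewrite !is_derive_cvgP; split=> [h|[h1 h2]].
  split.
    exact: (cvg_comp _ _ h (cvg_fst (F := nbhs v.1) (G := nbhs v.2))).
  exact: (cvg_comp _ _ h (cvg_snd (F := nbhs v.1) (G := nbhs v.2))).
rewrite [v]surjective_pairing.
exact: (cvg_pair h1 h2).
Qed.

(** * Mean value and Gronwall estimates on an interval *)

Section RealCalculus.
Variable R : realType.
Implicit Types (f df : R -> R) (a b t : R).

Lemma mean_value f df a b : a < b ->
  (forall t, a <= t <= b -> is_derive t 1 f (df t)) ->
  exists2 t, a < t < b & f b - f a = df t * (b - a).
Proof.
move=> ab fd.
have [t tab e] : exists2 t, t \in `]a, b[%R & f b - f a = df t * (b - a).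
  apply: MVT => //.
    by move=> x; rewrite in_itv/= => /andP[x1 x2]; apply: fd; rewrite !ltW.
  apply: derivable_within_continuous => x; rewrite in_itv/= => /fd h.
  exact: ex_derive.
by exists t.
Qed.

Lemma derive_le_slope f df a b k : a <= b ->
  (forall t, a <= t <= b -> is_derive t 1 f (df t)) ->
  (forall t, a <= t <= b -> df t <= k) -> f b <= f a + k * (b - a).
Proof.
rewrite le_eqVlt => /predU1P[-> _ _|ab fd dfk]; first by rewrite subrr mulr0 addr0.
have [t /andP[t1 t2] e] := mean_value ab fd.
rewrite -lerBlDl e ler_wpM2r ?subr_ge0 ?(ltW ab)//.
by apply: dfk; rewrite !ltW.
Qed.

Lemma derive_ge_slope f df a b k : a <= b ->
  (forall t, a <= t <= b -> is_derive t 1 f (df t)) ->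
  (forall t, a <= t <= b -> k <= df t) -> f a + k * (b - a) <= f b.
Proof.
rewrite le_eqVlt => /predU1P[-> _ _|ab fd dfk]; first by rewrite subrr mulr0 addr0.
have [t /andP[t1 t2] e] := mean_value ab fd.
rewrite -lerBrDl e ler_wpM2r ?subr_ge0 ?(ltW ab)//.
by apply: dfk; rewrite !ltW.
Qed.

Lemma derive_lt f df a b : a < b ->
  (forall t, a <= t <= b -> is_derive t 1 f (df t)) ->
  (forall t, a < t < b -> df t < 0) -> f b < f a.
Proof.
move=> ab fd dfk; have [t tab e] := mean_value ab fd.
by rewrite -subr_lt0 e nmulr_rlt0 ?dfk// subr_gt0.
Qed.

Lemma derive_gt f df a b : a < b ->
  (forall t, a <= t <= b -> is_derive t 1 f (df t)) ->
  (forall t, a < t < b -> 0 < df t) -> f a < f b.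
Proof.
move=> ab fd dfk; have [t tab e] := mean_value ab fd.
by rewrite -subr_gt0 e mulr_gt0 ?dfk// subr_gt0.
Qed.

Lemma derive0_eq f a b : a <= b ->
  (forall t, a <= t <= b -> is_derive t 1 f 0) -> f b = f a.
Proof.
rewrite le_eqVlt => /predU1P[-> //|ab fd].
have [t _] := @mean_value f (fun=> 0) a b ab fd.
by rewrite mul0r => /eqP; rewrite subr_eq0 => /eqP.
Qed.

(** Multiplied by [expR (- K * (t - a))] the function decreases, multiplied by [expR (K * (t - a))]
    it increases. Bounding [|df|] rather than [df] controls both directions of time, which gives
    uniqueness of solutions backwards as well. *)
Lemma gronwall f df (K a b : R) : a <= b ->
  (forall t, a <= t <= b -> is_derive t 1 f (df t)) ->
  (forall t, a <= t <= b -> `|df t| <= K * f t) ->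
  f b <= expR (K * (b - a)) * f a /\ f a <= expR (K * (b - a)) * f b.
Proof.
move=> ab fd dfK.
have dE (k t : R) : is_derive t 1 (fun u => expR (k * (u - a))) (k * expR (k * (t - a))).
  by apply: is_derive_eq; rewrite /GRing.scale/=; ring.
have d1 (k t : R) : a <= t <= b -> is_derive t 1 (fun u => expR (k * (u - a)) * f u)
    (expR (k * (t - a)) * (df t + k * f t)).
  move=> tab; have := dE k t; have := fd _ tab => h1 h2.
  by apply: is_derive_eq; rewrite /GRing.scale/=; ring.
have E0 : expR (K * (a - a)) = 1 :> R by rewrite subrr mulr0 expR0.
have E0' : expR (- K * (a - a)) = 1 :> R by rewrite subrr mulr0 expR0.
have EV : expR (K * (b - a)) * expR (- K * (b - a)) = 1 by rewrite mulNr expRxMexpNx_1.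
split.
- have := @derive_le_slope _ _ a b 0 ab (d1 (- K)).
  rewrite E0' mul0r addr0 mul1r => h.
  have {}h : expR (- K * (b - a)) * f b <= f a.
    apply: h => t tab; rewrite pmulr_rle0 ?expR_gt0//.
    have := dfK _ tab; rewrite ler_norml => /andP[_]; lra.
  have := ler_wpM2l (expR_ge0 (K * (b - a))) h.
  by rewrite mulrA EV mul1r.
- have := @derive_ge_slope _ _ a b 0 ab (d1 K).
  rewrite E0 mul0r addr0 mul1r; apply => t tab.
  rewrite pmulr_rge0 ?expR_gt0//.
  have := dfK _ tab; rewrite ler_norml => /andP[]; lra.
Qed.

End RealCalculus.

(** * Uniqueness and gluing of solutions, and the partial flow *)

Section Flow.
Variables (R : realType) (X : R * R -> R * R).
Implicit Types (p q : R * R) (c : R -> R * R) (a b s t : R).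

Definition solution a b c := forall s, a < s < b -> is_derive s 1 c (X (c s)).

Definition locally_lipschitz := forall M : R, exists L : R,
  forall p q, `|p| <= M -> `|q| <= M -> `|X p - X q| <= L * `|p - q|.

(** The existence time [e] is uniform over a ball; this is what makes bounded orbits complete. *)
Definition locally_solvable := forall M : R, exists2 e : R, 0 < e &
  forall p, `|p| <= M -> exists2 c, c 0 = p & solution (- e) e c.

Lemma solution_shift a b c t : solution a b c ->
  solution (a - t) (b - t) (fun u => c (u + t)).
Proof.
move=> h s /andP[s1 s2]; have /h/is_derive_cvgP hs : a < s + t < b by lra.
apply/is_derive_cvgP; under eq_fun do rewrite -addrA.
exact: hs.
Qed.

Lemma solution_continuous a b c : solution a b c ->
  forall s, a < s < b -> {for s, continuous c}.
Proof.
move=> h s /h hs; apply: differentiable_continuous.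
by apply/derivable1_diffP; apply: ex_derive.
Qed.

Lemma sup_normE (p : R * R) : `|p| = Num.max `|p.1| `|p.2|.
Proof. by []. Qed.

Lemma solution_bounded a b c s t : solution a b c -> a < s -> s <= t -> t < b ->
  exists M : R, forall u, s <= u <= t -> `|c u| <= M.
Proof.
move=> h as_ st tb.
have cc : {within `[s, t], continuous (fun u => `|c u|)}.
  apply: continuous_in_subspaceT => u; rewrite inE/= in_itv/= => /andP[u1 u2].
  apply: continuous_comp; last exact: norm_continuous.
  by apply: (solution_continuous h); lra.
have [u _ hu] := EVT_max st cc.
by exists `|c u| => v vst; apply: hu; rewrite in_itv.
Qed.

(** The Euclidean square replaces the sup norm of the product because it is differentiable along
    pairs of solutions. *)
Definition sqdist (p q : R * R) := (p.1 - q.1) ^+ 2 + (p.2 - q.2) ^+ 2.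

Lemma sqdist_ge p q : `|p - q| ^+ 2 <= sqdist p q.
Proof.
rewrite sup_normE /sqdist/=.
by case: (leP `|p.1 - q.1| `|p.2 - q.2|) => _; rewrite real_normK ?num_real// ?lerDl ?lerDr sqr_ge0.
Qed.

Lemma sqdist_le p q : sqdist p q <= 2 * `|p - q| ^+ 2.
Proof.
have h1 : `|p.1 - q.1| <= `|p - q| by rewrite [leRHS]sup_normE le_max lexx.
have h2 : `|p.2 - q.2| <= `|p - q| by rewrite [leRHS]sup_normE le_max lexx orbT.
rewrite /sqdist -(real_normK (num_real (p.1 - q.1))).
rewrite -(real_normK (num_real (p.2 - q.2))) mulr_natl mulr2n.
by rewrite lerD// ler_sqr ?nnegrE// (le_trans _ h1)// (le_trans _ h2).
Qed.

(** The derivative of [sqdist] is a sum of two products, each at most twice the distance times [L]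
    times the distance, and the squared sup distance is at most [sqdist]; hence the rate [4 * L]. *)
Lemma sqdist_gronwall M L a b c1 c2 s t :
  (forall p q, `|p| <= M -> `|q| <= M -> `|X p - X q| <= L * `|p - q|) ->
  solution a b c1 -> solution a b c2 -> a < s -> s <= t -> t < b ->
  (forall u, s <= u <= t -> `|c1 u| <= M /\ `|c2 u| <= M) ->
  sqdist (c1 t) (c2 t) <= expR (4 * L * (t - s)) * sqdist (c1 s) (c2 s) /\
  sqdist (c1 s) (c2 s) <= expR (4 * L * (t - s)) * sqdist (c1 t) (c2 t).
Proof.
move=> lip h1 h2 as_ st tb bd.
pose dD u := 2 * ((c1 u).1 - (c2 u).1) * ((X (c1 u)).1 - (X (c2 u)).1) +
             2 * ((c1 u).2 - (c2 u).2) * ((X (c1 u)).2 - (X (c2 u)).2).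
apply: (@gronwall _ (fun u => sqdist (c1 u) (c2 u)) dD) => // u ust.
  have uab : a < u < b by lra.
  have /is_derive_pairP[d11 d12] := h1 _ uab.
  have /is_derive_pairP[d21 d22] := h2 _ uab.
  by apply: is_derive_eq; rewrite /dD /GRing.scale/=; ring.
have [b1 b2] := bd _ ust; have lp := lip _ _ b1 b2.
have g := sqdist_ge (c1 u) (c2 u).
set d := `|c1 u - c2 u| in lp g.
have x1 : `|(c1 u).1 - (c2 u).1| <= d by rewrite [leRHS]sup_normE le_max lexx.
have x2 : `|(c1 u).2 - (c2 u).2| <= d by rewrite [leRHS]sup_normE le_max lexx orbT.
have X1 : `|(X (c1 u)).1 - (X (c2 u)).1| <= L * d.
  by rewrite (le_trans _ lp)// [leRHS]sup_normE le_max lexx.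
have X2 : `|(X (c1 u)).2 - (X (c2 u)).2| <= L * d.
  by rewrite (le_trans _ lp)// [leRHS]sup_normE le_max lexx orbT.
have d0 : 0 <= d := normr_ge0 _.
have Ld0 : 0 <= L * d by rewrite (le_trans _ lp).
have e1 : `|dD u| <= 4 * (d * (L * d)).
  rewrite /dD (le_trans (ler_normD _ _))// !normrM !normr_nat.
  have := ler_pM (normr_ge0 _) (normr_ge0 _) x1 X1.
  have := ler_pM (normr_ge0 _) (normr_ge0 _) x2 X2.
  lra.
apply: (le_trans e1).
(* [L] comes without a sign. If it is negative, the Lipschitz bound itself forces the two points to
   coincide. *)
have [L0|L0] := leP 0 L.
  by have := ler_wpM2l L0 g; rewrite expr2; lra.
have dz : d = 0.
  apply/eqP; apply/negPn/negP => dn0; have : 0 < d by rewrite lt0r dn0.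
  by move=> dp; move: Ld0; rewrite nmulr_rge0// leNgt dp.
have cc : c1 u = c2 u by apply/eqP; rewrite -subr_eq0 -normr_eq0 -/d dz.
by rewrite dz mul0r mulr0 cc /sqdist !subrr expr0n/= addr0 mulr0.
Qed.

Hypothesis lipX : locally_lipschitz.

Lemma sqdist_eq0 p q : sqdist p q <= 0 -> p = q.
Proof.
move=> h; have := le_trans (sqdist_ge p q) h => h'.
have : `|p - q| ^+ 2 == 0 by rewrite eq_le h' sqr_ge0.
by rewrite sqrf_eq0 normr_eq0 subr_eq0 => /eqP.
Qed.

Lemma solution_unique a b c1 c2 t0 : solution a b c1 -> solution a b c2 ->
  a < t0 < b -> c1 t0 = c2 t0 -> forall t, a < t < b -> c1 t = c2 t.
Proof.
move=> h1 h2 /andP[at0 t0b] e t /andP[at_ tb].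
have Z p : sqdist p p = 0 by rewrite /sqdist !subrr expr0n/= addr0.
have [st|/ltW ts] := leP t0 t.
- have [M1 b1] := solution_bounded h1 at0 st tb.
  have [M2 b2] := solution_bounded h2 at0 st tb.
  have [L lip] := lipX (Num.max M1 M2).
  have [||||g _] := sqdist_gronwall lip h1 h2 (s := t0) (t := t) => //.
    by move=> u ust; rewrite !le_max b1// b2// orbT.
  by apply: sqdist_eq0; rewrite (le_trans g)// e Z mulr0.
- have [M1 b1] := solution_bounded h1 at_ ts t0b.
  have [M2 b2] := solution_bounded h2 at_ ts t0b.
  have [L lip] := lipX (Num.max M1 M2).
  have [||||_ g] := sqdist_gronwall lip h1 h2 (s := t) (t := t0) => //.
    by move=> u ust; rewrite !le_max b1// b2// orbT.
  by apply: sqdist_eq0; rewrite (le_trans g)// e Z mulr0.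
Qed.

Lemma solution_sub a b a' b' c : a <= a' -> b' <= b ->
  solution a b c -> solution a' b' c.
Proof. by move=> h1 h2 h s hs; apply: h; lra. Qed.

Lemma flow_unique p t q q' : flow X p t q -> flow X p t q' -> q = q'.
Proof.
move=> [a [b [c [ab tab c0 ct h]]]] [a' [b' [c' [ab' tab' c0' ct' h']]]].
rewrite -ct -ct'; pose A := Num.max a a'; pose B := Num.min b b'.
have hA : a <= A /\ a' <= A by rewrite !le_max !lexx orbT.
have hB : B <= b /\ B <= b' by rewrite !ge_min !lexx orbT.
have hA0 : A < 0 /\ A < t by rewrite !gt_max; split; apply/andP; split; lra.
have hB0 : 0 < B /\ t < B by rewrite !lt_min; split; apply/andP; split; lra.
apply: (@solution_unique A B c c' 0); last lra.
- by apply: (@solution_sub a b); [case: hA|case: hB|].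
- by apply: (@solution_sub a' b'); [case: hA|case: hB|].
- lra.
- by rewrite c0 c0'.
Qed.

(** Both solutions are defined at time 0, and [s] lies between 0 and one of [t], [u]. *)
Lemma flow_between p t q s u r : flow X p t q -> flow X p u r ->
  (t <= s <= u) || (u <= s <= t) -> exists q', flow X p s q'.
Proof.
move=> [a [b [c [ab tab c0 ct h]]]] [a' [b' [c' [ab' tab' c0' ct' h']]]] hs.
have [s1|s1] := ltP a s; have [s2|s2] := ltP s b.
- by exists (c s); exists a, b, c; split=> //; rewrite s1.
- by exists (c' s); exists a', b', c'; split=> //; case/orP: hs; lra.
- by exists (c' s); exists a', b', c'; split=> //; case/orP: hs; lra.
- lra.
Qed.

Lemma flow_shift a b c s t : solution a b c -> a < s < b -> a < t < b ->
  flow X (c s) (t - s) (c t).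
Proof.
move=> h sab tab; exists (a - s), (b - s), (fun u => c (u + s)); split.
- lra.
- lra.
- by rewrite add0r.
- by rewrite subrK.
- exact: solution_shift.
Qed.

Lemma flow_opp p t q : flow X p t q -> flow X q (- t) p.
Proof.
move=> [a [b [c [ab tab c0 ct h]]]]; rewrite -c0 -ct -[- t]add0r.
exact: (flow_shift h).
Qed.

Lemma solution_glue a1 b1 c1 a2 b2 c2 s : solution a1 b1 c1 -> solution a2 b2 c2 ->
  a1 < s < b1 -> a2 < s < b2 -> c1 s = c2 s ->
  exists c, [/\ solution (Num.min a1 a2) (Num.max b1 b2) c,
    forall u, a1 < u < b1 -> c u = c1 u & forall u, a2 < u < b2 -> c u = c2 u].
Proof.
move=> h1 h2 s1 s2 e.
have E u : a1 < u < b1 -> a2 < u < b2 -> c1 u = c2 u.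
  move=> u1 u2; apply: (@solution_unique (Num.max a1 a2) (Num.min b1 b2) c1 c2 s).
  - by apply: solution_sub h1; rewrite ?le_max ?ge_min lexx.
  - by apply: solution_sub h2; rewrite ?le_max ?ge_min lexx orbT.
  - by rewrite gt_max lt_min; apply/andP; split; apply/andP; split; lra.
  - by [].
  - by rewrite gt_max lt_min; apply/andP; split; apply/andP; split; lra.
pose c u := if a1 < u < b1 then c1 u else c2 u.
have C1 u : a1 < u < b1 -> c u = c1 u by rewrite /c => ->.
have C2 u : a2 < u < b2 -> c u = c2 u.
  by rewrite /c; case: ifP => // u1 u2; exact: E.
have loc a b c' (u : R) : solution a b c' -> a < u < b ->
    (forall v, a < v < b -> c v = c' v) -> is_derive u 1 c (X (c u)).
  move=> h /[dup] uab /andP[au ub] cE; rewrite (cE _ uab).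
  apply: (@near_eq_is_derive _ _ _ c'); last exact: h.
  have : u \in `]a, b[ by rewrite in_itv/= au ub.
  move=> /near_in_itvoo; apply: filterS => v; rewrite in_itv/= => vab.
  by rewrite cE.
exists c; split=> // u; rewrite gt_min lt_max.
have [u1|u1] := boolP (a1 < u < b1); first by move=> _; exact: (loc _ _ _ u h1).
move=> u12; apply: (loc _ _ _ u h2) => //.
by move: u1 u12; rewrite negb_and -!leNgt => /orP[] ? /andP[/orP[] ? /orP[] ?]; lra.
Qed.

Lemma flow_add p s q t r : flow X p s q -> flow X q t r -> flow X p (s + t) r.
Proof.
move=> [a1 [b1 [c1 [ab1 tab1 c10 c1t h1]]]] [a2 [b2 [c2 [ab2 tab2 c20 c2t h2]]]].
have h2' := @solution_shift _ _ _ (- s) h2.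
have [||c [hc cE1 cE2]] := solution_glue h1 h2' tab1; first by lra.
  by rewrite subrr c20.
exists (Num.min a1 (a2 - - s)), (Num.max b1 (b2 - - s)), c; split=> //.
- by rewrite gt_min lt_max; apply/andP; split; apply/orP; left; lra.
- by rewrite gt_min lt_max; apply/andP; split; apply/orP; right; lra.
- by rewrite cE1.
- by rewrite cE2 -?c2t; [congr c2; ring|lra].
Qed.

Lemma flow0 p : locally_solvable -> flow X p 0 p.
Proof.
move=> /(_ `|p|)[e e0 /(_ p (lexx _))[c c0 h]].
by exists (- e), e, c; split=> //; lra.
Qed.

(** The value is the default [0] where the orbit is no longer defined, so uses of [phi] are guarded
    by [dom]. *)
Definition phi p t := xget 0 [set q | flow X p t q].
Definition dom p t := exists q, flow X p t q.

Lemma phiE p t q : flow X p t q -> phi p t = q.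
Proof.
move=> h; rewrite /phi; case: xgetP => [q' _ h'|/(_ q)//].
exact: (flow_unique h' h).
Qed.

Lemma dom_flow p t : dom p t -> flow X p t (phi p t).
Proof. by move=> [q h]; rewrite (phiE h). Qed.

Lemma phi_derive p t : dom p t -> is_derive t 1 (phi p) (X (phi p t)).
Proof.
move=> [q [a [b [c [ab tab c0 ct h]]]]].
have E u : a < u < b -> phi p u = c u.
  by move=> uab; apply: phiE; exists a, b, c.
rewrite E//; apply: (@near_eq_is_derive _ _ _ c); last exact: h.
have : t \in `]a, b[ by rewrite in_itv.
by move=> /near_in_itvoo; apply: filterS => v; rewrite in_itv/= => /E.
Qed.

Lemma dom_near p t : dom p t -> \forall u \near t, dom p u.
Proof.
move=> [q [a [b [c [ab tab c0 ct h]]]]].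
have : t \in `]a, b[ by rewrite in_itv.
move=> /near_in_itvoo; apply: filterS => v; rewrite in_itv/= => vab.
by exists (c v), a, b, c.
Qed.

Lemma phi_continuous p t : dom p t -> {for t, continuous (phi p)}.
Proof.
move=> /phi_derive h; apply: differentiable_continuous.
by apply/derivable1_diffP; apply: ex_derive.
Qed.

Hypothesis solX : locally_solvable.

Lemma dom0 p : dom p 0.
Proof. by exists p; exact: flow0. Qed.

Lemma phi0 p : phi p 0 = p.
Proof. by apply: phiE; exact: flow0. Qed.

Lemma dom_between p t s : dom p t -> (0 <= s <= t) || (t <= s <= 0) -> dom p s.
Proof. by move=> [q h] hs; apply: (flow_between (flow0 p solX) h). Qed.

Lemma phiD p s t : dom p s -> dom (phi p s) t ->
  dom p (s + t) /\ phi p (s + t) = phi (phi p s) t.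
Proof.
move=> /dom_flow h /dom_flow h'; have := flow_add h h' => h''.
by split; [exists (phi (phi p s) t)|exact: phiE].
Qed.

(** On the ball of radius [M] every solution lives for a common time [e], so the orbit can be
    prolonged by steps of [e / 2] indefinitely. The boolean [sg] selects the direction of time. *)
Lemma dom_bounded (sg : bool) p (M : R) :
  (forall t q, 0 <= t -> flow X p ((-1) ^+ sg * t) q -> `|q| <= M) ->
  forall t, 0 <= t -> dom p ((-1) ^+ sg * t).
Proof.
move=> bd; have [e e0 he] := solX M.
have step n : dom p ((-1) ^+ sg * (n%:R * (e / 2))).
  elim: n => [|n [q hq]]; first by rewrite mul0r mulr0; exact: dom0.
  have nn : 0 <= n%:R * (e / 2) by rewrite mulr_ge0// divr_ge0// ltW.
  have [c c0 hc] := he _ (bd _ _ nn hq).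
  exists (c ((-1) ^+ sg * (e / 2))); rewrite -addn1 natrD mulrDl mulrDr mul1r.
  apply: (flow_add hq); exists (- e), e, c; split=> //; first lra.
  by case: sg {bd hq}; rewrite ?expr0 ?expr1; lra.
move=> t t0.
have e2 : 0 < e / 2 by rewrite divr_gt0.
have [n hn] : exists n : nat, t / (e / 2) <= n%:R.
  by exists (Num.bound (t / (e / 2))); rewrite ltW// archi_boundP// divr_ge0// ltW.
apply: (dom_between (step n)); rewrite ler_pdivrMr// in hn.
by case: sg {bd step}; rewrite ?expr0 ?expr1; lra.
Qed.

End Flow.

(** * Quadratic fields are locally solvable *)

Section CauchyProduct.
Variable R : realType.
Implicit Types (u v : nat -> R).

Definition convolution u v n := \sum_(k < n.+1) u k * v (n - k)%N.

Lemma series_convolution u v n :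
  series (convolution u v) n = \sum_(k < n) u k * series v (n - k)%N.
Proof.
elim: n => [|n IH]; first by rewrite /series/= big_nat big_pred0// big_ord0.
rewrite seriesSr IH /convolution [RHS]big_ord_recr/= subSnn.
rewrite [X in _ + X]big_ord_recr/= subnn addrA; congr (_ + _); last first.
  by rewrite seriesEnat/= big_nat1.
rewrite -big_split/=; apply: eq_bigr => k _.
by rewrite -mulrDr subSn 1?ltnW// seriesSr.
Qed.

(** The product of the partial sums differs from the partial sum of the convolution by a sum of [n]
    terms, each at most [n * A ^+ 2 * 16^-1 ^+ n]. Since [n <= 2 ^ n], the total is at most
    [A ^+ 2 * 4^-1 ^+ n]: the ratio 1/16 leaves room to absorb the factor [n * n]. *)
Lemma cvg_convolution u v (A : R) :
  (forall n, `|u n| <= A * 16^-1 ^+ n) -> (forall n, `|v n| <= A * 16^-1 ^+ n) ->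
  series (convolution u v) @ \oo --> limn (series u) * limn (series v).
Proof.
move=> hu hv.
have A0 : 0 <= A by have := hu 0; rewrite expr0 mulr1; exact: le_trans.
have i16 : `|16^-1 : R| < 1 by rewrite ger0_norm ?invr_ge0// invf_lt1// ltr1n.
have cv (w : nat -> R) : (forall n, `|w n| <= A * 16^-1 ^+ n) -> cvgn (series w).
  move=> hw; apply: normed_cvg.
  apply: (@series_le_cvg _ _ (geometric A 16^-1)) => //=.
    by move=> n; rewrite mulr_ge0// exprn_ge0// invr_ge0.
  exact: is_cvg_geometric_series.
have cuv := cvgM (cv _ hu) (cv _ hv).
suff d : (series u \* series v \- series (convolution u v)) @ \oo --> (0 : R).
  have E : series (convolution u v) =
      (series u \* series v) - (series u \* series v \- series (convolution u v)).
    by apply/funext => n; rewrite !fctE opprB addrC subrK.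
  rewrite E -[X in _ --> X]subr0; exact: cvgB (cuv _) d.
apply/cvgr0Pnorm_le => e e0.
have g0 : geometric (A ^+ 2) (4^-1 : R) @ \oo --> 0.
  by apply: cvg_geometric; rewrite ger0_norm ?invr_ge0// invf_lt1// ltr1n.
near=> n.
have : `|geometric (A ^+ 2) (4^-1 : R) n| <= e.
  by near: n; exact: cvgr0_norm_le g0 _ e0.
apply: le_trans; rewrite /= (@ger0_norm _ (A ^+ 2 * _)); last first.
  by rewrite mulr_ge0 ?sqr_ge0// exprn_ge0// invr_ge0.
rewrite series_convolution [in series u n]seriesEord/= mulr_suml -sumrB.
apply: (le_trans (ler_norm_sum _ _ _)).
have T (k : 'I_n) : `|u k * series v n - u k * series v (n - k)%N| <= n%:R * (A ^+ 2 * 16^-1 ^+ n).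
  rewrite -mulrBr normrM sub_series leq_subr.
  have e1 : `|\sum_(n - k <= j < n) v j| <= \sum_(n - k <= j < n) A * 16^-1 ^+ (n - k).
    apply: (le_trans (ler_norm_sum _ _ _)); apply: ler_sum_nat => j /andP[j1 j2].
    apply: (le_trans (hv j)); rewrite ler_wpM2l// ler_wiXn2l ?invr_ge0//.
    by rewrite invf_le1// ler1n.
  rewrite sumr_const_nat subKn 1?ltnW// -(mulr_natl _ k) in e1.
  apply: (le_trans (ler_pM _ _ (hu k) e1)) => //.
  rewrite mulrCA mulrACA -expr2 -exprD subnKC 1?ltnW//.
  by rewrite ler_wpM2r ?ler_nat 1?ltnW// mulr_ge0 ?sqr_ge0.
apply: (le_trans (ler_sum _ (fun k _ => T k))).
have -> : \sum_(i < n) n%:R * (A ^+ 2 * 16^-1 ^+ n) =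
    A ^+ 2 * (n%:R * n%:R * 16^-1 ^+ n) :> R.
  by rewrite sumr_const card_ord -[LHS]mulr_natl; ring.
rewrite ler_wpM2l ?sqr_ge0//.
have -> : (16^-1 : R) = 4^-1 * 4^-1 by rewrite -invfM -natrM.
rewrite exprMn mulrA -[leRHS]mul1r ler_wpM2r// ?exprn_ge0 ?invr_ge0//.
rewrite exprVn ler_pdivrMr ?exprn_gt0// mul1r -natrM -natrX ler_nat.
have -> : (4 ^ n = 2 ^ n * 2 ^ n)%N by rewrite -expnMn.
by rewrite leq_mul// ltnW// ltn_expl.
Unshelve. all: by end_near. Qed.

End CauchyProduct.

(** * Lipschitz bounds and power series solutions of quadratic fields *)

Section QuadraticField.
Variable R : realType.

Definition quadratic_field (p0 p1 p2 q0 q1 q2 : R) (z : R * R) : R * R :=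
  (p0 * z.1 ^+ 2 + p1 * z.1 * z.2 + p2 * z.2 ^+ 2,
   q0 * z.1 ^+ 2 + q1 * z.1 * z.2 + q2 * z.2 ^+ 2).

Variables p0 p1 p2 q0 q1 q2 : R.
Let X := quadratic_field p0 p1 p2 q0 q1 q2.

Let C := 1 + (`|p0| + `|p1| + `|p2| + `|q0| + `|q1| + `|q2|).

Let C_gt0 : 0 < C.
Proof. by rewrite /C ltr_pwDl// !addr_ge0. Qed.

Lemma quadratic_field_lipschitz : locally_lipschitz X.
Proof.
move=> M; exists (2 * `|M| * C) => p q pM qM.
have h (c0 c1 c2 : R) : `|c0| + `|c1| + `|c2| <= C ->
    `|c0 * p.1 ^+ 2 + c1 * p.1 * p.2 + c2 * p.2 ^+ 2 -
      (c0 * q.1 ^+ 2 + c1 * q.1 * q.2 + c2 * q.2 ^+ 2)| <= 2 * `|M| * C * `|p - q|.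
  move=> cC.
  have M0 : M <= `|M| := ler_norm _.
  have pp := sup_normE p; have qq := sup_normE q; have dd := sup_normE (p - q).
  have a1 : `|p.1| <= `|M| by rewrite (le_trans _ (le_trans pM M0))// pp le_max lexx.
  have a2 : `|p.2| <= `|M| by rewrite (le_trans _ (le_trans pM M0))// pp le_max lexx orbT.
  have b1 : `|q.1| <= `|M| by rewrite (le_trans _ (le_trans qM M0))// qq le_max lexx.
  have b2 : `|q.2| <= `|M| by rewrite (le_trans _ (le_trans qM M0))// qq le_max lexx orbT.
  set d := `|p - q|.
  have d1 : `|p.1 - q.1| <= d by rewrite /d dd le_max lexx.
  have d2 : `|p.2 - q.2| <= d by rewrite /d dd le_max lexx orbT.
  have d0 : 0 <= d := normr_ge0 _.
  have -> : c0 * p.1 ^+ 2 + c1 * p.1 * p.2 + c2 * p.2 ^+ 2 -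
      (c0 * q.1 ^+ 2 + c1 * q.1 * q.2 + c2 * q.2 ^+ 2) =
      c0 * ((p.1 - q.1) * (p.1 + q.1)) + c1 * ((p.1 - q.1) * p.2 + q.1 * (p.2 - q.2))
       + c2 * ((p.2 - q.2) * (p.2 + q.2)) by ring.
  have B (x y : R) : `|x| <= `|M| -> `|y| <= `|M| -> `|x + y| <= 2 * `|M|.
    by move=> hx hy; rewrite (le_trans (ler_normD _ _))// mulr_natl mulr2n lerD.
  have t0 : `|c0 * ((p.1 - q.1) * (p.1 + q.1))| <= `|c0| * (2 * `|M| * d).
    by rewrite !normrM ler_wpM2l// mulrC ler_pM// B.
  have t2 : `|c2 * ((p.2 - q.2) * (p.2 + q.2))| <= `|c2| * (2 * `|M| * d).
    by rewrite !normrM ler_wpM2l// mulrC ler_pM// B.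
  have t1 : `|c1 * ((p.1 - q.1) * p.2 + q.1 * (p.2 - q.2))| <= `|c1| * (2 * `|M| * d).
    rewrite normrM ler_wpM2l// (le_trans (ler_normD _ _))// !normrM.
    rewrite -mulrA mulr_natl mulr2n lerD//; last by rewrite ler_pM.
    by rewrite mulrC ler_pM.
  apply: (le_trans (ler_normD _ _)).
  apply: (le_trans (lerD (ler_normD _ _) (lexx _))).
  apply: (le_trans (lerD (lerD t0 t1) t2)).
  rewrite -!mulrDl [leRHS](_ : _ = C * (2 * `|M| * d)); last by ring.
  by rewrite ler_wpM2r// !mulr_ge0.
rewrite sup_normE ge_max; apply/andP; split; apply: h; rewrite /C.
all: have := normr_ge0 p0; have := normr_ge0 p1; have := normr_ge0 p2.
all: have := normr_ge0 q0; have := normr_ge0 q1; have := normr_ge0 q2; lra.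
Qed.

(** A bilinear map, not symmetric, with [B u u = X u]: applied to power series it turns the field
    into Cauchy products. *)
Let B (u v : R * R) : R * R :=
  (p0 * (u.1 * v.1) + p1 * (u.1 * v.2) + p2 * (u.2 * v.2),
   q0 * (u.1 * v.1) + q1 * (u.1 * v.2) + q2 * (u.2 * v.2)).

Let norm_B u v : `|B u v| <= C * (`|u| * `|v|).
Proof.
have h (c0 c1 c2 : R) : `|c0| + `|c1| + `|c2| <= C ->
    `|c0 * (u.1 * v.1) + c1 * (u.1 * v.2) + c2 * (u.2 * v.2)| <= C * (`|u| * `|v|).
  move=> cC.
  have u1 : `|u.1| <= `|u| by rewrite [leRHS]sup_normE le_max lexx.
  have u2 : `|u.2| <= `|u| by rewrite [leRHS]sup_normE le_max lexx orbT.
  have v1 : `|v.1| <= `|v| by rewrite [leRHS]sup_normE le_max lexx.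
  have v2 : `|v.2| <= `|v| by rewrite [leRHS]sup_normE le_max lexx orbT.
  apply: (le_trans (ler_normD _ _)).
  apply: (le_trans (lerD (ler_normD _ _) (lexx _))).
  rewrite !normrM.
  apply: (@le_trans _ _ ((`|c0| + `|c1| + `|c2|) * (`|u| * `|v|))).
    by rewrite !mulrDl !lerD// ler_wpM2l// ler_pM.
  by rewrite ler_wpM2r// mulr_ge0.
have := normr_ge0 p0; have := normr_ge0 p1; have := normr_ge0 p2.
have := normr_ge0 q0; have := normr_ge0 q1; have := normr_ge0 q2.
rewrite sup_normE ge_max => ? ? ? ? ? ?; apply/andP.
by split; apply: h; rewrite /C; lra.
Qed.

Let next (s : seq (R * R)) : R * R :=
  (size s)%:R^-1 *: \sum_(k < size s) B s`_k s`_((size s).-1 - k).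

(** The coefficient of order [n + 1] depends on all earlier ones, so the recursion carries the whole
    list of coefficients up to order [n]. *)
Let coefs p := fix coefs n := if n is m.+1 then rcons (coefs m) (next (coefs m)) else [:: p].

Let coef p n := (coefs p n)`_n.

Let size_coefs p n : size (coefs p n) = n.+1.
Proof. by elim: n => //= n IH; rewrite size_rcons IH. Qed.

Let nth_coefs p n k : (k <= n)%N -> (coefs p n)`_k = coef p k.
Proof.
elim: n => [|n IH]; first by rewrite leqn0 => /eqP ->.
rewrite leq_eqVlt => /predU1P[->//|]; rewrite ltnS => kn.
by rewrite /= nth_rcons size_coefs ltnS kn IH.
Qed.

Let coefS p n : coef p n.+1 = n.+1%:R^-1 *: \sum_(k < n.+1) B (coef p k) (coef p (n - k)).
Proof.
rewrite {1}/coef/= nth_rcons size_coefs ltnn eqxx /next size_coefs.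
congr (_ *: _); apply: eq_bigr => k _.
by rewrite !nth_coefs ?leq_subr// -ltnS.
Qed.

(** The bound is the Taylor coefficient of [A / (1 - C * A * t)], the solution of the majorant
    equation [y' = C * y ^+ 2], [y 0 = A]. *)
Let norm_coef p (A : R) n : 0 <= A -> `|p| <= A -> `|coef p n| <= A * (C * A) ^+ n.
Proof.
move=> A0 pA; elim/ltn_ind: n => -[_|n IH]; first by rewrite expr0 mulr1.
rewrite coefS normrZ ger0_norm ?invr_ge0// ler_pdivrMl//.
apply: (le_trans (ler_norm_sum _ _ _)).
have h (k : 'I_n.+1) : `|B (coef p k) (coef p (n - k))| <= A * (C * A) ^+ n.+1.
  apply: (le_trans (norm_B _ _)).
  apply: (@le_trans _ _ (C * (A * (C * A) ^+ k * (A * (C * A) ^+ (n - k))))).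
    rewrite ler_wpM2l ?(ltW C_gt0)// ler_pM// IH//.
    by rewrite ltnS leq_subr.
  rewrite mulrACA -exprD subnKC; last by rewrite -ltnS.
  by rewrite exprS le_eqVlt; apply/predU1P; left; ring.
apply: (le_trans (ler_sum _ (fun k _ => h k))).
by rewrite sumr_const card_ord mulr_natl.
Qed.

(** The power series with the coefficients [coef p] is the solution. They grow at most like
    [A * M ^+ n], so for [|t| < (16 * M)^-1] the terms have ratio 1/16, as the Cauchy product lemma
    requires; [A] depends only on the ball, and so does the existence time. *)
Lemma quadratic_field_solvable : locally_solvable X.
Proof.
move=> M0; pose A := 1 + `|M0|; pose M := C * A.
have A0 : 0 < A by rewrite ltr_pwDl.
have M_gt0 : 0 < M by rewrite mulr_gt0.
exists (16 * M)^-1; first by rewrite invr_gt0 mulr_gt0.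
move=> p pM0.
have pA : `|p| <= A by rewrite (le_trans pM0)// (le_trans (ler_norm _))// lerDr.
pose x n := (coef p n).1; pose y n := (coef p n).2.
have bx n : `|x n| <= A * M ^+ n.
  by rewrite (le_trans _ (norm_coef n (ltW A0) pA))// [leRHS]sup_normE le_max lexx.
have by_ n : `|y n| <= A * M ^+ n.
  by rewrite (le_trans _ (norm_coef n (ltW A0) pA))// [leRHS]sup_normE le_max lexx orbT.
have cvK (w : nat -> R) (D : R) : (forall n, `|w n| <= D * (4 * M) ^+ n) -> cvgn (pseries w (8 * M)^-1).
  move=> hw; apply: normed_cvg.
  have D0 : 0 <= D by have := hw 0; rewrite expr0 mulr1; exact: le_trans.
  apply: (@series_le_cvg _ _ (geometric D 2^-1)) => //=.
    by move=> n; rewrite mulr_ge0// exprn_ge0// invr_ge0.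
    move=> n; rewrite normrM normrX (@ger0_norm _ (8 * M)^-1); last first.
      by rewrite invr_ge0 mulr_ge0// ltW.
    apply: (le_trans (ler_wpM2r _ (hw n))); first by rewrite exprn_ge0// invr_ge0 mulr_ge0// ltW.
    rewrite -mulrA -exprMn ler_wpM2l// le_eqVlt; apply/predU1P; left; congr (_ ^+ _).
    by field; rewrite gt_eqF.
  by apply: is_cvg_geometric_series; rewrite ger0_norm ?invr_ge0// invf_lt1// ltr1n.
(* As [n + 1 <= 2 ^ n.+1], differentiating a series at most doubles the ratio of its coefficients.
   After two differentiations it is [4 * M], and the series still converges at [(8 * M)^-1] with
   ratio 1/2. *)
have diffs (w : nat -> R) (D k : R) : 0 <= k -> (forall n, `|w n| <= D * k ^+ n) ->
    forall n, `|pseries_diffs w n| <= D * k * (2 * k) ^+ n.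
  move=> k0 hw n; rewrite /pseries_diffs normrM normr_nat.
  have D0 : 0 <= D by have := hw 0; rewrite expr0 mulr1; exact: le_trans.
  apply: (@le_trans _ _ (2 ^+ n * (D * k ^+ n.+1))).
    by rewrite ler_pM// -natrX ler_nat ltn_expl.
  by rewrite exprS exprMn le_eqVlt; apply/predU1P; left; ring.
have cvx (w : nat -> R) : (forall n, `|w n| <= A * M ^+ n) ->
    forall t, - (16 * M)^-1 < t < (16 * M)^-1 ->
    is_derive t 1 (fun t => limn (pseries w t)) (limn (pseries (pseries_diffs w) t)).
  move=> hw t ht; have h1 := diffs _ _ _ (ltW M_gt0) hw.
  have h2 := diffs _ _ _ (mulr_ge0 (ler0n _ 2) (ltW M_gt0)) h1.
  have W (a b : R) n : 0 <= b -> b <= 4 * M -> 0 <= a -> a * b ^+ n <= a * (4 * M) ^+ n.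
    by move=> *; rewrite ler_wpM2l// lerXn2r// nnegrE// mulr_ge0// ltW.
  have Mp := M_gt0; have AM : 0 <= A * M by rewrite mulr_ge0 ?ltW.
  have AMM : 0 <= A * M * (2 * M) by rewrite mulr_ge0// mulr_ge0// ltW.
  apply: (@pseries_snd_diffs _ _ (8 * M)^-1).
  - by apply: (cvK _ A) => n; rewrite (le_trans (hw n))// W//; lra.
  - by apply: (cvK _ (A * M)) => n; rewrite (le_trans (h1 n))// W//; lra.
  - by apply: (cvK _ (A * M * (2 * M))) => n; rewrite (le_trans (h2 n))// W//; lra.
  - rewrite (@ger0_norm _ (8 * M)^-1); last first.
      by rewrite invr_ge0 mulr_ge0// ltW.
    apply: (@lt_le_trans _ _ (16 * M)^-1); first by rewrite ltr_norml.
    by rewrite lef_pV2 ?posrE ?mulr_gt0// ler_wpM2r ?(ltW M_gt0)// ler_nat.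
have term (w : nat -> R) : (forall n, `|w n| <= A * M ^+ n) ->
    forall t, - (16 * M)^-1 < t < (16 * M)^-1 ->
    forall n, `|w n * t ^+ n| <= A * 16^-1 ^+ n.
  move=> hw t ht n; rewrite normrM normrX.
  have tM : `|t| <= (16 * M)^-1 by rewrite ler_norml; lra.
  apply: (@le_trans _ _ (A * M ^+ n * (16 * M)^-1 ^+ n)).
    by rewrite ler_pM// lerXn2r// nnegrE// invr_ge0 mulr_ge0// ltW.
  rewrite -mulrA -exprMn ler_wpM2l ?(ltW A0)// le_eqVlt; apply/predU1P; left; congr (_ ^+ _).
  by field; rewrite gt_eqF.
pose c t := (limn (pseries x t), limn (pseries y t)).
exists c.
  rewrite [RHS]surjective_pairing; congr pair; apply/cvg_lim => //.
    suff E n : pseries x 0 n.+1 = p.1.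
      by rewrite -(cvg_shiftS (pseries x 0)) (_ : [sequence _]_n = fun=> p.1); [exact: cvg_cst|apply/funext].
    rewrite /pseries seriesEnat/= big_nat_recl// expr0 mulr1 big1 ?addr0// => i _.
    by rewrite expr0n mulr0.
  suff E n : pseries y 0 n.+1 = p.2.
    by rewrite -(cvg_shiftS (pseries y 0)) (_ : [sequence _]_n = fun=> p.2); [exact: cvg_cst|apply/funext].
  rewrite /pseries seriesEnat/= big_nat_recl// expr0 mulr1 big1 ?addr0// => i _.
  by rewrite expr0n mulr0.
move=> t ht; pose xt n := x n * t ^+ n; pose yt n := y n * t ^+ n.
have cxx := cvg_convolution (term _ bx t ht) (term _ bx t ht).
have cxy := cvg_convolution (term _ bx t ht) (term _ by_ t ht).
have cyy := cvg_convolution (term _ by_ t ht) (term _ by_ t ht).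
have lim_comb (w : nat -> R) (c0 c1 c2 : R) : (forall n, n.+1%:R * w n.+1 =
      \sum_(k < n.+1) (c0 * (x k * x (n - k)%N) + c1 * (x k * y (n - k)%N) + c2 * (y k * y (n - k)%N))) ->
    limn (pseries (pseries_diffs w) t) =
    c0 * (c t).1 ^+ 2 + c1 * (c t).1 * (c t).2 + c2 * (c t).2 ^+ 2.
  move=> hw; apply/cvg_lim => //.
  have -> : pseries (pseries_diffs w) t = (fun n => c0 * series (convolution xt xt) n +
      c1 * series (convolution xt yt) n + c2 * series (convolution yt yt) n).
    apply/funext => n; rewrite /pseries !seriesEnat/= !mulr_sumr -!big_split/=.
    apply: eq_bigr => m _; rewrite /pseries_diffs hw /convolution !mulr_sumr -!big_split/= mulr_suml.
    apply: eq_bigr => k _; rewrite /xt /yt.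
    have -> : t ^+ m = t ^+ k * t ^+ (m - k) by rewrite -exprD subnKC// -ltnS.
    by ring.
  rewrite -!mulrA !expr2; apply: cvgD; first apply: cvgD.
  - exact: cvgMl_tmp cxx.
  - exact: cvgMl_tmp cxy.
  - exact: cvgMl_tmp cyy.
apply/is_derive_pairP; split.
- apply: (is_derive_eq (cvx _ bx t ht)); apply: lim_comb => n.
  rewrite /x coefS/= (big_morph fst (fun _ _ => erefl) erefl)/= -[_ *: _]/(_ * _).
  by rewrite mulrA divff ?mul1r.
- apply: (is_derive_eq (cvx _ by_ t ht)); apply: lim_comb => n.
  rewrite /y coefS/= (big_morph snd (fun _ _ => erefl) erefl)/= -[_ *: _]/(_ * _).
  by rewrite mulrA divff ?mul1r.
Qed.

End QuadraticField.

(** * Adapted charts and the normal derivative *)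

Lemma nbhs_distP (R : realType) (V : normedModType R) (p : V) (A : set V) :
  nbhs p A <-> exists2 e : R, 0 < e & forall q, `|q - p| < e -> A q.
Proof.
split=> [/nbhs_normP|[e e0 h]].
  by move=> [e /= e0 h]; exists e => // q qp; apply: h; rewrite /ball_/= distrC.
by apply/nbhs_normP; exists e => //= q; rewrite /ball_/= distrC => /h.
Qed.

Lemma cvg_fst_comp (R : realType) (T : Type) (F : set_system T) (FF : Filter F)
    (g : T -> R * R) (l : R * R) : g x @[x --> F] --> l -> (g x).1 @[x --> F] --> l.1.
Proof.
by move=> gl; exact: (cvg_comp _ _ gl (cvg_fst (F := nbhs l.1) (G := nbhs l.2))).
Qed.

Lemma cvg_snd_comp (R : realType) (T : Type) (F : set_system T) (FF : Filter F)
    (g : T -> R * R) (l : R * R) : g x @[x --> F] --> l -> (g x).2 @[x --> F] --> l.2.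
Proof.
by move=> gl; exact: (cvg_comp _ _ gl (cvg_snd (F := nbhs l.1) (G := nbhs l.2))).
Qed.

(** For an adapted chart [h] and a boundary point [p] this is the normal component of [v]: positive
    when [v] points into [N], negative when it points out. *)
HB.lock Definition dsnd (R : realType) (h : R * R -> R * R) (v p : R * R) : R :=
  ('D_v h p).2.

Section Differential.
Variable R : realType.
Implicit Types (f g : R -> R) (h : R * R -> R * R) (p v w : R * R).

Lemma derive_comp h (c : R -> R * R) (t : R) v :
  differentiable h (c t) -> is_derive t 1 c v ->
  is_derive t 1 (h \o c) ('D_v h (c t)).
Proof.
move=> dh dc; have dct : differentiable c t by apply/derivable1_diffP; exact: ex_derive.
have dhc : differentiable (h \o c) t by apply: differentiable_comp.
apply: DeriveDef; first exact: diff_derivable.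
case: dc => _ <-; rewrite deriveE// diff_comp//= [in RHS]deriveE//.
by rewrite [in RHS]deriveE.
Qed.

Lemma derive_linear h p v w (e : R) : differentiable h p ->
  'D_(v + e *: w) h p = 'D_v h p + e *: 'D_w h p.
Proof. by move=> dh; rewrite !deriveE// linearD linearZ. Qed.

Lemma dsnd_linear h p v w (e : R) : differentiable h p ->
  dsnd h (v + e *: w) p = dsnd h v p + e * dsnd h w p.
Proof. by move=> dh; rewrite dsnd.unlock derive_linear. Qed.

Lemma dsnd0 h p : dsnd h 0 p = 0.
Proof. by rewrite dsnd.unlock derive0. Qed.

Lemma dsndN h v p : differentiable h p -> dsnd h (- v) p = - dsnd h v p.
Proof.
move=> dh; have := dsnd_linear 0 v (-1) dh.
by rewrite add0r scaleN1r dsnd0 add0r mulN1r.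
Qed.

Lemma dsnd_basis h p v : differentiable h p ->
  dsnd h v p = v.1 * dsnd h (1, 0) p + v.2 * dsnd h (0, 1) p.
Proof.
move=> dh; pose e1 : R * R := (1, 0); pose e2 : R * R := (0, 1).
have E2 := dsnd_linear (0 + v.1 *: e1) e2 v.2 dh.
have E1 := dsnd_linear 0 e1 v.1 dh.
have ev : 0 + v.1 *: e1 + v.2 *: e2 = v.
  by rewrite [RHS]surjective_pairing; congr pair; rewrite /= /GRing.scale/=; ring.
by rewrite ev in E2; rewrite E2 E1 dsnd0 add0r.
Qed.

Lemma dsnd_line h p v : differentiable h p ->
  is_derive (0 : R) 1 (fun t => (h (p + t *: v)).2) (dsnd h v p).
Proof.
move=> dh; have dl : is_derive (0 : R) 1 (fun t : R => p + t *: v) v.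
  apply/is_derive_pairP; split => /=.
    by apply: is_derive_eq; rewrite /GRing.scale/=; ring.
  by apply: is_derive_eq; rewrite /GRing.scale/=; ring.
have := @derive_comp h (fun t : R => p + t *: v) 0 v.
by rewrite dsnd.unlock scale0r addr0 => /(_ dh dl)/is_derive_pairP[].
Qed.

Lemma dsnd_comp h (c : R -> R * R) (t : R) v :
  differentiable h (c t) -> is_derive t 1 c v ->
  is_derive t 1 (fun s => (h (c s)).2) (dsnd h v (c t)).
Proof.
by move=> dh dc; rewrite dsnd.unlock; have /is_derive_pairP[] := derive_comp dh dc.
Qed.

Lemma derive_gt0_sign f (a d : R) : is_derive a 1 f d -> f a = 0 -> 0 < d ->
  exists2 e : R, 0 < e & forall t, 0 < t < e -> 0 < f (a + t) /\ f (a - t) < 0.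
Proof.
move=> /is_derive_cvgP fd fa d0.
have : \forall t \near 0^', 0 < t^-1 *: (f (t *: 1 + a) - f a).
  exact: (cvgr_gt _ fd).
rewrite fa => /(nbhs_distP (0 : R) _)[e e0 h]; exists e => // t /andP[t0 te].
have S (s x : R) : s *: x = s * x by [].
split.
- have := h t; rewrite subr0 gtr0_norm// te => /(_ isT); rewrite gt_eqF// => /(_ isT).
  by rewrite !S mulr1 subr0 pmulr_rgt0 ?invr_gt0// addrC.
- have := h (- t); rewrite subr0 normrN gtr0_norm// te => /(_ isT).
  rewrite oppr_eq0 gt_eqF// => /(_ isT).
  by rewrite !S mulr1 subr0 nmulr_rgt0 ?invr_lt0 ?oppr_lt0// addrC.
Qed.

Lemma derive_ge0_sign f (a d e : R) : is_derive a 1 f d -> f a = 0 -> 0 < e ->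
  (forall t, 0 < t < e -> 0 <= f (a + t)) -> 0 <= d.
Proof.
move=> fd fa e0 h; rewrite leNgt; apply/negP => d0.
have fd' : is_derive a 1 (fun t => - f t) (- d) by apply: is_deriveN.
have [||e' e'0 h'] := derive_gt0_sign fd'; [by rewrite fa oppr0|by rewrite oppr_gt0|].
have m0 : 0 < Num.min e e' by rewrite lt_min e0.
have m1 : Num.min e e' <= e by rewrite ge_min lexx.
have m2 : Num.min e e' <= e' by rewrite ge_min lexx orbT.
have [|h1 _] := h' (Num.min e e' / 2); first by lra.
by have := h (Num.min e e' / 2); lra.
Qed.

Lemma derive_le0_sign f (a d e : R) : is_derive a 1 f d -> f a = 0 -> 0 < e ->
  (forall t, 0 < t < e -> 0 <= f (a - t)) -> d <= 0.
Proof.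
move=> fd fa e0 h; rewrite leNgt; apply/negP => d0.
have [e' e'0 h'] := derive_gt0_sign fd fa d0.
have m0 : 0 < Num.min e e' by rewrite lt_min e0.
have m1 : Num.min e e' <= e by rewrite ge_min lexx.
have m2 : Num.min e e' <= e' by rewrite ge_min lexx orbT.
have [|_ h1] := h' (Num.min e e' / 2); first by lra.
by have := h (Num.min e e' / 2); lra.
Qed.

End Differential.

Section Charts.
Variables (R : realType) (N : set (R * R)).
Implicit Types (U : set (R * R)) (h : R * R -> R * R) (p v w z : R * R).

Lemma chart_open U h : adapted_chart N U h -> open U.
Proof. by move=> [[V [k [[? _] _ _ _ _]]] _]. Qed.

Lemma chart_nbhs U h p : adapted_chart N U h -> U p -> nbhs p U.
Proof. by move=> /chart_open oU Up; apply: open_nbhs_nbhs; split. Qed.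

Lemma chart_differentiable U h p : adapted_chart N U h -> U p -> differentiable h p.
Proof. by move=> [[V [k [_ hs _ _ _]]] _] Up; exact: (hs [::]). Qed.

Lemma chart_continuous U h p : adapted_chart N U h -> U p -> {for p, continuous h}.
Proof. by move=> hU Up; apply: differentiable_continuous; exact: chart_differentiable hU Up. Qed.

Lemma chart_dir_continuous U h p v : adapted_chart N U h -> U p ->
  {for p, continuous ('D_v h)}.
Proof.
move=> [[V [k [_ hs _ _ _]]] _] Up; apply: differentiable_continuous.
exact: (hs [:: v]).
Qed.

Lemma chart_inverse U h p : adapted_chart N U h -> U p -> exists V k,
  [/\ diffeomorphism U V h k, V (h p), k (h p) = p, nbhs (h p) V & {for h p, continuous k}].
Proof.
move=> [[V [k hk]] _] Up; exists V, k; have [[oU oV] hs ks hU kV] := hk.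
have [Vhp khp] := hU _ Up; split=> //.
  by apply: open_nbhs_nbhs; split.
by apply: differentiable_continuous; exact: (ks [::]).
Qed.

Lemma chart_gt0_interior U h p : adapted_chart N U h -> U p -> 0 < (h p).2 -> interior N p.
Proof.
move=> hU Up hp; have cp := chart_continuous hU Up.
have : \forall z \near p, 0 < (h z).2.
  have c2 : {for p, continuous (fun z => (h z).2)}.
    exact: cvg_snd_comp.
  exact: (cvgr_gt _ c2).
move=> H; rewrite /interior/=; have H2 := chart_nbhs hU Up.
near=> z; have [_ /(_ z) hN] := hU; apply/hN; first by near: z.
by apply: ltW; near: z.
Unshelve. all: by end_near. Qed.

(** In a chart, the points just below the horizontal axis are outside [N] and accumulate at [p].
    This topological description makes the boundary independent of the chart. *)
Lemma boundaryP p : boundary N p -> N p /\ ~ interior N p.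
Proof.
move=> [U [h [Up hU hp]]]; split; first by have [_ /(_ p Up) ->] := hU; rewrite hp.
rewrite /interior/= => Np.
have [V [k [hk Vhp khp nV ck]]] := chart_inverse hU Up.
have : \forall q \near h p, V q /\ N (k q).
  by apply: filterI => //; move: (ck); rewrite /prop_for/continuous_at khp; apply.
move=> /nbhs_distP[e e0 H].
pose q := ((h p).1, - (e / 2)).
have [|Vq Nq] := H q.
  rewrite sup_normE/= subrr normr0 hp subr0 normrN gtr0_norm ?divr_gt0//.
  by rewrite gt_max e0/=; lra.
have [_ _ _ _ /(_ q Vq) [Ukq hkq]] := hk.
have [_ /(_ _ Ukq) [/(_ Nq) + _]] := hU.
by rewrite hkq/= oppr_ge0; lra.
Qed.

Lemma boundary_chart U h p : adapted_chart N U h -> U p -> boundary N p <-> (h p).2 = 0.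
Proof.
move=> hU Up; split=> [/boundaryP[Np Ni]|hp]; last by exists U, h.
have [_ /(_ p Up) [/(_ Np) + _]] := hU.
rewrite le_eqVlt => /predU1P[//|hp].
by exfalso; apply: Ni; exact: chart_gt0_interior hU Up hp.
Qed.

Lemma smooth_domain_cases p : smooth_domain N -> N p -> boundary N p \/ interior N p.
Proof.
move=> sN Np; have [U [h [Up hU]]] := sN _ Np.
have [_ /(_ p Up) [/(_ Np) + _]] := hU.
rewrite le_eqVlt => /predU1P[hp|hp].
  by left; exists U, h.
by right; exact: chart_gt0_interior hU Up hp.
Qed.

Lemma chart_lt0_near U h p : adapted_chart N U h -> U p -> (h p).2 < 0 ->
  exists2 r : R, 0 < r & forall z, `|z - p| < r -> (h z).2 < 0.
Proof.
move=> hU Up hp.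
have : \forall z \near p, (h z).2 < 0.
  exact: (cvgr_lt _ (cvg_snd_comp _ (chart_continuous hU Up))).
by move=> /nbhs_distP.
Qed.

Lemma chart_interior U h p : adapted_chart N U h -> U p -> interior N p -> 0 < (h p).2.
Proof.
move=> hU Up ip; have Np := interior_subset ip.
have [_ /(_ p Up) [/(_ Np) + _]] := hU; rewrite le_eqVlt => /predU1P[hp|//].
by have [] : N p /\ ~ interior N p by apply: boundaryP; exists U, h.
Qed.

(** The vector is the image of [(0, 1)] under the differential of the inverse chart: near [h p] the
    composite of [h] with its inverse is the identity. *)
Lemma chart_normal U h p : adapted_chart N U h -> U p -> exists w, dsnd h w p = 1.
Proof.
move=> hU Up; have [V [k [hk Vhp khp nV ck]]] := chart_inverse hU Up.
have [_ _ ks _ kV] := hk.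
have dk : differentiable k (h p) by exact: (ks [::]).
have dh := chart_differentiable hU Up.
pose e : R * R := (0, 1); pose w := 'D_e k (h p); exists w.
have dl : is_derive (0 : R) 1 (fun t : R => h p + t *: e) e.
  apply/is_derive_pairP; split => /=.
    by apply: is_derive_eq; rewrite /GRing.scale/=; ring.
  by apply: is_derive_eq; rewrite /GRing.scale/=; ring.
pose c (t : R) := k (h p + t *: e).
have c0 : c 0 = p by rewrite /c scale0r addr0.
have dc : is_derive (0 : R) 1 c w.
  have := @derive_comp _ k (fun t : R => h p + t *: e) 0 e.
  by rewrite scale0r addr0; apply.
have dhc : is_derive (0 : R) 1 (fun t => (h (c t)).2) (dsnd h w p).
  by rewrite -[in dsnd _ _ _]c0; apply: dsnd_comp => //; rewrite c0.
have E : \forall t \near (0 : R), (h (c t)).2 = (h p + t *: e).2.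
  have lc : {for (0 : R), continuous (fun t : R => h p + t *: e)}.
    by apply: differentiable_continuous; apply/derivable1_diffP; apply: ex_derive.
  have : \forall t \near (0 : R), V (h p + t *: e).
    by apply: lc; rewrite scale0r addr0.
  by apply: filterS => t /kV[_]; rewrite /c => ->.
have dl' := near_eq_is_derive E dhc.
have /is_derive_pairP[_ dl2] := dl.
by case: dl' => _ <-; case: dl2.
Qed.

(** If [v] were tangent in [h] but strictly outward in [h'], then tilting it slightly along the
    inward normal of [h] would give a direction that enters [N] according to [h] and leaves it
    according to [h']. The tilt [e] is such that [e * |b| = - d / 2 - e], which keeps the [h']
    component negative. *)
Lemma dsnd_ge0_chart U h U' h' p v :
  adapted_chart N U h -> U p -> (h p).2 = 0 ->
  adapted_chart N U' h' -> U' p -> (h' p).2 = 0 ->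
  dsnd h v p = 0 -> 0 <= dsnd h' v p.
Proof.
move=> hU Up hp hU' Up' hp' hv; rewrite leNgt; apply/negP => d0.
have dh := chart_differentiable hU Up; have dh' := chart_differentiable hU' Up'.
have [w hw] := chart_normal hU Up.
pose d := dsnd h' v p; pose b := dsnd h' w p.
pose e := - d / (2 * (`|b| + 1)).
have b1 : 0 < 2 * (`|b| + 1) by rewrite mulr_gt0// ltr_wpDl.
have e0 : 0 < e by rewrite /e divr_gt0// oppr_gt0.
pose u := v + e *: w.
have du : dsnd h u p = _ := dsnd_linear v w e dh.
have du' : dsnd h' u p = _ := dsnd_linear v w e dh'.
have l2 := dsnd_line u dh; have l2' := dsnd_line u dh'.
have lc : {for (0 : R), continuous (fun t : R => p + t *: u)}.
  apply: differentiable_continuous; apply/derivable1_diffP.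
  have [//] : is_derive (0 : R) 1 (fun t : R => p + t *: u) u.
  apply/is_derive_pairP; split => /=.
    by apply: is_derive_eq; rewrite /GRing.scale/=; ring.
  by apply: is_derive_eq; rewrite /GRing.scale/=; ring.
clearbody u.
have [||e1 e1p H1] := derive_gt0_sign l2.
- by rewrite scale0r addr0.
- by rewrite du hv hw add0r mulr1.
have : \forall t \near (0 : R), U (p + t *: u) /\ U' (p + t *: u).
  apply: filterI.
    by apply: lc; rewrite scale0r addr0; exact: chart_nbhs hU Up.
  by apply: lc; rewrite scale0r addr0; exact: chart_nbhs hU' Up'.
move=> /nbhs_distP[e2 e2p H2].
have : 0 <= dsnd h' u p.
  apply: (derive_ge0_sign l2' _ (e := Num.min e1 e2)).
  - by rewrite scale0r addr0.
  - by rewrite lt_min e1p.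
  - move=> t /andP[t0]; rewrite lt_min => /andP[t1 t2].
    have [|Ut Ut'] := H2 t; first by rewrite subr0 gtr0_norm.
    have [|h1 _] := H1 t; first by rewrite t0.
    rewrite add0r in h1 *.
    have [_ /(_ _ Ut') [+ _]] := hU'; apply.
    by have [_ /(_ _ Ut) [_]] := hU; apply; exact: ltW.
rewrite du' -/d -/b; apply/negP; rewrite -ltNge.
have : e * b <= e * `|b| by rewrite ler_wpM2l ?(ltW e0)// ler_norm.
have : e * `|b| = - d / 2 - e by rewrite /e; field; apply: lt0r_neq0; lra.
rewrite -/d in d0; lra.
Qed.

(** Tangency is defined by the existence of some chart; comparing two charts on both [v] and [- v]
    shows that any chart decides it. *)
Lemma tangent_chart U h p v : adapted_chart N U h -> U p -> (h p).2 = 0 ->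
  tangent_to_boundary N p v <-> dsnd h v p = 0.
Proof.
move=> hU Up hp; split; last by rewrite dsnd.unlock => hv; exists U, h.
move=> [U' [h' [Up' hU' hp' +]]]; 
rewrite (_ : ('D_v h' p).2 = dsnd h' v p) => [hv'|]; last by rewrite dsnd.unlock.
apply/eqP; rewrite eq_le.
rewrite (dsnd_ge0_chart hU' Up' hp' hU Up hp hv') andbT.
have dh := chart_differentiable hU Up; have dh' := chart_differentiable hU' Up'.
have : 0 <= dsnd h (- v) p.
  apply: (dsnd_ge0_chart hU' Up' hp' hU Up hp).
  by rewrite dsndN// hv' oppr0.
by rewrite dsndN// oppr_ge0.
Qed.

(** The direction [X z] moves with [z], whereas smoothness of a chart speaks of fixed directions; so
    the derivative is expanded along the two basis vectors. *)
Lemma chart_field_continuous U h p (X : R * R -> R * R) :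
  adapted_chart N U h -> U p -> {for p, continuous X} ->
  {for p, continuous (fun z => dsnd h (X z) z)}.
Proof.
move=> hU Up cX.
have E : \forall z \near p, (X z).1 * dsnd h (1, 0) z + (X z).2 * dsnd h (0, 1) z =
    dsnd h (X z) z.
  near=> z; have Uz : U z by near: z; exact: chart_nbhs hU Up.
  by rewrite [RHS]dsnd_basis//; exact: chart_differentiable hU Uz.
have cd v : {for p, continuous (dsnd h v)}.
  rewrite dsnd.unlock.
  exact: (cvg_snd_comp _ (chart_dir_continuous (v := v) hU Up)).
rewrite /prop_for/continuous_at -(nbhs_singleton E).
apply: cvg_trans; first exact: (near_eq_cvg E).
by apply: cvgD; apply: cvgM;
  [exact: (cvg_fst_comp _ cX)|exact: cd|exact: (cvg_snd_comp _ cX)|exact: cd].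
Unshelve. all: by end_near. Qed.

End Charts.

(** * Linear changes of coordinates *)

Section SmoothLocality.
Variable R : realType.

Lemma differentiable_near0 (V W : normedModType R) (f : V -> W) (p : V) :
  (\forall z \near p, f z = 0) -> differentiable f p.
Proof.
move=> f0.
have fp0 : f p = 0 := nbhs_singleton f0.
have E : continuous (0 : V -> W) /\ f \o shift p = cst (f p) + (0 : V -> W) +o_ 0 id.
  split; first exact: cst_continuous.
  apply/eqaddoP => _/posnumP[eps].
  have : \forall x \near (0 : V), f (x + p) = 0.
    by move: f0; rewrite (near_shift 0)/=; apply: filterS => x; rewrite subr0.
  apply: filterS => x fx.
  by rewrite !fctE/= fx fp0 addr0 subr0 normr0 mulr_ge0.
have dE : ('d f p : V -> W) = 0 by apply/diff_unique; case: E.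
by apply/diff_locallyP; rewrite dE.
Qed.

Lemma near_eq_differentiable (V W : normedModType R) (f g : V -> W) (p : V) :
  (\forall z \near p, f z = g z) -> differentiable f p -> differentiable g p.
Proof.
move=> fg df; have -> : g = f + (g - f) by apply/funext => z; rewrite !fctE addrC subrK.
apply: differentiableD => //; apply: differentiable_near0.
by apply: filterS fg => z; rewrite !fctE => ->; rewrite subrr.
Qed.

Lemma continuous_withinP (A : set (R * R)) (f : R * R -> R * R) :
  {within A, continuous f} <-> forall x, A x -> forall e : R, 0 < e ->
    exists2 d : R, 0 < d & forall y, A y -> `|y - x| < d -> `|f y - f x| < e.
Proof.
rewrite subspace_continuousP; split=> h x Ax.
  move=> e e0; have : f @ within A (nbhs x) --> f x := h _ Ax.
  move=> /cvgrPdist_lt/(_ _ e0); rewrite /= near_withinE => /nbhs_distP[d d0 hd].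
  by exists d => // y Ay yx; rewrite distrC; exact: hd.
move=> W /nbhs_distP[e e0 hW]; have [d d0 hd] := h _ Ax _ e0.
rewrite /fmap/within/=; apply/nbhs_distP; exists d => // y yx Ay.
by apply: hW; exact: hd.
Qed.

End SmoothLocality.

Section LinearTransport.
Variable R : realType.
Implicit Types (T : {linear (R * R)%type -> (R * R)%type}).

Lemma linear_pairE T (z : R * R) : T z = z.1 *: T (1, 0) + z.2 *: T (0, 1).
Proof.
rewrite -!linearZ -linearD; congr (T _).
by rewrite [LHS]surjective_pairing; congr pair; rewrite /= /GRing.scale/=; ring.
Qed.

Lemma linear_pair_continuous T : continuous T.
Proof.
have -> : (T : R * R -> R * R) = fun z : R * R => z.1 *: T (1, 0) + z.2 *: T (0, 1).
  by apply/funext => z; exact: linear_pairE.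
move=> z; apply: cvgD; apply: cvgZr_tmp.
  exact: cvg_fst_comp.
exact: cvg_snd_comp.
Qed.
Arguments linear_pair_continuous : clear implicits.

Lemma linear_is_derive T (V : normedModType R) (f : V -> R * R) (a v : V) (df : R * R) :
  is_derive a v f df -> is_derive a v (T \o f) (T df).
Proof.
rewrite !is_derive_cvgP => h.
have := cvg_comp _ _ h (linear_pair_continuous T df); apply: cvg_trans.
apply: near_eq_cvg; near=> t.
by rewrite /= linearZ linearB.
Unshelve. all: by end_near. Qed.

(** The two difference quotients coincide, so this is an equality of functions and passes to
    iterated derivatives, each direction being replaced by its image under [T]. *)
Lemma derive_comp_linear T (f : R * R -> R * R) (v : R * R) :
  'D_v (f \o T) = ('D_(T v) f) \o T.
Proof.
apply/funext => a; rewrite /= /derive/=.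
have -> : (fun t : R => t^-1 *: (f (T (t *: v + a)) - f (T a))) =
    (fun t : R => t^-1 *: (f (t *: T v + T a) - f (T a))).
  by apply/funext => t; congr (_ *: (f _ - _)); exact: linearP.
by [].
Qed.

Local Opaque derive.

Lemma smooth_on_comp_linear T (U : set (R * R)) (h : R * R -> R * R) :
  smooth_on U h -> smooth_on (T @^-1` U) (h \o T).
Proof.
move=> hs vs p Up.
have -> : foldr (fun v g => 'D_v g) (h \o T) vs =
    (foldr (fun v g => 'D_v g) h (map T vs)) \o T.
  elim: vs => [//|v vs IH].
  exact: etrans (congr1 (fun g => 'D_v g) IH) (derive_comp_linear _ _ _).
apply: differentiable_comp; last exact: hs.
by apply: linear_differentiable; exact: linear_pair_continuous.
Qed.

Lemma smooth_on_linear_comp T (V : set (R * R)) (k : R * R -> R * R) :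
  open V -> smooth_on V k -> smooth_on V (T \o k).
Proof.
move=> oV ks vs p Vp.
have E : forall p, V p -> foldr (fun v g => 'D_v g) (T \o k) vs p =
    T (foldr (fun v g => 'D_v g) k vs p).
  elim: vs => //= v vs IH {}p {}Vp.
  have -> : 'D_v (foldr (fun v g => 'D_v g) (T \o k) vs) p =
      'D_v (T \o foldr (fun v g => 'D_v g) k vs) p.
    apply: near_eq_derive; near=> z; apply: IH; near: z.
    by apply: open_nbhs_nbhs; split.
  have dk : is_derive p v (foldr (fun v g => 'D_v g) k vs)
      ('D_v (foldr (fun v g => 'D_v g) k vs) p).
    by apply: derivableP; apply: diff_derivable; exact: ks.
  by have [] := linear_is_derive T dk.
apply: (@near_eq_differentiable _ _ _ (T \o foldr (fun v g => 'D_v g) k vs)).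
  near=> z; symmetry; apply: E; near: z.
  by apply: open_nbhs_nbhs; split.
apply: differentiable_comp; first exact: ks.
by apply: linear_differentiable; exact: linear_pair_continuous.
Unshelve. all: by end_near. Qed.

Section Push.
Variables T T' : {linear (R * R)%type -> (R * R)%type}.
Hypotheses (TK : cancel T T') (T'K : cancel T' T).
Implicit Types (X : R * R -> R * R) (N S : set (R * R)) (p q z : R * R).

Definition push_set T' N : set (R * R) := [set z | N (T' z)].

Lemma push_flow X p t q : flow X p t q -> flow (push_field T T' X) (T p) t (T q).
Proof.
move=> [a [b [c [ab tab c0 ct h]]]]; exists a, b, (T \o c); split=> //=.
- by rewrite c0.
- by rewrite ct.
- by move=> s /h hs; rewrite /push_field TK; exact: linear_is_derive.
Qed.

Lemma push_diffeomorphism U V h k : diffeomorphism U V h k ->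
  diffeomorphism (push_set T' U) V (h \o T') (T \o k).
Proof.
move=> [[oU oV] hs ks hU kV]; split.
- by split=> //; apply: open_comp => // z _; exact: linear_pair_continuous.
- exact: smooth_on_comp_linear.
- exact: smooth_on_linear_comp.
- by move=> p /hU[Vh khp]; split=> //=; rewrite khp T'K.
- by move=> q /kV[Uk hkq]; rewrite /push_set/= TK.
Qed.

Lemma push_chart N U h : adapted_chart N U h ->
  adapted_chart (push_set T' N) (push_set T' U) (h \o T').
Proof.
move=> [[V [k hk]] hN]; split; last by move=> p Up; exact: hN.
by exists V, (T \o k); exact: push_diffeomorphism.
Qed.

Lemma push_boundary N p : boundary N p -> boundary (push_set T' N) (T p).
Proof.
move=> [U [h [Up hU hp]]]; exists (push_set T' U), (h \o T').
by rewrite /push_set/= TK; split=> //; exact: push_chart.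
Qed.

Lemma push_tangency X N p : tangency_set X N p ->
  tangency_set (push_field T T' X) (push_set T' N) (T p).
Proof.
move=> [bp [U [h [Up hU hp hv]]]]; split; first exact: push_boundary.
exists (push_set T' U), (h \o T').
split.
- by rewrite /push_set/= TK.
- exact: push_chart.
- by rewrite /= TK.
- apply: etrans (congr1 (fun g => (g (T p)).2) (derive_comp_linear T' h _)) _.
  by rewrite /comp /push_field !TK.
Qed.

End Push.

(** Transport is proved in one direction; applying it again to the inverse map, and cancelling with
    this lemma and the next, gives the equivalences below. *)
Lemma push_fieldK T T' (X : R * R -> R * R) : cancel T T' ->
  push_field T' T (push_field T T' X) = X.
Proof. by move=> TK; apply/funext => z; rewrite /push_field !TK. Qed.

Lemma push_setK T T' (N : set (R * R)) : cancel T T' -> push_set T (push_set T' N) = N.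
Proof. by move=> TK; apply/funext => z; rewrite /push_set/= TK. Qed.

Section PushRegularisable.
Variables T T' : {linear (R * R)%type -> (R * R)%type}.
Hypotheses (TK : cancel T T') (T'K : cancel T' T).
Implicit Types (X : R * R -> R * R) (N S : set (R * R)) (p q z : R * R).

Lemma push_flowP X p t q :
  flow (push_field T T' X) p t q <-> flow X (T' p) t (T' q).
Proof.
split=> [/(push_flow T'K)|/(push_flow TK)]; first by rewrite push_fieldK.
by rewrite !T'K.
Qed.

Lemma push_boundaryP N p : boundary (push_set T' N) p <-> boundary N (T' p).
Proof.
split=> [/(push_boundary T'K TK)|/(push_boundary TK T'K)]; first by rewrite push_setK.
by rewrite T'K.
Qed.

Lemma push_tangencyP X N p :
  tangency_set (push_field T T' X) (push_set T' N) p <-> tangency_set X N (T' p).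
Proof.
split=> [/(push_tangency T'K TK)|/(push_tangency TK T'K)]; last by rewrite T'K.
by rewrite push_fieldK// push_setK.
Qed.

Lemma push_entryP X N p :
  entry_set (push_field T T' X) (push_set T' N) p <-> entry_set X N (T' p).
Proof.
rewrite /entry_set/= push_boundaryP; split=> -[bp [t t0 h]]; split=> //; exists t => // s q st.
  by have := h s (T q) st; rewrite push_flowP /push_set/= TK.
by move=> /push_flowP; exact: h.
Qed.

Lemma push_exitP X N p :
  exit_set (push_field T T' X) (push_set T' N) p <-> exit_set X N (T' p).
Proof.
rewrite /exit_set/= push_boundaryP; split=> -[bp [t t0 h]]; split=> //; exists t => // s q st.
  by have := h s (T q) st; rewrite push_flowP /push_set/= TK.
by move=> /push_flowP; exact: h.
Qed.

Lemma push_forward_asymptoticP X N p :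
  forward_asymptotic (push_field T T' X) (push_set T' N) p <-> forward_asymptotic X N (T' p).
Proof.
rewrite /forward_asymptotic/= push_entryP; split=> -[bp h]; split=> // t /h[q].
  by move=> /push_flowP; exists (T' q).
by exists (T q); rewrite ?push_flowP /push_set/= TK.
Qed.

Lemma push_exit_pointP X N p q :
  exit_point (push_field T T' X) (push_set T' N) p q <-> exit_point X N (T' p) (T' q).
Proof.
split=> -[t [t0 /push_flowP pq h1 h2]]; exists t; split=> //.
- by move=> s r st pr; have := h1 s (T r) st; rewrite push_flowP /push_set/= TK; apply.
- by move=> e /h2[s [r [ste /push_flowP pr nr]]]; exists s, (T' r).
- by move=> s r st /push_flowP pr; exact: h1 st pr.
- by move=> e /h2[s [r [ste pr nr]]]; exists s, (T r); split=> //; rewrite ?push_flowP /push_set/= TK.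
Qed.

Lemma push_continuous_extension X N f : continuous_extension X N f ->
  continuous_extension (push_field T T' X) (push_set T' N) (T \o f \o T').
Proof.
move=> [h1 h2 h3]; split.
- by move=> p /push_entryP/h1; rewrite push_exitP/= TK.
- have -> : entry_set (push_field T T' X) (push_set T' N) = T' @^-1` (entry_set X N).
    by apply/seteqP; split=> p /push_entryP.
  apply/subspace_continuousP => p Ap.
  move: h2 => /subspace_continuousP/(_ _ Ap) h2.
  apply: (cvg_comp _ T); last exact: linear_pair_continuous.
  apply: (cvg_comp T' f); last exact: h2.
  move=> W hW; have := linear_pair_continuous T' p _ hW.
  by rewrite /fmap/within/=.
- move=> p [/push_entryP ep np]; rewrite push_exit_pointP/= TK; apply: h3; split=> //.
  by move=> /push_forward_asymptoticP.
Qed.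

Lemma push_isolating_block X N : isolating_block X [set 0] N ->
  isolating_block (push_field T T' X) [set 0] (push_set T' N).
Proof.
move=> [[cN sN] [h1 h2 h3] h4 h5]; split.
- split.
    have -> : push_set T' N = T @` N.
      apply/seteqP; split=> z; rewrite /push_set/=; first by exists (T' z).
      by move=> [p Np <-]; rewrite TK.
    apply: continuous_compact => //; apply: continuous_subspaceT.
    exact: linear_pair_continuous.
  move=> p /sN[U [h [Up hU]]]; exists (push_set T' U), (h \o T'); split=> //.
  exact: push_chart.
- split.
  + by move=> _ ->; rewrite /push_set/= linear0; exact: h1.
  + move=> _ -> t; have [q fq q0] := h2 0 erefl t; rewrite q0 in fq; exists 0 => //.
    by apply/push_flowP; rewrite linear0.
  + move=> S SN iS p Sp.
    suff : T' p = 0 by move=> /(congr1 T); rewrite T'K linear0.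
    apply: (h3 (push_set T S)); last by rewrite /push_set/= T'K.
      by move=> z /SN; rewrite /push_set/= TK.
    move=> z Sz t; have [q fq Sq] := iS _ Sz t.
    exists (T' q); last by rewrite /push_set/= T'K.
    by move: fq => /push_flowP; rewrite TK.
- apply/seteqP; split=> p.
    by move=> [/push_entryP ep /push_exitP xp]; apply/push_tangencyP; rewrite -h4.
  by move=> /push_tangencyP; rewrite -h4 => -[/push_entryP ? /push_exitP ?].
- move=> p /push_tangencyP/h5[U [h [Up hU hq]]].
  exists (push_set T' U), (h \o T'); split=> //; first exact: push_chart.
  by move=> q /hq; rewrite push_tangencyP push_boundaryP.
Qed.

End PushRegularisable.

Lemma push_regularisable T T' (X : R * R -> R * R) : cancel T T' -> cancel T' T ->
  C0_regularisable X -> C0_regularisable (push_field T T' X).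
Proof.
move=> TK T'K [N [bN [f [cf uf]]]]; exists (push_set T' N).
split; first exact: push_isolating_block.
exists (T \o f \o T'); split; first exact: push_continuous_extension.
move=> g /(push_continuous_extension T'K TK); rewrite push_fieldK// push_setK// => /uf h p.
by move=> /(push_entryP TK T'K)/h/=/(congr1 T); rewrite !T'K.
Qed.

End LinearTransport.

(** * Orbits crossing the boundary of a block *)

Section IntermediateValue.
Variable R : realType.
Implicit Types (f g : R -> R) (a b v t : R).

Lemma ivt_incr f a b v : a <= b -> (forall t, a <= t <= b -> {for t, continuous f}) ->
  f a <= v <= f b -> exists2 c, a <= c <= b & f c = v.
Proof.
move=> ab cf /andP[fa fb].
have [||c] := @IVT R f a b v ab.
- by apply: continuous_in_subspaceT => t; rewrite inE/= in_itv/=; exact: cf.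
- by rewrite ge_min le_max fa fb orbT.
- by rewrite in_itv/= => cab fc; exists c.
Qed.

Lemma ivt_decr f a b v : a <= b -> (forall t, a <= t <= b -> {for t, continuous f}) ->
  f b <= v <= f a -> exists2 c, a <= c <= b & f c = v.
Proof.
move=> ab cf /andP[fa fb].
have [||c] := @IVT R f a b v ab.
- by apply: continuous_in_subspaceT => t; rewrite inE/= in_itv/=; exact: cf.
- by rewrite ge_min le_max fa fb orbT.
- by rewrite in_itv/= => cab fc; exists c.
Qed.

Lemma is_derive_continuous f t (d : R) : is_derive t 1 f d -> {for t, continuous f}.
Proof.
move=> fd; apply: differentiable_continuous.
by apply/derivable1_diffP; apply: ex_derive.
Qed.

Lemma is_derive_ln f t (d : R) : is_derive t 1 f d -> 0 < f t ->
  is_derive t 1 (fun s => ln (f s)) (d / f t).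
Proof.
move=> fd f0; have := @is_derive1_comp _ (@ln R) f t _ _ (is_derive1_ln f0) fd.
by rewrite mulrC.
Qed.

Lemma is_derive_atan f t (d : R) : is_derive t 1 f d ->
  is_derive t 1 (fun s => atan (f s)) (d / (1 + f t ^+ 2)).
Proof.
move=> fd; have := @is_derive1_comp _ (@atan R) f t _ _ (is_derive1_atan (f t)) fd.
by rewrite mulrC.
Qed.

Lemma is_derive_inv f t (d : R) : is_derive t 1 f d -> f t != 0 ->
  is_derive t 1 (fun s => (f s)^-1) (- d / f t ^+ 2).
Proof.
move=> fd f0; have h := @is_deriveV _ f t _ _ f0 fd.
by apply: (is_derive_eq h); rewrite /GRing.scale/= mulrC mulrN mulNr.
Qed.

(** A zero of a solution of [f' = f * g] spreads to the whole interval, since Gronwall applied to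
    [f ^+ 2] works in both directions of time. A change of sign would produce such a zero. *)
Lemma ode_sign f g a b (K : R) : a <= b ->
  (forall t, a <= t <= b -> is_derive t 1 f (f t * g t)) ->
  (forall t, a <= t <= b -> `|g t| <= K) ->
  (0 < f a -> 0 < f b) /\ (0 < f b -> 0 < f a).
Proof.
move=> ab fd gK.
have G s t : a <= s -> s <= t -> t <= b ->
    f t ^+ 2 <= expR (2 * K * (t - s)) * f s ^+ 2 /\ f s ^+ 2 <= expR (2 * K * (t - s)) * f t ^+ 2.
  move=> as_ st tb; apply: (@gronwall _ (fun u => f u ^+ 2) (fun u => 2 * f u * (f u * g u)) (2 * K)) => // u ust.
    have h : is_derive u 1 f (f u * g u) by apply: fd; lra.
    by apply: is_derive_eq; rewrite /GRing.scale/=; ring.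
  have gu : `|g u| <= K by apply: gK; lra.
  have -> : 2 * f u * (f u * g u) = 2 * f u ^+ 2 * g u by ring.
  rewrite normrM ger0_norm; last by rewrite mulr_ge0// sqr_ge0.
  have := ler_wpM2l (sqr_ge0 (f u)) gu; lra.
have cf t : a <= t <= b -> {for t, continuous f}.
  by move=> /fd h; exact: is_derive_continuous h.
have sq0 (x : R) : x ^+ 2 <= 0 -> x = 0.
  by move=> h; apply/eqP; rewrite -sqrf_eq0 eq_le h sqr_ge0.
split=> f0; rewrite ltNge; apply/negP => f1.
- have [|c /andP[ac cb] fc] := @ivt_decr f a b 0 ab cf; first by rewrite f1 ltW.
  have [_] := G a c (lexx a) ac cb.
  by rewrite fc expr0n mulr0 => /sq0; lra.
- have [|c /andP[ac cb] fc] := @ivt_incr f a b 0 ab cf; first by rewrite f1 ltW.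
  have [+ _] := G c b ac cb (lexx b).
  by rewrite fc expr0n mulr0 => /sq0; lra.
Qed.

End IntermediateValue.

Lemma pos_lt2 (R : realFieldType) (a b : R) : 0 < a -> 0 < b ->
  exists e, [/\ 0 < e, e < a & e < b].
Proof.
move=> a0 b0; have m0 : 0 < Num.min a b by rewrite lt_min a0.
have m1 : Num.min a b <= a by rewrite ge_min lexx.
have m2 : Num.min a b <= b by rewrite ge_min lexx orbT.
by exists (Num.min a b / 2); split; lra.
Qed.

(** A Lebesgue number: the radius can be chosen uniformly over [K]. *)
Lemma compact_in_interior (R : realType) (V : normedModType R) (K N : set V) :
  compact K -> K `<=` interior N ->
  exists2 e : R, 0 < e & forall z w, K z -> `|w - z| < e -> interior N w.
Proof.
move=> /compact_near_coveringP cK KN.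
have [|] := cK R (0 : R)^'+ (fun e z => forall w, `|w - z| < e -> interior N w).
  move=> x /KN; rewrite /interior/= => /nbhs_distP[e e0 he].
  have e2 : 0 < e / 2 by rewrite divr_gt0.
  have e4 : 0 < e / 4 by rewrite divr_gt0.
  exists ([set z | `|z - x| < e / 2], [set t | t < e / 4]) => /=.
    split; first by apply/nbhs_distP; exists (e / 2).
    by near=> t; near: t; exact: nbhs_right_lt.
  move=> [z t]/= [zx te] w wz; apply/nbhs_distP; exists (e / 4) => // u uw; apply: he.
  have -> : u - x = (u - w) + ((w - z) + (z - x)) by rewrite addrA subrKA subrKA.
  rewrite (le_lt_trans (ler_normD _ _))//.
  by have := ler_normD (w - z) (z - x); lra.
move=> e /= [e0 he]; exists (e / 2); first by rewrite divr_gt0.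
have e2 : 0 < e / 2 by rewrite divr_gt0.
have he2 : ball_ Num.Def.normr 0 e (e / 2) by rewrite /= sub0r normrN gtr0_norm//; lra.
by move=> z w Kz wz; apply: (he _ he2 e2 _ Kz).
Unshelve. all: by end_near. Qed.

(** * Orbits of a locally Lipschitz field at the boundary of a block *)

Section FieldBlock.
Variables (R : realType) (X : R * R -> R * R).
Hypotheses (lipX : locally_lipschitz X) (solX : locally_solvable X).
Hypothesis ctX : continuous X.
Implicit Types (N U : set (R * R)) (h : R * R -> R * R) (p q r z : R * R) (s t : R).

Local Notation phi := (phi X).
Local Notation dom := (dom X).

(** When [l] is linear and [g] is its cofactor, this says that orbits do not cross the invariant
    line [l = 0]. *)
Lemma phi_sign (l g : R * R -> R) p t : continuous g ->
  (forall s, dom p s -> is_derive s 1 (fun u => l (phi p u)) (l (phi p s) * g (phi p s))) ->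
  dom p t -> 0 < l p -> 0 < l (phi p t).
Proof.
move=> cg dl dpt lp.
have bd a b : a <= b -> (forall s, a <= s <= b -> dom p s) ->
    exists K : R, forall s, a <= s <= b -> `|g (phi p s)| <= K.
  move=> ab dd; have cc : {within `[a, b], continuous (fun u => `|g (phi p u)|)}.
    apply: continuous_in_subspaceT => u; rewrite inE/= in_itv/= => /dd du.
    apply: continuous_comp; last exact: norm_continuous.
    by apply: continuous_comp; [exact: phi_continuous|exact: cg].
  have [u _ hu] := EVT_max ab cc.
  by exists `|g (phi p u)| => v vst; apply: hu; rewrite in_itv.
have lp0 : 0 < l (phi p 0) by rewrite phi0.
have [t0|/ltW t0] := leP 0 t.
- have dd s : 0 <= s <= t -> dom p s.
    by move=> st; apply: (dom_between solX dpt); rewrite st.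
  have [K hK] := bd _ _ t0 dd.
  have [+ _] := ode_sign t0 (fun s hs => dl s (dd s hs)) hK; exact.
- have dd s : t <= s <= 0 -> dom p s.
    by move=> st; apply: (dom_between solX dpt); rewrite st orbT.
  have [K hK] := bd _ _ t0 dd.
  have [_ +] := ode_sign t0 (fun s hs => dl s (dd s hs)) hK; exact.
Qed.

Lemma phi_const (l : R * R -> R) p t :
  (forall s, dom p s -> is_derive s 1 (fun u => l (phi p u)) 0) ->
  dom p t -> l (phi p t) = l p.
Proof.
move=> dl dpt; have lp0 : l (phi p 0) = l p by rewrite phi0.
have [t0|/ltW t0] := leP 0 t.
  rewrite -lp0; apply: (@derive0_eq _ (fun u => l (phi p u)) 0 t) => // s st.
  by apply: dl; apply: (dom_between solX dpt); rewrite st.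
rewrite -lp0; apply/esym/(@derive0_eq _ (fun u => l (phi p u)) t 0) => // s st.
by apply: dl; apply: (dom_between solX dpt); rewrite st orbT.
Qed.

Lemma exit_point_unique N p q q' : exit_point X N p q -> exit_point X N p q' -> q = q'.
Proof.
have lt_false t t' : t < t' ->
    (forall e, 0 < e -> exists s r, [/\ t < s < t + e, flow X p s r & ~ N r]) ->
    (forall s r, 0 <= s <= t' -> flow X p s r -> N r) -> 0 <= t -> False.
  move=> tt' h h' t0; have [|s [r [ste fr nr]]] := h (t' - t); first by lra.
  by apply: nr; apply: h' fr; lra.
move=> [t [t0 fq h1 h2]] [t' [t0' fq' h1' h2']].
have [tt'|tt'|tt'] := ltgtP t t'.
- by exfalso; exact: lt_false tt' h2 h1' t0.
- by exfalso; exact: lt_false tt' h2' h1 t0'.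
- by apply: (flow_unique lipX fq); rewrite tt'.
Qed.

Lemma exit_point_escapes N p q : exit_point X N p q -> ~ forward_asymptotic X N p.
Proof.
move=> [t [t0 fq h1 h2]] [_ h]; have [|s [r [ste fr nr]]] := h2 1; first by [].
have [|r' fr' Nr'] := h s; first by lra.
by apply: nr; rewrite (flow_unique lipX fr fr').
Qed.

Lemma extension_exit_point N f p q : continuous_extension X N f ->
  entry_set X N p -> exit_point X N p q -> f p = q.
Proof.
move=> [_ _ h] ep pq; apply: (exit_point_unique (N := N) (p := p)) => //; apply: h.
by split=> //; exact: exit_point_escapes pq.
Qed.

Lemma chart_along N U h p t : adapted_chart N U h -> dom p t -> U (phi p t) ->
  is_derive t 1 (fun s => (h (phi p s)).2) (dsnd h (X (phi p t)) (phi p t)).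
Proof.
move=> hU dt Ut; apply: dsnd_comp; first exact: chart_differentiable hU Ut.
exact: phi_derive.
Qed.

Lemma chart_radius_gt0 N U h p : adapted_chart N U h -> U p -> 0 < dsnd h (X p) p ->
  exists2 r : R, 0 < r & forall z, `|z - p| < r -> U z /\ 0 < dsnd h (X z) z.
Proof.
move=> hU Up hp; have ch := chart_field_continuous hU Up (@ctX p).
have : \forall z \near p, U z /\ 0 < dsnd h (X z) z.
  by apply: filterI; [exact: chart_nbhs hU Up|exact: (cvgr_gt _ ch)].
by move=> /nbhs_distP.
Qed.

Lemma chart_radius_lt0 N U h p : adapted_chart N U h -> U p -> dsnd h (X p) p < 0 ->
  exists2 r : R, 0 < r & forall z, `|z - p| < r -> U z /\ dsnd h (X z) z < 0.
Proof.
move=> hU Up hp; have ch := chart_field_continuous hU Up (@ctX p).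
have : \forall z \near p, U z /\ dsnd h (X z) z < 0.
  by apply: filterI; [exact: chart_nbhs hU Up|exact: (cvgr_lt _ ch)].
by move=> /nbhs_distP.
Qed.

Lemma phi_near N U h p : adapted_chart N U h -> U p ->
  exists2 e : R, 0 < e & forall t, `|t| < e -> dom p t /\ U (phi p t).
Proof.
move=> hU Up.
have : \forall t \near (0 : R), dom p t /\ U (phi p t).
  apply: filterI; first by apply: dom_near; exact: dom0.
  have := phi_continuous lipX (dom0 solX p); rewrite /prop_for/continuous_at phi0//.
  by apply; exact: chart_nbhs hU Up.
by move=> /nbhs_distP[e e0 he]; exists e => // t te; apply: he; rewrite subr0.
Qed.

Lemma entry_of_transversal N U h p : adapted_chart N U h -> U p -> (h p).2 = 0 ->
  0 < dsnd h (X p) p -> entry_set X N p.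
Proof.
move=> hU Up hp hv; split; first by exists U, h.
have := chart_along hU (dom0 solX p); rewrite phi0// => /(_ Up) hd.
have [|e e0 he] := derive_gt0_sign hd _ hv; first by rewrite phi0.
have [e' e'0 he'] := phi_near hU Up.
exists (Num.min e e'); first by rewrite lt_min e0.
move=> s q /andP[s1 s2] /(phiE lipX) <- Ns.
have m1 : Num.min e e' <= e by rewrite ge_min lexx.
have m2 : Num.min e e' <= e' by rewrite ge_min lexx orbT.
have [|_ ] := he (- s); first by lra.
rewrite opprK add0r; apply/negP; rewrite -leNgt.
have [|_ Us] := he' s; first by rewrite ltr_norml; lra.
by have [_ /(_ _ Us)[+ _]] := hU; apply.
Qed.

Lemma exit_of_transversal N U h p : adapted_chart N U h -> U p -> (h p).2 = 0 ->
  dsnd h (X p) p < 0 -> exit_set X N p.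
Proof.
move=> hU Up hp hv; split; first by exists U, h.
have := chart_along hU (dom0 solX p); rewrite phi0// => /(_ Up) hd.
have hd' : is_derive (0 : R) 1 (fun s => - (h (phi p s)).2) (- dsnd h (X p) p).
  exact: is_deriveN.
have [|| e e0 he] := derive_gt0_sign hd'; [by rewrite phi0// hp oppr0|by rewrite oppr_gt0|].
have [e' e'0 he'] := phi_near hU Up.
exists (Num.min e e'); first by rewrite lt_min e0.
move=> s q /andP[s1 s2] /(phiE lipX) <- Ns.
have m1 : Num.min e e' <= e by rewrite ge_min lexx.
have m2 : Num.min e e' <= e' by rewrite ge_min lexx orbT.
have [|+ _] := he s; first by lra.
rewrite add0r oppr_gt0; apply/negP; rewrite -leNgt.
have [|_ Us] := he' s; first by rewrite ltr_norml; lra.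
by have [_ /(_ _ Us)[+ _]] := hU; apply.
Qed.

Section Block.
Variable N : set (R * R).
Hypothesis blockN : isolating_block X [set 0] N.

Lemma block_closed : closed N.
Proof. by have [[cN _] _ _ _] := blockN; exact: compact_closed. Qed.

(** In a block a tangency point is both an entry and an exit point, so failing to be one of the two
    already gives transversality. *)
Lemma block_not_tangent p U h : boundary N p -> adapted_chart N U h -> U p ->
  ~ entry_set X N p \/ ~ exit_set X N p -> dsnd h (X p) p != 0.
Proof.
move=> bp hU Up he; apply/eqP => hv.
have [_ _ e _] := blockN.
have : tangency_set X N p.
  by split=> //; apply/(tangent_chart _ hU Up) => //; apply/(boundary_chart hU Up).
by rewrite -e => -[]; case: he.
Qed.

(** An orbit that stays in [N] for a while has a nonnegative normal derivative at its start, and it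
    is nonzero because the start is not an exit point. *)
Lemma forward_inside_transversal p U h (e : R) : boundary N p -> adapted_chart N U h -> U p ->
  0 < e -> (forall s, 0 < s < e -> exists2 q, flow X p s q & N q) ->
  0 < dsnd h (X p) p.
Proof.
move=> bp hU Up e0 hf.
have hp : (h p).2 = 0 by apply/(boundary_chart hU Up).
rewrite lt0r (block_not_tangent bp hU Up)//=; last first.
  right=> -[_ [t t0 ht]].
  have m1 : Num.min e t <= e by rewrite ge_min lexx.
  have m2 : Num.min e t <= t by rewrite ge_min lexx orbT.
  have m0 : 0 < Num.min e t by rewrite lt_min e0.
  have [|q fq Nq] := hf (Num.min e t / 2); first by lra.
  by apply: (ht _ _ _ fq) => //; lra.
have := chart_along hU (dom0 solX p); rewrite phi0// => /(_ Up) hd.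
have [e' e'0 he'] := phi_near hU Up.
apply: (derive_ge0_sign hd _ (e := Num.min e e')); first by rewrite phi0.
  by rewrite lt_min e0.
move=> t /andP[t0]; rewrite lt_min add0r => /andP[te te'].
have [|_ Ut] := he' t; first by rewrite gtr0_norm.
have [_ /(_ _ Ut)[+ _]] := hU; apply.
by have [|q /(phiE lipX) ->] := hf t; first by rewrite t0.
Qed.

Lemma backward_inside_transversal p U h (e : R) : boundary N p -> adapted_chart N U h -> U p ->
  0 < e -> (forall s, - e < s < 0 -> exists2 q, flow X p s q & N q) ->
  dsnd h (X p) p < 0.
Proof.
move=> bp hU Up e0 hf.
have hp : (h p).2 = 0 by apply/(boundary_chart hU Up).
rewrite lt_neqAle (block_not_tangent bp hU Up)//=; last first.
  left=> -[_ [t t0 ht]].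
  have m1 : Num.min e t <= e by rewrite ge_min lexx.
  have m2 : Num.min e t <= t by rewrite ge_min lexx orbT.
  have m0 : 0 < Num.min e t by rewrite lt_min e0.
  have [|q fq Nq] := hf (- (Num.min e t / 2)); first by lra.
  by apply: (ht _ _ _ fq) => //; lra.
have := chart_along hU (dom0 solX p); rewrite phi0// => /(_ Up) hd.
have [e' e'0 he'] := phi_near hU Up.
apply: (derive_le0_sign hd _ (e := Num.min e e')); first by rewrite phi0.
  by rewrite lt_min e0.
move=> t /andP[t0]; rewrite lt_min sub0r => /andP[te te'].
have [|_ Ut] := he' (- t); first by rewrite normrN gtr0_norm.
have [_ /(_ _ Ut)[+ _]] := hU; apply.
by have [|q /(phiE lipX) ->] := hf (- t); first by lra.
Qed.

(** At a boundary point, the forward half of the orbit would make the normal derivative positive and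
    the backward half would make it negative. *)
Lemma through_interior p (e : R) : N p -> 0 < e ->
  (forall s, - e < s < e -> exists2 q, flow X p s q & N q) -> interior N p.
Proof.
move=> Np e0 hf; have [[_ sN] _ _ _] := blockN.
have [bp|//] := smooth_domain_cases sN Np.
have [U [h [Up hU hp]]] := bp.
have h1 : 0 < dsnd h (X p) p.
  by apply: (forward_inside_transversal bp hU Up e0) => s se; apply: hf; lra.
have h2 : dsnd h (X p) p < 0.
  by apply: (backward_inside_transversal bp hU Up e0) => s se; apply: hf; lra.
by have := lt_trans h1 h2; rewrite ltxx.
Qed.

Lemma block_origin : interior N 0.
Proof.
have [_ [h1 h2 _] _ _] := blockN.
apply: (@through_interior _ 1) => //; first exact: h1.
move=> s _; have [q fq q0] := h2 0 erefl s; exists 0; last exact: h1.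
by rewrite -[X in flow _ _ _ X]q0.
Qed.

End Block.

(** Turns an orbit that is outside [N] at both ends, and inside in the middle, into an entry point
    with its exit point. On the first and last stretches the sign of the normal derivative makes the
    second chart coordinate monotone, so each contains exactly one crossing, at [T1] and [T2];
    nothing else about [N] has to be known. *)
Lemma crossing N z0 (t1 t2 te : R) U1 h1 U2 h2 :
  0 < t1 -> t1 <= t2 -> t2 < te -> dom z0 te ->
  adapted_chart N U1 h1 -> adapted_chart N U2 h2 ->
  (forall t, 0 <= t <= t1 -> U1 (phi z0 t) /\ 0 < dsnd h1 (X (phi z0 t)) (phi z0 t)) ->
  (h1 z0).2 < 0 -> 0 < (h1 (phi z0 t1)).2 ->
  (forall t, t1 <= t <= t2 -> N (phi z0 t)) ->
  (forall t, t2 <= t <= te -> U2 (phi z0 t) /\ dsnd h2 (X (phi z0 t)) (phi z0 t) < 0) ->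
  0 < (h2 (phi z0 t2)).2 -> (h2 (phi z0 te)).2 < 0 ->
  exists T1 T2, [/\ 0 <= T1 <= t1, t2 <= T2 <= te, entry_set X N (phi z0 T1) &
    exit_point X N (phi z0 T1) (phi z0 T2)].
Proof.
move=> t10 t12 t2e dte hU1 hU2 H1 s0 s1 HN H2 s2 s3.
have dd t : 0 <= t <= te -> dom z0 t.
  by move=> tt; apply: (dom_between solX dte); rewrite tt.
pose f1 t := (h1 (phi z0 t)).2; pose f2 t := (h2 (phi z0 t)).2.
have d1 t : 0 <= t <= t1 -> is_derive t 1 f1 (dsnd h1 (X (phi z0 t)) (phi z0 t)).
  by move=> tt; apply: (chart_along hU1); [apply: dd; lra|have [] := H1 _ tt].
have d2 t : t2 <= t <= te -> is_derive t 1 f2 (dsnd h2 (X (phi z0 t)) (phi z0 t)).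
  by move=> tt; apply: (chart_along hU2); [apply: dd; lra|have [] := H2 _ tt].
have m1 s t : 0 <= s -> s < t -> t <= t1 -> f1 s < f1 t.
  move=> h0 st tt; apply: (derive_gt st) => [u ut|u ut]; first by apply: d1; lra.
  by have [] := H1 u; first lra.
have m2 s t : t2 <= s -> s < t -> t <= te -> f2 t < f2 s.
  move=> h0 st tt; apply: (derive_lt st) => [u ut|u ut]; first by apply: d2; lra.
  by have [] := H2 u; first lra.
have [T1 T1b fT1] : exists2 c, 0 <= c <= t1 & f1 c = 0.
  apply: ivt_incr; first exact: ltW.
    by move=> t /d1 h; exact: is_derive_continuous h.
  by rewrite /f1 phi0// !ltW.
have [T2 T2b fT2] : exists2 c, t2 <= c <= te & f2 c = 0.
  apply: ivt_decr; first exact: ltW.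
    by move=> t /d2 h; exact: is_derive_continuous h.
  by rewrite !ltW.
have T10 : 0 < T1.
  rewrite lt0r; apply/andP; split; last by lra.
  by apply/eqP => T10; move: fT1; rewrite T10 /f1 phi0//; lra.
have T2e : T2 < te.
  rewrite lt_neqAle; apply/andP; split; last by lra.
  by apply/eqP => T2E; move: fT2; rewrite T2E /f2; lra.
have NT t : T1 <= t <= T2 -> N (phi z0 t).
  move=> tT; have [tt1|tt1] := leP t t1.
    have [|Ut _] := H1 t; first by lra.
    have [_ /(_ _ Ut)[_ +]] := hU1; apply; rewrite -/(f1 t) -fT1.
    have [e|ne] := eqVneq t T1; first by rewrite e.
    by apply/ltW/m1; [lra| rewrite lt_neqAle eq_sym ne; lra|lra].
  have [tt2|tt2] := leP t t2; first by apply: HN; lra.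
  have [|Ut _] := H2 t; first by lra.
  have [_ /(_ _ Ut)[_ +]] := hU2; apply; rewrite -/(f2 t) -fT2.
  have [e|ne] := eqVneq t T2; first by rewrite e.
  by apply/ltW/m2; [lra| rewrite lt_neqAle ne; lra|lra].
have FT s t : 0 <= s <= te -> 0 <= t <= te -> flow X (phi z0 s) (t - s) (phi z0 t).
  move=> ss tt; have := flow_opp (dom_flow lipX (dd _ ss)) => h.
  by have := flow_add lipX h (dom_flow lipX (dd _ tt)); rewrite addrC.
have FE s t r : 0 <= s <= te -> 0 <= s + t <= te -> flow X (phi z0 s) t r -> r = phi z0 (s + t).
  move=> ss tt fr; apply: (flow_unique lipX fr).
  by have := FT _ _ ss tt; rewrite addrC addKr.
exists T1, T2; split=> //.
- have [|U1T dT] := H1 T1; first by lra.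
  by apply: (entry_of_transversal hU1 U1T) => //; exact: fT1.
- exists (T2 - T1); split.
  + lra.
  + by apply: FT; lra.
  + by move=> s r st /FE ->; [apply: NT; lra|lra|lra].
  + move=> e e0; have mm : 0 < Num.min e (te - T2) by rewrite lt_min e0 subr_gt0.
    have l1 : Num.min e (te - T2) <= e by rewrite ge_min lexx.
    have l2 : Num.min e (te - T2) <= te - T2 by rewrite ge_min lexx orbT.
    set m := Num.min e _ in mm l1 l2.
    exists (T2 - T1 + m / 2), (phi z0 (T2 + m / 2)); split.
    * lra.
    * have -> : T2 - T1 + m / 2 = (T2 + m / 2) - T1 by ring.
      by apply: FT; lra.
    * have [|Ut _] := H2 (T2 + m / 2); first by lra.
      have [_ /(_ _ Ut)[+ _]] := hU2 => h /h; rewrite -/(f2 _).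
      have := m2 T2 (T2 + m / 2); rewrite fT2 => h2' h0; have : f2 (T2 + m / 2) < 0 by apply: h2'; lra.
      lra.
Qed.

End FieldBlock.

(** * Invariant rays and elliptic sectors *)

Section Rays.
Variable R : realType.
Variables p0 p1 p2 q0 q1 q2 : R.
Local Notation X := (quadratic_field p0 p1 p2 q0 q1 q2).
Implicit Types (v p q : R * R) (s t l : R).

Let lipX : locally_lipschitz X := quadratic_field_lipschitz p0 p1 p2 q0 q1 q2.
Let solX : locally_solvable X := quadratic_field_solvable p0 p1 p2 q0 q1 q2.

Lemma quadratic_field_continuous : continuous X.
Proof.
move=> z; have c1 : {for z, continuous (fun w : R * R => w.1)} by exact: cvg_fst_comp.
have c2 : {for z, continuous (fun w : R * R => w.2)} by exact: cvg_snd_comp.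
have F (a b c : R) : {for z, continuous (fun w : R * R =>
    a * w.1 ^+ 2 + b * w.1 * w.2 + c * w.2 ^+ 2)}.
  apply: cvgD; first apply: cvgD.
  - by apply: cvgM; [exact: cvg_cst|exact: (cvg_comp _ _ c1 (@exprn_continuous R 2 _))].
  - by apply: cvgM; [apply: cvgM; [exact: cvg_cst|exact: c1]|exact: c2].
  - by apply: cvgM; [exact: cvg_cst|exact: (cvg_comp _ _ c2 (@exprn_continuous R 2 _))].
exact: (cvg_pair (F p0 p1 p2) (F q0 q1 q2)).
Qed.

Lemma quadratic_fieldZ s v : X (s *: v) = s ^+ 2 *: X v.
Proof.
by rewrite /quadratic_field /=; congr pair; rewrite /GRing.scale/=; ring.
Qed.

(** On an invariant line the equation is [s' = l * s ^+ 2], with blow-up when [l * s * t] reaches 1.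
    The margin [e] leaves an open interval of times around 0 and [t] on which the denominator stays
    positive. *)
Lemma ray_flow v l s t : X v = l *: v -> l * s * t < 1 ->
  flow X (s *: v) t ((s / (1 - l * s * t)) *: v).
Proof.
move=> Xv; set k := l * s => kt.
pose m := Num.max 0 (k * t).
have m0 : 0 <= m /\ k * t <= m by rewrite /m !le_max !lexx orbT.
have m1 : m < 1 by rewrite /m gt_max ltr01 kt.
pose e := (1 - m) / (2 * (`|k| + 1)).
have k1 : 0 < 2 * (`|k| + 1) by rewrite mulr_gt0// ltr_wpDl.
have e0 : 0 < e by rewrite /e divr_gt0// subr_gt0.
have ke : `|k| * e < 1 - m.
  have : `|k| * e = (1 - m) / 2 - e by rewrite /e; field; apply: lt0r_neq0; lra.
  by lra.
have min_t : Num.min 0 t <= 0 /\ Num.min 0 t <= t by rewrite !ge_min !lexx orbT.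
have max_t : 0 <= Num.max 0 t /\ t <= Num.max 0 t by rewrite !le_max !lexx orbT.
pose c u := (s / (1 - k * u)) *: v.
have pos u : Num.min 0 t - e < u < Num.max 0 t + e -> 0 < 1 - k * u.
  move=> /andP[u1 u2]; rewrite subr_gt0; apply: (@le_lt_trans _ _ (m + `|k| * e)); last by lra.
  have [k0|k0] := leP 0 k.
    rewrite (ger0_norm k0); have : k * u <= k * (Num.max 0 t + e) by rewrite ler_wpM2l// ltW.
    have : k * Num.max 0 t <= m.
      by rewrite maxr_pMr// mulr0.
    by lra.
  rewrite (ltr0_norm k0).
  have : k * u <= k * (Num.min 0 t - e) by rewrite ler_nM2l// ltW.
  have : k * Num.min 0 t <= m.
    by rewrite minr_nMr ?(ltW k0)// mulr0.
  by lra.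
exists (Num.min 0 t - e), (Num.max 0 t + e), c; split.
- lra.
- lra.
- by rewrite /c mulr0 subr0 divr1.
- by [].
- move=> u /pos ku; have ku0 : 1 - k * u != 0 by rewrite gt_eqF.
  have -> : X (c u) = (k * s / (1 - k * u) ^+ 2) *: v.
    by rewrite /c quadratic_fieldZ Xv scalerA; congr (_ *: _); rewrite /k; field.
  have D : is_derive u 1 (fun u : R => s / (1 - k * u)) (k * s / (1 - k * u) ^+ 2).
    have D1 : is_derive u 1 (fun u : R => 1 - k * u) (- k).
      by apply: is_derive_eq; rewrite /GRing.scale/=; ring.
    have D2 := is_derive_inv D1 ku0.
    by apply: is_derive_eq; rewrite /GRing.scale/=; field.
  by apply/is_derive_pairP; split; rewrite /c /=; apply: is_derive_eq; rewrite /GRing.scale/=; ring.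
Qed.

Section RayInBlock.
Variables (N : set (R * R)) (v : R * R) (l : R).
Hypotheses (blockN : isolating_block X [set 0] N) (v0 : v != 0).
Hypotheses (Xv : X v = l *: v).

(** The parameter [s1] is the supremum of the lengths for which the segment from the origin is
    contained in [N]; it is finite as [N] is bounded, and its end point belongs to the closed set
    [N] but not to the interior. *)
Lemma ray_segment : exists s1 : R, [/\ 0 < s1, boundary N (s1 *: v) &
  forall s, 0 <= s <= s1 -> N (s *: v)].
Proof.
have [[cN sN] _ _ _] := blockN.
have nv : 0 < `|v| by rewrite normr_gt0.
have [M [_ hM]] := compact_bounded cN.
pose A := [set s : R | 0 <= s /\ forall u, 0 <= u <= s -> N (u *: v)].
have N0 : N 0 := interior_subset (block_origin lipX solX blockN).
have A0 : A 0.
  split=> // u u0; have -> : u = 0 by lra.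
  by rewrite scale0r.
have ubA s : A s -> s <= (`|M| + 1) / `|v|.
  move=> [s0 /(_ s) h]; rewrite ler_pdivlMr//.
  have {}h : N (s *: v) by apply: h; lra.
  have Mm : M < `|M| + 1 by rewrite (le_lt_trans (ler_norm _))// ltrDl.
  by have := hM _ Mm _ h; rewrite /= normrZ ger0_norm.
have supA : has_sup A.
  by split; [exists 0|exists ((`|M| + 1) / `|v|) => s /ubA].
pose s1 := sup A.
have As s : 0 <= s < s1 -> N (s *: v).
  move=> /andP[s0 ss]; have [|u [u0 hu] su] := @sup_adherent _ A (s1 - s) _ supA; first by rewrite subr_gt0.
  by apply: hu; rewrite s0 ltW//; move: su; rewrite -/s1; lra.
have s1_ge0 : 0 <= s1 by apply: ub_le_sup => //; case: supA.
have near_in u : interior N (u *: v) -> exists2 e : R, 0 < e & forall w, `|w - u| < e -> N (w *: v).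
  rewrite /interior/= => /nbhs_distP[e e0 he]; exists (e / `|v|); first by rewrite divr_gt0.
  by move=> w wu; apply: he; rewrite -scalerBl normrZ -ltr_pdivlMr.
have sup_not_in : ~ interior N (s1 *: v).
  move=> /near_in[e e0 he].
  have : A (s1 + e / 2).
    split; first by lra.
    move=> u u0; have [us|us] := ltP u s1; first by apply: As; lra.
    by apply: he; rewrite ger0_norm; lra.
  by move=> /(ub_le_sup (proj2 supA)); rewrite -/s1; lra.
have s1_gt0 : 0 < s1.
  rewrite lt0r s1_ge0 andbT; apply/eqP => s10; apply: sup_not_in.
  by rewrite s10 scale0r; exact: (block_origin lipX solX blockN).
have Ns1 : N (s1 *: v).
  have clN := block_closed blockN.
  apply: clN => B; rewrite /= => /nbhs_distP[e e0 he].
  have ev : 0 < e / `|v| by rewrite divr_gt0.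
  have m0 : 0 < Num.min s1 (e / `|v|) by rewrite lt_min s1_gt0.
  have m1 : Num.min s1 (e / `|v|) <= s1 by rewrite ge_min lexx.
  have m2 : Num.min s1 (e / `|v|) <= e / `|v| by rewrite ge_min lexx orbT.
  set m := Num.min _ _ in m0 m1 m2.
  exists ((s1 - m / 2) *: v); split; first by apply: As; lra.
  apply: he; rewrite -scalerBl normrZ -ltr_pdivlMr//.
  by rewrite addrAC subrr add0r normrN gtr0_norm; lra.
exists s1; split=> //; first by have [] := smooth_domain_cases sN Ns1.
move=> s ss; have [e|ne] := eqVneq s s1; first by rewrite e.
by apply: As; rewrite lt_neqAle ne; lra.
Qed.

Variable s1 : R.
Hypotheses (s1_gt0 : 0 < s1) (bs1 : boundary N (s1 *: v)).
Hypothesis (Ns1 : forall s, 0 <= s <= s1 -> N (s *: v)).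

(** For a short time in both directions the orbit of [s *: v] moves along the segment without
    passing [s1 *: v]; the length [e] of that time makes [k * t <= (s1 - s) / s1], that is
    [s / (1 - k * t) <= s1]. *)
Lemma ray_interior s : 0 <= s < s1 -> interior N (s *: v).
Proof.
move=> /andP[s0 ss]; pose k := l * s.
pose e := (s1 - s) / (s1 * (`|k| + 1)).
have k1 : 0 < `|k| + 1 by rewrite ltr_wpDl.
have e0 : 0 < e by rewrite /e divr_gt0// ?subr_gt0// mulr_gt0.
apply: (through_interior lipX solX blockN _ e0); first by apply: Ns1; lra.
move=> t te.
have kt : s1 * (k * t) <= s1 - s.
  have h1 : k * t <= `|k| * `|t| by rewrite -normrM ler_norm.
  have h2 : `|t| <= e by rewrite ler_norml; lra.
  have h3 : `|k| * `|t| <= (`|k| + 1) * e by rewrite ler_pM// lerDl.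
  have h4 : s1 * ((`|k| + 1) * e) = s1 - s by rewrite /e; field; rewrite !gt_eqF.
  by rewrite -h4 ler_pM2l//; lra.
have kt1 : k * t <= (s1 - s) / s1 by rewrite ler_pdivlMr// mulrC.
have [s0'|s_gt0] := eqVneq s 0.
  exists 0; last by rewrite -[0](scale0r v); apply: Ns1; lra.
  have := @ray_flow v l 0 t Xv; rewrite mulr0 mul0r scale0r mul0r scale0r s0' scale0r.
  by apply.
have sp : 0 < s by rewrite lt0r s_gt0.
have kt2 : k * t < 1.
  by rewrite (le_lt_trans kt1)// ltr_pdivrMr// mul1r; lra.
exists ((s / (1 - k * t)) *: v); first exact: ray_flow.
have d0 : 0 < 1 - k * t by rewrite subr_gt0.
apply: Ns1; apply/andP; split; [by rewrite divr_ge0// ltW|rewrite ler_pdivrMr//].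
by rewrite mulrBr mulr1; lra.
Qed.

Lemma ray_entering U h : l < 0 -> adapted_chart N U h -> U (s1 *: v) ->
  0 < dsnd h (X (s1 *: v)) (s1 *: v).
Proof.
move=> l0 hU Us; apply: (forward_inside_transversal lipX solX blockN bs1 hU Us ltr01).
move=> t /andP[t0 _].
have k0 : 0 <= - (l * s1 * t) by rewrite oppr_ge0 -mulrA nmulr_rle0// mulr_ge0// ltW.
exists ((s1 / (1 - l * s1 * t)) *: v); first by apply: ray_flow => //; lra.
have d1 : 1 <= 1 - l * s1 * t by lra.
have d0 : 0 < 1 - l * s1 * t by rewrite (lt_le_trans _ d1).
apply: Ns1; apply/andP; split; first by rewrite divr_ge0 ?(ltW s1_gt0) ?(ltW d0).
by rewrite ler_pdivrMr// ler_peMr// ltW.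
Qed.

Lemma ray_exiting U h : 0 < l -> adapted_chart N U h -> U (s1 *: v) ->
  dsnd h (X (s1 *: v)) (s1 *: v) < 0.
Proof.
move=> l0 hU Us; apply: (backward_inside_transversal lipX solX blockN bs1 hU Us ltr01).
move=> t /andP[_ t0].
have k0 : 0 <= - (l * s1 * t) by rewrite oppr_ge0 nmulr_lle0 ?mulr_ge0 ?ltW.
exists ((s1 / (1 - l * s1 * t)) *: v); first by apply: ray_flow => //; lra.
have d1 : 1 <= 1 - l * s1 * t by lra.
have d0 : 0 < 1 - l * s1 * t by rewrite (lt_le_trans _ d1).
apply: Ns1; apply/andP; split; first by rewrite divr_ge0 ?(ltW s1_gt0) ?(ltW d0).
by rewrite ler_pdivrMr// ler_peMr// ltW.
Qed.

End RayInBlock.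

(** A bounded orbit is complete, so an orbit that remains near the origin is a nonzero invariant
    subset of [N]. *)
Lemma no_small_orbits N : isolating_block X [set 0] N ->
  (forall e : R, 0 < e -> exists2 p, p != 0 & forall t q, flow X p t q -> `|q| < e) -> False.
Proof.
move=> blockN h.
have := block_origin lipX solX blockN; rewrite /interior/= => /nbhs_distP[e e0 he].
have [p pn0 hp] := h _ e0.
have bd (sg : bool) t : 0 <= t -> dom X p ((-1) ^+ sg * t).
  by apply: (dom_bounded lipX solX (M := e)) => u q _ /hp/ltW.
have dp t : dom X p t.
  have [t0|t0] := leP 0 t; first by have := bd false t t0; rewrite expr0 mul1r.
  by have := bd true (- t); rewrite expr1 mulN1r opprK; apply; lra.
have [_ [_ _ hm] _ _] := blockN.
have : [set q | exists t, flow X p t q] `<=` [set 0].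
  apply: hm => [q [t /hp]|q [t fq] u]; first by rewrite -[X in `|X|]subr0; exact: he.
  have [r fr] := dp (t + u); exists r; last by exists (t + u).
  by have := flow_add lipX (flow_opp fq) fr; rewrite addKr.
move=> /(_ p) /= h0; move/eqP: pn0; apply; apply: h0.
by exists 0; exact: flow0.
Qed.

Lemma phi_derive1 p t : dom X p t ->
  is_derive t 1 (fun s => (phi X p s).1) (X (phi X p t)).1.
Proof. by move=> /(phi_derive lipX)/is_derive_pairP[]. Qed.

Lemma phi_derive2 p t : dom X p t ->
  is_derive t 1 (fun s => (phi X p s).2) (X (phi X p t)).2.
Proof. by move=> /(phi_derive lipX)/is_derive_pairP[]. Qed.

End Rays.

Section Elliptic.
Variable R : realType.

Lemma canonical_fieldE (k1 k2 : R) :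
  canonical_field k1 k2 = quadratic_field k1 k2 (-1) 0 (k1 + 1) k2.
Proof.
by apply/funext => z; rewrite /canonical_field /quadratic_field; congr pair; ring.
Qed.

Section Canonical.
Variables k1 k2 : R.
Local Notation X := (quadratic_field k1 k2 (-1) 0 (k1 + 1) k2).

Let lipX : locally_lipschitz X := quadratic_field_lipschitz k1 k2 (-1) 0 (k1 + 1) k2.
Let solX : locally_solvable X := quadratic_field_solvable k1 k2 (-1) 0 (k1 + 1) k2.

(** The logarithm of a Darboux integral on the upper half-plane. The derivatives of the three
    functions along the flow are [2 * (k1 * x + k2 * y)], [(k1 + 1) * x + k2 * y] and [- y], and the
    weights cancel them. *)
Definition canonical_integral (z : R * R) : R :=
  (1 + k1) / 2 * ln (z.1 ^+ 2 + z.2 ^+ 2) - k1 * ln z.2 + k2 * atan (z.1 / z.2).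

Lemma canonical_upper_half p t : dom X p t -> 0 < p.2 -> 0 < (phi X p t).2.
Proof.
move=> dp p2; apply: (phi_sign lipX solX (l := snd)
  (g := fun z => (k1 + 1) * z.1 + k2 * z.2)) => //.
  move=> z; apply: cvgD; apply: cvgM; [exact: cvg_cst|exact: cvg_fst_comp|exact: cvg_cst|].
  exact: cvg_snd_comp.
move=> s /phi_derive2 h; apply: (is_derive_eq h).
by rewrite /quadratic_field/=; ring.
Qed.

Lemma canonical_integral_const p t : dom X p t -> 0 < p.2 ->
  canonical_integral (phi X p t) = canonical_integral p.
Proof.
move=> dp p2; apply: (@phi_const _ _ lipX solX canonical_integral p t _ dp) => s ds.
have y0 := canonical_upper_half ds p2.
have /phi_derive1 := ds; have /phi_derive2 := ds.
rewrite /canonical_integral.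
set x := fun s => (phi X p s).1; set y := fun s => (phi X p s).2.
rewrite /quadratic_field/= -/(x s) -/(y s) => dy dx.
have ys0 : 0 < y s := y0.
have yn0 : y s != 0 by rewrite gt_eqF.
have r0 : 0 < x s ^+ 2 + y s ^+ 2 by rewrite ltr_wpDl ?sqr_ge0// exprn_gt0.
have rn0 : x s ^+ 2 + y s ^+ 2 != 0 by rewrite gt_eqF.
have d1 : is_derive s 1 (fun s => ln (x s ^+ 2 + y s ^+ 2))
    (2 * (k1 * x s + k2 * y s)).
  have dr : is_derive s 1 (fun s => x s ^+ 2 + y s ^+ 2)
      (2 * (k1 * x s + k2 * y s) * (x s ^+ 2 + y s ^+ 2)).
    by apply: is_derive_eq; rewrite /GRing.scale/=; ring.
  by apply: (is_derive_eq (is_derive_ln dr r0)); field.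
have d2 : is_derive s 1 (fun s => ln (y s)) ((k1 + 1) * x s + k2 * y s).
  by apply: (is_derive_eq (is_derive_ln dy ys0)); field.
have d3 : is_derive s 1 (fun s => atan (x s / y s)) (- y s).
  have dV := is_derive_inv dy yn0.
  have du : is_derive s 1 (fun s => x s / y s) (- (x s ^+ 2 + y s ^+ 2) / y s).
    by apply: is_derive_eq; rewrite /GRing.scale/=; field.
  apply: (is_derive_eq (is_derive_atan du)); field.
  by rewrite yn0 addrC rn0.
have comb (f1 f2 f3 : R -> R) (e1 e2 e3 : R) : is_derive s 1 f1 e1 -> is_derive s 1 f2 e2 ->
    is_derive s 1 f3 e3 ->
    is_derive s 1 (fun u => (1 + k1) / 2 * f1 u - k1 * f2 u + k2 * f3 u)
      ((1 + k1) / 2 * e1 - k1 * e2 + k2 * e3).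
  by move=> h1 h2 h3; apply: is_derive_eq; rewrite /GRing.scale/=; ring.
by apply: (is_derive_eq (comb _ _ _ _ _ _ d1 d2 d3)); field.
Qed.

Lemma atan_bound (u : R) : - (pi / 2) <= atan u <= pi / 2.
Proof. by rewrite !ltW ?atan_gtNpi2 ?atan_ltpi2. Qed.

(** As [k1 > 0] and [y] is at most the radius [r], the integral is at least [ln r] minus
    [|k2| * pi / 2]. At [(0, y0)] it equals [ln y0], so the whole orbit satisfies [r <= y0 * C]. *)
Lemma canonical_elliptic N : 0 < k1 -> isolating_block X [set 0] N -> False.
Proof.
move=> k10 blockN; apply: (no_small_orbits blockN) => e e0.
pose C := expR (`|k2| * (pi / 2)).
have C0 : 0 < C := expR_gt0 _.
pose y0 := e / (2 * C).
have y0_gt0 : 0 < y0 by rewrite divr_gt0// mulr_gt0.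
exists (0, y0); first by apply/eqP => -[y0E]; move: y0_gt0; rewrite y0E ltxx.
move=> t q fq.
have dq : dom X (0, y0) t by exists q.
have qE := phiE lipX fq.
have q2 : 0 < q.2 by rewrite -qE; exact: canonical_upper_half.
have := canonical_integral_const dq y0_gt0; rewrite qE /canonical_integral/=.
rewrite mul0r atan0 mulr0 addr0 expr0n add0r lnXn//.
have ly0 : ln y0 *+ 2 = 2 * ln y0 by rewrite mulr_natl.
rewrite ly0; clear ly0.
set r2 := q.1 ^+ 2 + q.2 ^+ 2 => I.
have r2q : q.2 ^+ 2 <= r2 by rewrite /r2 lerDr sqr_ge0.
have r20 : 0 < r2 by rewrite (lt_le_trans _ r2q)// exprn_gt0.
have l1 : 2 * ln q.2 <= ln r2.
  by rewrite mulr_natl -lnXn// ler_ln ?posrE// exprn_gt0.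
have l2 : `|k2 * atan (q.1 / q.2)| <= `|k2| * (pi / 2).
  by rewrite normrM ler_wpM2l// ler_norml atan_bound.
have l3 : ln r2 <= 2 * ln (y0 * C).
  rewrite lnM ?posrE// /C expRK.
  have k1l := ler_wpM2l (ltW k10) l1.
  move: l2; rewrite ler_norml => /andP[l2 _]; lra.
have l4 : r2 < e ^+ 2.
  have yC : y0 * C = e / 2 by rewrite /y0; field; rewrite gt_eqF.
  rewrite -ltr_ln ?posrE ?exprn_gt0//; apply: (le_lt_trans l3).
  rewrite yC lnXn// mulr_natl ltrMn2r/= ltr_ln ?posrE//; lra.
have B (x : R) : x ^+ 2 <= r2 -> `|x| < e.
  move=> xr; rewrite -ltr_sqr ?nnegrE ?(ltW e0)// real_normK ?num_real//; lra.
by rewrite sup_normE gt_max !B// /r2 lerDl sqr_ge0.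
Qed.

End Canonical.

(** Normalised so that the directional polynomial is [x * y * (x - y)]. On the vectors [(1, 0)],
    [(0, 1)] and [(1, 1)] of its three zero lines the field acts by the factors [a], [d] and
    [a + d + 1]. *)
Definition lv_field (a d : R) : R * R -> R * R := quadratic_field a (d + 1) 0 0 (a + 1) d.

Section LotkaVolterra.
Variables a d : R.
Local Notation X := (lv_field a d).

Let lipX : locally_lipschitz X := quadratic_field_lipschitz a (d + 1) 0 0 (a + 1) d.
Let solX : locally_solvable X := quadratic_field_solvable a (d + 1) 0 0 (a + 1) d.

Lemma lin_continuous (u v : R) : continuous (fun z : R * R => u * z.1 + v * z.2).
Proof.
move=> z; apply: cvgD; apply: cvgM; [exact: cvg_cst|exact: cvg_fst_comp|exact: cvg_cst|].
exact: cvg_snd_comp.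
Qed.

Lemma lv_y_gt0 p t : dom X p t -> 0 < p.2 -> 0 < (phi X p t).2.
Proof.
move=> dp p2; apply: (phi_sign lipX solX (l := snd)
  (g := fun z => (a + 1) * z.1 + d * z.2)) => //; first exact: lin_continuous.
move=> s /phi_derive2 h; apply: (is_derive_eq h).
by rewrite /lv_field /quadratic_field/=; ring.
Qed.

Lemma lv_x_lt0 p t : dom X p t -> p.1 < 0 -> (phi X p t).1 < 0.
Proof.
move=> dp p1; rewrite -oppr_gt0; apply: (phi_sign lipX solX (l := fun z => - z.1)
  (g := fun z => a * z.1 + (d + 1) * z.2)); rewrite ?oppr_gt0//; first exact: lin_continuous.
move=> s /phi_derive1 h; have h' := is_deriveN h; apply: (is_derive_eq h').
by rewrite /lv_field /quadratic_field/=; ring.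
Qed.

Lemma lv_x_gt0 p t : dom X p t -> 0 < p.1 -> 0 < (phi X p t).1.
Proof.
move=> dp p1; apply: (phi_sign lipX solX (l := fst)
  (g := fun z => a * z.1 + (d + 1) * z.2)) => //; first exact: lin_continuous.
move=> s /phi_derive1 h; apply: (is_derive_eq h).
by rewrite /lv_field /quadratic_field/=; ring.
Qed.

(** The logarithm of a Darboux integral on the sector [x < 0 < y], built from the three invariant
    lines. The exponents add up to 1, so the integral itself is homogeneous of degree one. *)
Definition lv_integral (z : R * R) : R :=
  - d * ln (- z.1) - a * ln z.2 + (1 + a + d) * ln (z.2 - z.1).

Lemma lv_integral_const p t : dom X p t -> p.1 < 0 -> 0 < p.2 ->
  lv_integral (phi X p t) = lv_integral p.
Proof.
move=> dp p1 p2; apply: (@phi_const _ _ lipX solX lv_integral p t _ dp) => s ds.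
have y0 := lv_y_gt0 ds p2; have x0 := lv_x_lt0 ds p1.
have /phi_derive1 := ds; have /phi_derive2 := ds.
rewrite /lv_integral.
set x := fun s => (phi X p s).1; set y := fun s => (phi X p s).2.
rewrite -/X /lv_field /quadratic_field/= -/(x s) -/(y s) => dy dx.
have ys0 : 0 < y s := y0.
have xs0 : 0 < - x s by rewrite oppr_gt0.
have yxs0 : 0 < y s - x s by rewrite addr_gt0.
have d1 : is_derive s 1 (fun s => ln (- x s)) (a * x s + (d + 1) * y s).
  have dNx : is_derive s 1 (fun s => - x s) (- (a * x s ^+ 2 + (d + 1) * x s * y s + 0 * y s ^+ 2)).
    exact: is_deriveN.
  by apply: (is_derive_eq (is_derive_ln dNx xs0)); field; lra.
have d2 : is_derive s 1 (fun s => ln (y s)) ((a + 1) * x s + d * y s).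
  by apply: (is_derive_eq (is_derive_ln dy ys0)); field; rewrite gt_eqF.
have d3 : is_derive s 1 (fun s => ln (y s - x s)) (a * x s + d * y s).
  have dyx := is_deriveB dy dx.
  by apply: (is_derive_eq (@is_derive_ln _ (fun s => y s - x s) _ _ dyx yxs0)); field; rewrite gt_eqF.
by apply: is_derive_eq; rewrite /GRing.scale/=; ring.
Qed.

(** For positive [a] and [d] the integral is at least [ln (y - x)], because [- x] and [y] are both
    at most [y - x]. At [(- y0, y0)] it equals [ln y0 + (1 + a + d) * ln 2], whence the constant
    [C]. *)
Lemma lv_elliptic N : 0 < a -> 0 < d -> isolating_block X [set 0] N -> False.
Proof.
move=> a0 d0 blockN; apply: (no_small_orbits blockN) => e e0.
pose C := expR ((1 + a + d) * ln 2).
have C0 : 0 < C := expR_gt0 _.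
pose y0 := e / (2 * C).
have y0_gt0 : 0 < y0 by rewrite divr_gt0// mulr_gt0.
exists (- y0, y0); first by apply/eqP => -[_ y0E]; move: y0_gt0; rewrite y0E ltxx.
move=> t q fq.
have dq : dom X (- y0, y0) t by exists q.
have qE := phiE lipX fq.
have ny0 : (- y0, y0).1 < 0 by rewrite /= oppr_lt0.
have q2 : 0 < q.2 by rewrite -qE; exact: lv_y_gt0.
have q1 : q.1 < 0 by rewrite -qE; exact: lv_x_lt0.
have := lv_integral_const dq ny0 y0_gt0; rewrite qE /lv_integral/= !opprK => I.
have nq1 : 0 < - q.1 by rewrite oppr_gt0.
have s0 : 0 < q.2 - q.1 by rewrite addr_gt0.
have l1 : ln (- q.1) <= ln (q.2 - q.1) by rewrite ler_ln ?posrE//; lra.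
have l2 : ln q.2 <= ln (q.2 - q.1) by rewrite ler_ln ?posrE//; lra.
have h1 := ler_wpM2l (ltW d0) l1; have h2 := ler_wpM2l (ltW a0) l2.
have l3 : ln (q.2 - q.1) <= ln (y0 * C).
  rewrite lnM ?posrE// /C expRK.
  have E2 : ln (y0 + y0) = ln y0 + ln 2.
    by rewrite -lnM ?posrE//; congr ln; ring.
  by move: I; rewrite E2; lra.
have yC : y0 * C = e / 2 by rewrite /y0; field; rewrite gt_eqF.
have yC0 : 0 < y0 * C by rewrite mulr_gt0.
move: l3; rewrite ler_ln ?posrE// yC => l3.
by rewrite sup_normE gt_max !ltr_norml; lra.
Qed.

End LotkaVolterra.

End Elliptic.

(** * Hyperbolic sectors *)

Section HyperbolicSector.
Variables (R : realType) (al de : R).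
Hypotheses (al0 : 0 < al) (de0 : 0 < de).
Local Notation X := (lv_field (- al) (- de)).

Let lipX : locally_lipschitz X := quadratic_field_lipschitz _ _ _ _ _ _.
Let solX : locally_solvable X := quadratic_field_solvable _ _ _ _ _ _.
Let ctX : continuous X := @quadratic_field_continuous R _ _ _ _ _ _.

(** Minus the cofactor of the line [x = y]. It decreases strictly along every orbit of the sector
    [x < 0 < y], is positive near the [y] axis and negative near the [x] axis away from the origin,
    so its levels tell how far the passage has gone. *)
Definition clock (z : R * R) : R := al * z.1 + de * z.2.

Definition clock_rate (z : R * R) : R := - clock z ^+ 2 + (al + de) * z.1 * z.2.

Lemma clock_derive p t : dom X p t ->
  is_derive t 1 (fun s => clock (phi X p s)) (clock_rate (phi X p t)).
Proof.
move=> dt; have := phi_derive1 dt; have := phi_derive2 dt.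
rewrite /clock_rate /clock.
set x := fun s => (phi X p s).1; set y := fun s => (phi X p s).2.
rewrite -/X /lv_field /quadratic_field/= -/(x t) -/(y t) => dy dx.
by apply: is_derive_eq; rewrite /GRing.scale/=; ring.
Qed.

(* With [A = - al x] and [B = de y] the rate is [- ((A - B)^2 + c A B)], and
   [(A - B)^2 + c A B >= mu (A + B)^2] as soon as [mu <= 1] and [4 mu <= c]. *)
Lemma clock_rate_bound (sg : R) : 0 < sg -> exists2 w : R, 0 < w &
  forall z, z.1 < 0 -> 0 < z.2 -> sg <= z.2 - z.1 -> clock_rate z <= - w.
Proof.
move=> sg0; pose c := (al + de) / (al * de).
have ad0 : 0 < al * de by rewrite mulr_gt0.
have c0 : 0 < c by rewrite divr_gt0// addr_gt0.
have [mu [mu0 mu1 mu2]] : exists mu, [/\ 0 < mu, mu < 1 & mu < c / 4].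
  by apply: pos_lt2 => //; rewrite divr_gt0.
have [ga [ga0 ga1 ga2]] := pos_lt2 al0 de0.
exists (mu * (ga * sg) ^+ 2); first by rewrite mulr_gt0// exprn_gt0// mulr_gt0.
move=> z x0 y0 hs; pose A := - (al * z.1); pose B := de * z.2.
have A0 : 0 < A by rewrite /A oppr_gt0 pmulr_rlt0.
have B0 : 0 < B by rewrite /B mulr_gt0.
have rE : clock_rate z = - ((A - B) ^+ 2 + c * (A * B)).
  by rewrite /clock_rate /clock /A /B /c; field; rewrite !gt_eqF.
have AB : ga * sg <= A + B.
  have h1 : ga * - z.1 <= A by rewrite /A -mulrN ler_wpM2r ?oppr_ge0 ?ltW.
  have h2 : ga * z.2 <= B by rewrite /B ler_wpM2r ?ltW.
  have h3 : ga * sg <= ga * (z.2 - z.1) by rewrite ler_wpM2l// ltW.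
  lra.
have AB2 : (ga * sg) ^+ 2 <= (A + B) ^+ 2.
  by rewrite ler_sqr ?nnegrE// ltW// ?mulr_gt0// addr_gt0.
have h4 : mu * (ga * sg) ^+ 2 <= mu * (A + B) ^+ 2 by rewrite ler_wpM2l// ltW.
rewrite rE lerN2; apply: (le_trans h4); rewrite -subr_ge0.
have -> : (A - B) ^+ 2 + c * (A * B) - mu * (A + B) ^+ 2 =
    (1 - mu) * (A - B) ^+ 2 + (c - 4 * mu) * (A * B) by ring.
by rewrite addr_ge0// mulr_ge0 ?sqr_ge0 ?subr_ge0 ?mulr_ge0 ?ltW//; lra.
Qed.

(** The integral is now a combination of logarithms in which [ln (- x)] and [ln y] have positive
    weights. The bound keeps an orbit away from the origin, hence the clock rate away from 0. *)
Lemma lv_integral_le z : z.1 < 0 -> 0 < z.2 ->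
  lv_integral (- al) (- de) z <= ln (z.2 - z.1).
Proof.
move=> x0 y0; rewrite /lv_integral !opprK.
have nx0 : 0 < - z.1 by rewrite oppr_gt0.
have s0 : 0 < z.2 - z.1 by rewrite addr_gt0.
have l1 : ln (- z.1) <= ln (z.2 - z.1) by rewrite ler_ln ?posrE//; lra.
have l2 : ln z.2 <= ln (z.2 - z.1) by rewrite ler_ln ?posrE//; lra.
have := ler_wpM2l (ltW de0) l1; have := ler_wpM2l (ltW al0) l2; lra.
Qed.

(* If both coordinates were larger than [eta], they would be comparable to each other
   because the clock is bounded, and the integral is homogeneous of degree one. *)
Lemma lv_integral_small (eta Lm : R) : 0 < eta -> 0 < Lm -> exists k0 : R,
  forall z, z.1 < 0 -> 0 < z.2 -> `|clock z| <= Lm -> lv_integral (- al) (- de) z < k0 ->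
  - z.1 <= eta \/ z.2 <= eta.
Proof.
move=> eta0 Lm0; pose C := 1 + al / de + de / al; pose E := Lm / de + Lm / al.
have C0 : 0 < C by rewrite /C !addr_gt0// divr_gt0.
have E0 : 0 < E by rewrite /E addr_gt0// divr_gt0.
(* The value at [eta] of the increasing function [m / (C * m + E)]. Since the bounded clock gives
   [y - x <= C * m + E] for [m] either of [- x] and [y], both exceed [th * (y - x)] or equal it when
   they are larger than [eta]. *)
pose th := eta / (C * eta + E).
have D0 : 0 < C * eta + E by rewrite addr_gt0// mulr_gt0.
have th0 : 0 < th by rewrite divr_gt0.
exists ((al + de) * ln th + ln eta) => z x0 y0 hL hk.
have [xe|xe] := leP (- z.1) eta; first by left.
have [ye|ye] := leP z.2 eta; first by right.
exfalso; move: hk; apply/negP; rewrite -leNgt.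
have nx0 : 0 < - z.1 by rewrite oppr_gt0.
have s0 : 0 < z.2 - z.1 by rewrite addr_gt0.
move: hL; rewrite ler_norml => /andP[hL1 hL2].
have small m : eta < m -> z.2 - z.1 <= C * m + E -> th * (z.2 - z.1) <= m.
  move=> em sm; have h : th * (z.2 - z.1) <= th * (C * m + E) by rewrite ler_wpM2l// ltW.
  apply: (le_trans h); rewrite /th mulrAC ler_pdivrMr//.
  have : E * eta <= E * m by rewrite ler_wpM2l// ltW.
  have -> : eta * (C * m + E) = C * eta * m + E * eta by ring.
  have -> : m * (C * eta + E) = C * eta * m + E * m by ring.
  lra.
have Cy (m : R) : 0 < m -> C * m = m + al * m / de + de * m / al.
  by move=> _; rewrite /C; field; rewrite !gt_eqF.
have sx : z.2 - z.1 <= C * - z.1 + E.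
  have h : z.2 <= (al * - z.1 + Lm) / de by rewrite ler_pdivlMr//; move: hL2; rewrite /clock; lra.
  have : 0 < de * - z.1 / al by rewrite divr_gt0// mulr_gt0.
  have : 0 < Lm / al by rewrite divr_gt0.
  by rewrite Cy// /E; move: h; rewrite mulrDl; lra.
have sy : z.2 - z.1 <= C * z.2 + E.
  have h : - z.1 <= (de * z.2 + Lm) / al by rewrite ler_pdivlMr//; move: hL1; rewrite /clock; lra.
  have : 0 < al * z.2 / de by rewrite divr_gt0// mulr_gt0.
  have : 0 < Lm / de by rewrite divr_gt0.
  by rewrite Cy// /E; move: h; rewrite mulrDl; lra.
have ths : 0 < th * (z.2 - z.1) := mulr_gt0 th0 s0.
have lx : ln th + ln (z.2 - z.1) <= ln (- z.1).
  by rewrite -lnM ?posrE// ler_ln ?posrE//; exact: small.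
have ly : ln th + ln (z.2 - z.1) <= ln z.2.
  by rewrite -lnM ?posrE// ler_ln ?posrE//; exact: small.
have ls : ln eta <= ln (z.2 - z.1) by rewrite ler_ln ?posrE//; lra.
have := ler_wpM2l (ltW de0) lx; have := ler_wpM2l (ltW al0) ly.
rewrite /lv_integral !opprK; lra.
Qed.

(** The term [de * ln x] tends to minus infinity while the others remain bounded: orbits that start
    close enough to the [y] axis have an integral as small as desired. *)
Lemma lv_integral_near_axis (y k : R) : 0 < y -> exists2 e : R, 0 < e &
  forall x, 0 < x -> x < e -> lv_integral (- al) (- de) (- x, y) < k.
Proof.
move=> y0; pose b := 1 - al - de; pose B := `|b| * (`|ln y| + `|ln (y + 1)|).
pose e1 := expR ((k - al * ln y - B - 1) / de).
have e10 : 0 < e1 := expR_gt0 _.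
have [e [e0 ee1 e1']] := pos_lt2 e10 ltr01.
exists e => // x x0 xe; rewrite /lv_integral/= !opprK.
have lx : de * ln x <= k - al * ln y - B - 1.
  have : ln x <= ln e1 by rewrite ler_ln ?posrE//; lra.
  by rewrite /e1 expRK ler_pdivlMr// mulrC.
have ll : `|ln (y + x)| <= `|ln y| + `|ln (y + 1)|.
  have l1 : ln y <= ln (y + x) by rewrite ler_ln ?posrE ?addr_gt0//; lra.
  have l2 : ln (y + x) <= ln (y + 1) by rewrite ler_ln ?posrE ?addr_gt0//; lra.
  have := ler_norm (ln (y + 1)); have := ler_norm (- ln y); rewrite normrN.
  have := normr_ge0 (ln (y + 1)); have := normr_ge0 (ln y).
  by rewrite ler_norml; lra.
have lb : b * ln (y + x) <= B.
  apply: (le_trans (ler_norm _)); rewrite normrM /B ler_wpM2l//.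
move: lb; rewrite /b; lra.
Qed.

(** Otherwise the clock is bounded along the forward orbit; as one coordinate is small and the clock
    controls the other, the orbit is bounded, hence defined for all positive times. But the clock
    loses at least [w] per unit of time. *)
Lemma clock_descends z0 (l3 : R) : z0.1 < 0 -> 0 < z0.2 ->
  (exists eta : R, forall t q, 0 <= t -> flow X z0 t q -> - l3 <= clock q ->
     - q.1 <= eta \/ q.2 <= eta) ->
  exists2 t, 0 <= t & dom X z0 t /\ clock (phi X z0 t) <= - l3.
Proof.
move=> x0 y0 [eta heta]; apply: contrapT => hno.
have no t q : 0 <= t -> flow X z0 t q -> - l3 < clock q.
  move=> t0 fq; rewrite ltNge; apply/negP => cq; apply: hno; exists t => //.
  by split; [exists q|rewrite (phiE lipX fq)].
pose g0 := lv_integral (- al) (- de) z0; pose sg := expR g0.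
have [w w0 hw] := clock_rate_bound (expR_gt0 g0).
have rate t : dom X z0 t -> clock_rate (phi X z0 t) <= - w.
  move=> dt; apply: hw; [exact: lv_x_lt0|exact: lv_y_gt0|].
  have h1 := lv_x_lt0 dt x0; have h2 := lv_y_gt0 dt y0.
  have := lv_integral_le h1 h2; rewrite lv_integral_const// -/g0 => hg.
  by rewrite -[leRHS]lnK ?posrE ?addr_gt0 ?oppr_gt0// ler_expR.
have dec t : 0 <= t -> dom X z0 t -> clock (phi X z0 t) <= clock z0 - w * t.
  move=> t0 dt; have dd s : 0 <= s <= t -> dom X z0 s.
    by move=> st; apply: (dom_between solX dt); rewrite st.
  have := @derive_le_slope _ (fun s => clock (phi X z0 s)) (fun s => clock_rate (phi X z0 s))
    0 t (- w) t0 (fun s hs => clock_derive (dd s hs)) (fun s hs => rate s (dd s hs)).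
  by rewrite phi0// subr0 mulNr.
have bd t q : 0 <= t -> flow X z0 t q ->
    `|q| <= `|eta| + (`|clock z0| + `|l3| + al * `|eta|) / de +
            (`|clock z0| + `|l3| + de * `|eta|) / al.
  move=> t0 fq; have dt : dom X z0 t by exists q.
  have qE := phiE lipX fq.
  have h1 : q.1 < 0 by rewrite -qE; exact: lv_x_lt0.
  have h2 : 0 < q.2 by rewrite -qE; exact: lv_y_gt0.
  have c1 := no _ _ t0 fq.
  have c2 := dec _ t0 dt; rewrite qE in c2.
  have wt : 0 <= w * t by rewrite mulr_ge0// ltW.
  have n1 := ler_norm (clock z0); have n2 := ler_norm l3; have n3 := ler_norm eta.
  have n4 := normr_ge0 (clock z0); have n5 := normr_ge0 l3; have n6 := normr_ge0 eta.
  have a1 : 0 <= (`|clock z0| + `|l3| + al * `|eta|) / de.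
    by rewrite divr_ge0 ?(ltW de0)// !addr_ge0// mulr_ge0// ltW.
  have a2 : 0 <= (`|clock z0| + `|l3| + de * `|eta|) / al.
    by rewrite divr_ge0 ?(ltW al0)// !addr_ge0// mulr_ge0// ltW.
  set A1 := (_ / de) in a1 *; set A2 := (_ / al) in a2 *.
  have [qe|qe] := heta t q t0 fq (ltW c1).
    have : q.2 <= A1.
      rewrite /A1 ler_pdivlMr//; move: c2; rewrite {1}/clock.
      have : al * - q.1 <= al * `|eta| by rewrite ler_wpM2l ?(ltW al0)//; lra.
      by lra.
    by rewrite sup_normE ge_max !ler_norml; lra.
  have : - q.1 <= A2.
    rewrite /A2 ler_pdivlMr//; move: c1; rewrite {1}/clock.
    have : de * q.2 <= de * `|eta| by rewrite ler_wpM2l ?(ltW de0)//; lra.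
    by lra.
  by rewrite sup_normE ge_max !ler_norml; lra.
have glob t : 0 <= t -> dom X z0 t.
  move=> t0; have := @dom_bounded _ _ lipX solX false z0 _ _ t t0.
  by rewrite expr0 mul1r; apply => s q s0; rewrite mul1r; exact: bd.
pose t := (`|clock z0| + `|l3|) / w.
have t0 : 0 <= t by rewrite divr_ge0 ?(ltW w0)// addr_ge0.
have := no _ _ t0 (dom_flow lipX (glob _ t0)).
have := dec _ t0 (glob _ t0).
have -> : w * t = `|clock z0| + `|l3| by rewrite /t; field; rewrite gt_eqF.
have := ler_norm (clock z0); have := ler_norm l3; lra.
Qed.

Lemma clock_strict_decr z0 s t : z0.1 < 0 -> 0 < z0.2 -> 0 <= s -> s < t -> dom X z0 t ->
  clock (phi X z0 t) < clock (phi X z0 s).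
Proof.
move=> x0 y0 s0 st dt; have dd u : s <= u <= t -> dom X z0 u.
  by move=> ut; apply: (dom_between solX dt); apply/orP; left; lra.
apply: (derive_lt st (fun u hu => clock_derive (dd u hu))) => u ut.
have du : dom X z0 u by apply: dd; lra.
rewrite /clock_rate; have h1 := lv_x_lt0 du x0; have h2 := lv_y_gt0 du y0.
have : (al + de) * (phi X z0 u).1 * (phi X z0 u).2 < 0.
  by rewrite pmulr_llt0// pmulr_rlt0// addr_gt0.
by have := sqr_ge0 (clock (phi X z0 u)); lra.
Qed.

End HyperbolicSector.

Section RaySign.
Variables (R : realType) (p0 p1 p2 q0 q1 q2 : R).
Local Notation X := (quadratic_field p0 p1 p2 q0 q1 q2).

(** As [X (s *: v)] is [s ^+ 2 * l] times [v], the sign hypothesis says that [v] points out of [N],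
    whether the flow runs inwards or outwards along the ray. So the points just beyond the boundary
    point are outside [N]. *)
Lemma chart_beyond_ray N U h (v : R * R) (l s1 s2 : R) :
  adapted_chart N U h -> X v = l *: v -> 0 < s1 -> s1 < s2 -> 
  (forall s, s1 <= s <= s2 -> U (s *: v) /\ l * dsnd h (X (s *: v)) (s *: v) < 0) ->
  (h (s2 *: v)).2 < (h (s1 *: v)).2.
Proof.
move=> hU Xv s10 s12 H.
have dv s : s1 <= s <= s2 -> is_derive s 1 (fun u => (h (u *: v)).2) (dsnd h v (s *: v)).
  move=> ss; have [Us _] := H _ ss.
  apply: (@dsnd_comp _ h (fun u : R => u *: v) s v).
    exact: chart_differentiable hU Us.
  apply/is_derive_pairP; split => /=; apply: is_derive_eq; rewrite /GRing.scale/=; ring.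
apply: (derive_lt s12 dv) => s ss.
have ss' : s1 <= s <= s2 by lra.
have [Us] := H _ ss'; rewrite quadratic_fieldZ Xv scalerA.
have := dsnd_linear 0 v (s ^+ 2 * l) (chart_differentiable hU Us).
rewrite dsnd0 !add0r => ->.
have s0 : 0 < s by lra.
have -> : l * (s ^+ 2 * l * dsnd h v (s *: v)) = (s * l) ^+ 2 * dsnd h v (s *: v) by ring.
move=> h0; rewrite ltNge; apply/negP => h1; move: h0; apply/negP; rewrite -leNgt.
by rewrite mulr_ge0// sqr_ge0.
Qed.

End RaySign.

Lemma segment_scale_compact (R : realType) (v : R * R) (c : R) : compact ((fun s : R => s *: v) @` `[0, c]).
Proof.
apply: continuous_compact; last exact: segment_compact.
by apply: continuous_subspaceT; exact: scalel_continuous.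
Qed.

Lemma pair_norm_lt (R : realType) (x y e : R) : - e < x < e -> - e < y < e -> `|(x, y)| < e.
Proof. by move=> hx hy; rewrite sup_normE gt_max !ltr_norml hx hy. Qed.

Lemma scale_north (R : realType) (s : R) : s *: ((0, 1) : R * R) = (0, s).
Proof. by rewrite [LHS]surjective_pairing; congr pair; rewrite /= /GRing.scale/=; ring. Qed.

Lemma scale_west (R : realType) (s : R) : s *: ((-1, 0) : R * R) = (- s, 0).
Proof. by rewrite [LHS]surjective_pairing; congr pair; rewrite /= /GRing.scale/=; ring. Qed.

Lemma lv_north (R : realType) (a d : R) : lv_field a d (0, 1) = d *: ((0, 1) : R * R).
Proof. by rewrite scale_north /lv_field /quadratic_field/=; congr pair; ring. Qed.

Lemma lv_west (R : realType) (a d : R) : lv_field a d (-1, 0) = (- a) *: ((-1, 0) : R * R).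
Proof. by rewrite scale_west /lv_field /quadratic_field/=; congr pair; ring. Qed.

Lemma north_neq0 (R : realType) : ((0, 1) : R * R) != 0.
Proof. by apply/eqP => -[/eqP]; rewrite oner_eq0. Qed.

Lemma west_neq0 (R : realType) : ((-1, 0) : R * R) != 0.
Proof. by apply/eqP => -[/eqP]; rewrite oppr_eq0 oner_eq0. Qed.

(** An orbit that starts at height [y1 + dl] very near the [y] axis goes down along that axis and
    then out along the negative [x] axis, within [eta] of one or the other throughout. The smallness
    of [eta] against [dl] converts levels of the clock into bounds on the long coordinate. *)
Lemma sector_orbit (R : realType) (al de y1 x1 dl eta c : R) (X := lv_field (- al) (- de)) :
  0 < al -> 0 < de -> 0 < c -> 0 < dl -> 4 * dl < y1 -> 4 * dl < x1 ->
  0 < eta -> eta < dl -> al * eta < de * dl / 4 -> de * eta < al * dl / 4 ->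
  exists eta1 t1 t2 t3, let z0 := (- eta1, y1 + dl) in [/\ [/\ 0 < eta1, eta1 < c & eta1 < eta],
    [/\ 0 < t1, t1 <= t2, t2 < t3 & dom X z0 t3],
    forall t, 0 <= t <= t1 -> - eta <= (phi X z0 t).1 <= 0 /\
      y1 - dl <= (phi X z0 t).2 <= y1 + dl + dl / 4,
    forall t, t1 <= t <= t2 ->
      (- eta <= (phi X z0 t).1 <= 0 /\ 0 <= (phi X z0 t).2 <= y1 - dl / 2) \/
      (0 <= (phi X z0 t).2 <= eta /\ 0 <= - (phi X z0 t).1 <= x1 - dl / 2) &
    forall t, t2 <= t <= t3 -> 0 <= (phi X z0 t).2 <= eta /\
      x1 - dl <= - (phi X z0 t).1 <= x1 + dl + dl / 4 /\
      (t = t3 -> - (phi X z0 t).1 - (x1 + dl) = de * (phi X z0 t).2 / al)].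
Proof.
move=> al0 de0 c_gt0 dl0 dly dlx eta0 eta_dl ae dee.
have lipX : locally_lipschitz X := quadratic_field_lipschitz _ _ _ _ _ _.
have solX : locally_solvable X := quadratic_field_solvable _ _ _ _ _ _.
have y10 : 0 < y1 by lra.
have x10 : 0 < x1 by lra.
(* A bound for the absolute value of the clock during the whole passage. *)
pose Lm := de * (y1 + dl) + al * (x1 + dl).
have Lm0 : 0 < Lm by rewrite addr_gt0// mulr_gt0// addr_gt0.
have [k0 hk0] := lv_integral_small al0 de0 eta0 Lm0.
have [c' c'0 hc] := @lv_integral_near_axis _ al de de0 (y1 + dl) k0 (addr_gt0 y10 dl0).
have [c2 [c20 c2c c2c']] := pos_lt2 c_gt0 c'0.
have [eta1 [eta10 eta1c2 eta1e]] := pos_lt2 c20 eta0.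
have eta1c : eta1 < c by lra.
have eta1c' : eta1 < c' by lra.
pose z0 : R * R := (- eta1, y1 + dl).
have x0 : z0.1 < 0 by rewrite /z0/= oppr_lt0.
have y0 : 0 < z0.2 by rewrite /z0/= addr_gt0.
have kz0 : lv_integral (- al) (- de) z0 < k0 by apply: hc.
have adl : 0 < al * dl by rewrite mulr_gt0.
have ddl : 0 < de * dl by rewrite mulr_gt0.
have ax1 : 0 < al * x1 by rewrite mulr_gt0.
have dy1 : 0 < de * y1 by rewrite mulr_gt0.
have al_dl : 4 * (al * dl) < al * x1 by rewrite mulrCA ltr_pM2l.
have de_dl : 4 * (de * dl) < de * y1 by rewrite mulrCA ltr_pM2l.
have aeta1 : al * eta1 < al * eta by rewrite ltr_pM2l.
have aeta10 : 0 < al * eta1 by rewrite mulr_gt0.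
have small t : 0 <= t -> dom X z0 t -> - (al * (x1 + dl)) <= clock al de (phi X z0 t) ->
    - (phi X z0 t).1 <= eta \/ (phi X z0 t).2 <= eta.
  move=> t0 dt ct; apply: hk0; [exact: lv_x_lt0|exact: lv_y_gt0| |by rewrite lv_integral_const].
  have cz : clock al de (phi X z0 t) <= clock al de z0.
    have [<-|tn0] := eqVneq 0 t; first by rewrite phi0.
    apply: ltW; rewrite -[in ltRHS](phi0 lipX solX z0); apply: clock_strict_decr => //.
    by rewrite lt_neqAle tn0.
  have cz0 : clock al de z0 = de * (y1 + dl) - al * eta1 by rewrite /clock/=; ring.
  have := mulr_gt0 al0 x10; rewrite ler_norml /Lm.
  clear -ct cz cz0 aeta10 ddl adl dy1; lra.
have [|te te0 [dte cte]] := @clock_descends _ al de al0 de0 z0 (al * (x1 + dl)) x0 y0.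
  exists eta => t q t0 fq cq; have dt : dom X z0 t by exists q.
  by have := small t t0 dt; rewrite (phiE lipX fq); apply.
have ddt t : 0 <= t <= te -> dom X z0 t.
  by move=> tt; apply: (dom_between solX dte); rewrite tt.
have cont t : 0 <= t <= te -> {for t, continuous (fun s => clock al de (phi X z0 s))}.
  by move=> /ddt /(clock_derive (al := al) (de := de)) h; exact: is_derive_continuous h.
have find s (l : R) : 0 <= s <= te -> clock al de (phi X z0 te) <= l <= clock al de (phi X z0 s) ->
    exists2 t, s <= t <= te & clock al de (phi X z0 t) = l.
  move=> ss hl; apply: (ivt_decr (f := fun s => clock al de (phi X z0 s))) => //; first by case/andP: ss.
  by move=> t tt; apply: cont; clear -ss tt; lra.
have cz0 : clock al de (phi X z0 0) = de * (y1 + dl) - al * eta1 by rewrite phi0// /clock/=; ring.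
(* The three times are defined by levels of the clock: its values at heights [y1 - dl] on the [y]
   axis, then at distances [x1 - dl] and [x1 + dl] on the negative [x] axis. *)
have [t1 t1b ct1] := find 0 (de * (y1 - dl)) ltac:(clear -te0; lra) ltac:(clear -cte cz0 aeta1 ae adl ddl de_dl ax1 dy1 aeta10; lra).
have [t2 t2b ct2] := find t1 (- (al * (x1 - dl))) ltac:(clear -t1b; lra) ltac:(rewrite ct1; clear -cte adl ddl al_dl de_dl ax1 dy1; lra).
have [t3 t3b ct3] := find t2 (- (al * (x1 + dl))) ltac:(clear -t1b t2b; lra) ltac:(rewrite ct2; clear -cte adl; lra).
have mono s t : 0 <= s -> s <= t -> t <= te -> clock al de (phi X z0 t) <= clock al de (phi X z0 s).
  move=> s0 st tt; have [->//|sn] := eqVneq s t.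
  by apply/ltW/clock_strict_decr => //; [rewrite lt_neqAle sn|apply: ddt; clear -s0 st tt; lra].
have t10 : 0 < t1.
  rewrite lt_neqAle; apply/andP; split; last by case/andP: t1b.
  by apply/eqP => t1E; move: ct1; rewrite -t1E cz0; clear -aeta1 ae ddl; lra.
have t23 : t2 < t3.
  rewrite lt_neqAle; apply/andP; split; last by case/andP: t3b.
  by apply/eqP => t1E; move: ct3; rewrite -t1E ct2; clear -adl; lra.
have bx t : 0 <= t <= te -> (phi X z0 t).1 < 0 by move=> /ddt dt; exact: lv_x_lt0.
have byy t : 0 <= t <= te -> 0 < (phi X z0 t).2 by move=> /ddt dt; exact: lv_y_gt0.
have ck t : clock al de (phi X z0 t) = al * (phi X z0 t).1 + de * (phi X z0 t).2 by [].
have Z1 t : 0 <= t <= t1 -> - eta <= (phi X z0 t).1 <= 0 /\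
    y1 - dl <= (phi X z0 t).2 <= y1 + dl + dl / 4.
  move=> tt; have tte : 0 <= t <= te by clear -tt t1b; lra.
  have cc1 := mono t t1 ltac:(clear -tt; lra) ltac:(clear -tt; lra) ltac:(clear -t1b; lra).
  have cc0 := mono 0 t (lexx 0) ltac:(clear -tt; lra) ltac:(clear -tte; lra).
  have h1 := bx t tte; have h2 := byy t tte.
  rewrite ct1 in cc1; rewrite cz0 in cc0; rewrite ck in cc0 cc1.
  have [xs|ys] : - (phi X z0 t).1 <= eta \/ (phi X z0 t).2 <= eta.
    by apply: small; [case/andP: tt|exact: ddt|rewrite ck; clear -cc1 adl ax1 dy1 ddl de_dl; lra].
  - split; first by clear -xs h1; lra.
    have hx : al * - (phi X z0 t).1 <= al * eta by rewrite ler_pM2l.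
    have hx' : 0 <= al * - (phi X z0 t).1 by rewrite mulr_ge0 ?oppr_ge0 ?ltW.
    by apply/andP; split; rewrite -(ler_pM2l de0); clear -hx hx' cc0 cc1 ae ddl aeta10; lra.
  - exfalso; have : de * (phi X z0 t).2 <= de * eta by rewrite ler_pM2l.
    have : de * eta < de * (y1 - dl) by rewrite ltr_pM2l//; clear -eta_dl dly dl0; lra.
    have : 0 <= al * - (phi X z0 t).1 by rewrite mulr_ge0 ?oppr_ge0 ?ltW.
    clear -cc1; lra.
have Z2 t : t2 <= t <= t3 -> 0 <= (phi X z0 t).2 <= eta /\
    x1 - dl <= - (phi X z0 t).1 <= x1 + dl + dl / 4.
  move=> tt; have tte : 0 <= t <= te by clear -tt t1b t2b t3b; lra.
  have cc1 := mono t t3 ltac:(clear -tt t1b t2b; lra) ltac:(clear -tt; lra) ltac:(clear -t3b; lra).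
  have cc0 := mono t2 t ltac:(clear -t1b t2b; lra) ltac:(clear -tt; lra) ltac:(clear -tte; lra).
  have h1 := bx t tte; have h2 := byy t tte.
  rewrite ct3 in cc1; rewrite ct2 in cc0; rewrite ck in cc0 cc1.
  have [xs|ys] : - (phi X z0 t).1 <= eta \/ (phi X z0 t).2 <= eta.
    by apply: small; [case/andP: tte|exact: ddt|rewrite ck; clear -cc1; lra].
  - exfalso; have : al * - (phi X z0 t).1 <= al * eta by rewrite ler_pM2l.
    have : al * eta < al * (x1 - dl) by rewrite ltr_pM2l//; clear -eta_dl dlx dl0; lra.
    have : 0 <= de * (phi X z0 t).2 by rewrite mulr_ge0 ?ltW.
    clear -cc0; lra.
  - split; first by clear -ys h2; lra.
    have hx : de * (phi X z0 t).2 <= de * eta by rewrite ler_pM2l.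
    have hx' : 0 <= de * (phi X z0 t).2 by rewrite mulr_ge0 ?ltW.
    by apply/andP; split; rewrite -(ler_pM2l al0); clear -hx hx' cc0 cc1 dee adl; lra.
have Z12 t : t1 <= t <= t2 ->
    (- eta <= (phi X z0 t).1 <= 0 /\ 0 <= (phi X z0 t).2 <= y1 - dl / 2) \/
    (0 <= (phi X z0 t).2 <= eta /\ 0 <= - (phi X z0 t).1 <= x1 - dl / 2).
  move=> tt; have tte : 0 <= t <= te by clear -tt t1b t2b t3b; lra.
  have cc1 := mono t t2 ltac:(clear -tt t1b; lra) ltac:(clear -tt; lra) ltac:(clear -t2b t3b; lra).
  have cc0 := mono t1 t ltac:(clear -t1b; lra) ltac:(clear -tt; lra) ltac:(clear -tte; lra).
  have h1 := bx t tte; have h2 := byy t tte.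
  rewrite ct2 in cc1; rewrite ct1 in cc0.
  have sm : - (phi X z0 t).1 <= eta \/ (phi X z0 t).2 <= eta.
    by apply: small; [case/andP: tte|exact: ddt|clear -cc1 adl; lra].
  rewrite ck in cc0 cc1.
  case: sm => [xs|ys].
  - have hx : al * - (phi X z0 t).1 <= al * eta by rewrite ler_pM2l.
    left; clear -xs h1 h2 hx cc0 cc1 ae ddl de0; split; first by lra.
    by apply/andP; split; [lra|rewrite -(ler_pM2l de0); lra].
  - have hx : de * (phi X z0 t).2 <= de * eta by rewrite ler_pM2l.
    right; clear -ys h1 h2 hx cc0 cc1 dee adl al0; split; first by lra.
    by apply/andP; split; [lra|rewrite -(ler_pM2l al0); lra].
exists eta1, t1, t2, t3; split=> //.
- split=> //; first by case/andP: t2b.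
  by apply: ddt; clear -t1b t2b t3b; lra.
- move=> t tt; have [h1 h2] := Z2 t tt; split=> //; split=> // t3E.
  move: ct3; rewrite -t3E ck => ct3; apply: (mulfI (lt0r_neq0 al0)).
  by rewrite mulrCA divff ?gt_eqF//; clear -ct3; lra.
Qed.

(** The two segments of half-lines, cut short of their end points, are compact in the interior of
    [N] and so have tubes inside it; near the end points the charts fix the sign of the normal
    derivative. An orbit thin enough for all these neighbourhoods meets the requirements of
    [crossing]. *)
Lemma sector_crossing (R : realType) (al de y1 x1 e : R) (X := lv_field (- al) (- de))
    (N U1 : set (R * R)) h1 (U2 : set (R * R)) h2 : 0 < al -> 0 < de -> 0 < y1 -> 0 < x1 -> 0 < e ->
  (forall s, 0 <= s < y1 -> interior N (0, s)) ->
  (forall s, 0 <= s < x1 -> interior N (- s, 0)) ->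
  adapted_chart N U1 h1 -> (h1 (0, y1)).2 = 0 ->
  (forall z, `|z - (0, y1)| < e -> U1 z /\ 0 < dsnd h1 (X z) z) ->
  adapted_chart N U2 h2 -> (h2 (- x1, 0)).2 = 0 ->
  (forall z, `|z - (- x1, 0)| < e -> U2 z /\ dsnd h2 (X z) z < 0) ->
  exists P Q, [/\ `|P - (0, y1)| < e, `|Q - (- x1, 0)| < e, entry_set X N P &
    exit_point X N P Q].
Proof.
move=> al0 de0 y10 x10 e0 I1 I2 hU1 hp1 W1 hU2 hp2 W2.
have lipX : locally_lipschitz X := quadratic_field_lipschitz _ _ _ _ _ _.
have solX : locally_solvable X := quadratic_field_solvable _ _ _ _ _ _.
have [d1 [d10 d1y d1x]] := pos_lt2 y10 x10.
have [d [d0 dd1 de_]] := pos_lt2 d10 e0.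
pose dl := d / 4; have dl0 : 0 < dl by rewrite divr_gt0.
have dle : 4 * dl < e by rewrite /dl; lra.
have dly : 4 * dl < y1 by rewrite /dl; lra.
have dlx : 4 * dl < x1 by rewrite /dl; lra.
have Xn : X (0, 1) = (- de) *: ((0, 1) : R * R) := lv_north _ _.
have Xw : X (-1, 0) = al *: ((-1, 0) : R * R) by rewrite /X lv_west opprK.
have s1 : (h1 (0, y1 + dl)).2 < 0.
  have := @chart_beyond_ray _ _ _ _ _ _ _ _ U1 h1 (0, 1) (- de) y1 (y1 + dl) hU1 Xn y10.
  rewrite !scale_north hp1; apply; first by rewrite ltrDl.
  move=> s ss; rewrite scale_north; have [|Us ds] := W1 (0, s).
    by apply: pair_norm_lt => /=; lra.
  by split=> //; rewrite nmulr_rlt0// oppr_lt0.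
have s2 : (h2 (- (x1 + dl), 0)).2 < 0.
  have := @chart_beyond_ray _ _ _ _ _ _ _ _ U2 h2 (-1, 0) al x1 (x1 + dl) hU2 Xw x10.
  rewrite !scale_west hp2; apply; first by rewrite ltrDl.
  move=> s ss; rewrite scale_west; have [|Us ds] := W2 (- s, 0).
    by apply: pair_norm_lt => /=; lra.
  by split=> //; rewrite pmulr_rlt0.
have U1s : U1 (0, y1 + dl) by have [|] := W1 (0, y1 + dl); first by clear -dle dl0; apply: pair_norm_lt => /=; lra.
have U2s : U2 (- (x1 + dl), 0) by have [|] := W2 (- (x1 + dl), 0); first by clear -dle dl0; apply: pair_norm_lt => /=; lra.
have [e1 e10 H1] := chart_lt0_near hU1 U1s s1.
have [e2 e20 H2] := chart_lt0_near hU2 U2s s2.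
have [|e3 e30 H3] := compact_in_interior (N := N) (@segment_scale_compact R (0, 1) (y1 - dl / 2)).
  by move=> _ [s /= + <-]; rewrite in_itv/= scale_north => ss; apply: I1; lra.
have [|e4 e40 H4] := compact_in_interior (N := N) (@segment_scale_compact R (-1, 0) (x1 - dl / 2)).
  by move=> _ [s /= + <-]; rewrite in_itv/= scale_west => ss; apply: I2; lra.
have T1 x y : 0 <= y <= y1 - dl / 2 -> - e3 < x < e3 -> interior N (x, y).
  move=> hy hx; apply: (H3 (0, y)); first by exists y; rewrite ?scale_north//= in_itv.
  by clear -hx e30; apply: pair_norm_lt => /=; lra.
have T2 x y : 0 <= x <= x1 - dl / 2 -> - e4 < y < e4 -> interior N (- x, y).
  move=> hx hy; apply: (H4 (- x, 0)); first by exists x; rewrite ?scale_west//= in_itv.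
  by clear -hy e40; apply: pair_norm_lt => /=; lra.
have [g1 [g10 g1e1 g1e2]] := pos_lt2 e10 e20.
have [g2 [g20 g2e3 g2e4]] := pos_lt2 e30 e40.
have [g [g0 gg1 gg2]] := pos_lt2 g10 g20.
(* The two bounds are what [sector_orbit] requires of [eta], in divided form. *)
have [b1 [b10 b1a b1b]] : exists b, [/\ 0 < b, b < de * dl / (4 * al) & b < al * dl / (4 * de)].
  by apply: pos_lt2; rewrite divr_gt0// mulr_gt0.
have [b2 [b20 b2b1 b2g]] := pos_lt2 b10 g0.
have [b3 [b30 b3a b3b]] : exists b, [/\ 0 < b, b < b2 & b < al * e2 / de].
  by apply: pos_lt2 => //; rewrite divr_gt0// mulr_gt0.
have [eta [eta0 etab eta_dl]] := pos_lt2 b30 dl0.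
have ae : al * eta < de * dl / 4.
  have : al * eta < al * (de * dl / (4 * al)).
    by rewrite ltr_pM2l//; clear -etab b3a b2b1 b1a; lra.
  by have -> : al * (de * dl / (4 * al)) = de * dl / 4 by field; rewrite gt_eqF.
have dee : de * eta < al * dl / 4.
  have : de * eta < de * (al * dl / (4 * de)).
    by rewrite ltr_pM2l//; clear -etab b3a b2b1 b1b; lra.
  by have -> : de * (al * dl / (4 * de)) = al * dl / 4 by field; rewrite gt_eqF.
have dee2 : de * eta < al * e2.
  have : de * eta < de * (al * e2 / de).
    by rewrite ltr_pM2l//; clear -etab b3b; lra.
  by have -> : de * (al * e2 / de) = al * e2 by field; rewrite gt_eqF.
have [eta1 [t1 [t2 [t3 []]]]] := @sector_orbit _ al de y1 x1 dl eta e1 al0 de0 e10 dl0 dly dlx eta0 eta_dl ae dee.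
set z0 := (- eta1, y1 + dl).
move=> [eta10 eta1e1 eta1e] [t10 t12 t23 dt3] Z1 Z12' Z2.
have Z12 t : t1 <= t <= t2 -> interior N (phi X z0 t).
  move=> /Z12'; rewrite [phi X z0 t]surjective_pairing => -[[xb yb]|[yb xb]].
    by apply: T1 => //; clear -xb etab b3a b2g gg2 g2e3 eta0; lra.
  rewrite -[(phi X z0 t).1]opprK; apply: T2 => //.
  by clear -yb etab b3a b2g gg2 g2e4 eta0; lra.
have V1 t : 0 <= t <= t1 -> `|phi X z0 t - (0, y1)| < e.
  move=> /Z1 [xb yb]; rewrite [phi X z0 t]surjective_pairing.
  by clear -xb yb dle eta_dl dl0; apply: pair_norm_lt => /=; lra.
have V2 t : t2 <= t <= t3 -> `|phi X z0 t - (- x1, 0)| < e.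
  move=> /Z2 [yb [xb _]]; rewrite [phi X z0 t]surjective_pairing.
  by clear -xb yb dle eta_dl dl0; apply: pair_norm_lt => /=; lra.
have W1' t : 0 <= t <= t1 -> _ := fun ht => W1 _ (V1 t ht).
have W2' t : t2 <= t <= t3 -> _ := fun ht => W2 _ (V2 t ht).
have [|||||T3 [T4 [T3b T4b ent ext]]] :=
    @crossing _ X lipX solX N z0 t1 t2 t3 U1 h1 U2 h2 t10 t12 t23 dt3 hU1 hU2 W1' _ _ _ W2'.
- by apply: H1; rewrite /z0; clear -eta10 eta1e1 e10; apply: pair_norm_lt => /=; lra.
- apply: (chart_interior hU1); last by apply: Z12; rewrite lexx.
  by have [|] := W1' t1; first by rewrite lexx ltW.
- by move=> t /Z12; exact: interior_subset.
- apply: (chart_interior hU2); last by apply: Z12; rewrite t12 lexx.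
  by have [|] := W2' t2; first by rewrite lexx ltW.
- apply: H2; have tte : t2 <= t3 <= t3 by rewrite ltW/=.
  have [ya [xa /(_ erefl) xE]] := Z2 _ tte.
  have hx : de * (phi X z0 t3).2 / al < e2.
    have : de * (phi X z0 t3).2 <= de * eta by rewrite ler_pM2l//; case/andP: ya.
    by rewrite ltr_pdivrMr//; clear -dee2; lra.
  have hx' : 0 <= de * (phi X z0 t3).2 / al.
    by rewrite divr_ge0 ?mulr_ge0 ?(ltW al0) ?(ltW de0)//; case/andP: ya.
  rewrite [phi X z0 t3]surjective_pairing.
  clear -xE hx hx' ya etab b3a b2g gg1 g1e2 eta0 e20; apply: pair_norm_lt => /=; lra.
exists (phi X z0 T3), (phi X z0 T4); split=> //; [exact: V1|exact: V2].
Qed.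

Section SectorPassage.
Variables (R : realType) (al de : R).
Hypotheses (al0 : 0 < al) (de0 : 0 < de).
Local Notation X := (lv_field (- al) (- de)).
Variables (N : set (R * R)) (f : R * R -> R * R).
Hypotheses (blockN : isolating_block X [set 0] N) (extf : continuous_extension X N f).

Let lipX : locally_lipschitz X := quadratic_field_lipschitz _ _ _ _ _ _.
Let solX : locally_solvable X := quadratic_field_solvable _ _ _ _ _ _.
Let ctX : continuous X := @quadratic_field_continuous R _ _ _ _ _ _.

(** The entry point [(0, y1)] is asymptotic, but it is a limit of entry points of the sector whose
    exit points tend to the end point [(- x1, 0)] of the other half-line; continuity of [f] leaves
    no other value. *)
Lemma sector_passage (y1 : R) : 0 < y1 -> boundary N (0, y1) ->
  (forall s, 0 <= s <= y1 -> N (0, s)) ->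
  exists2 x1, 0 < x1 & f (0, y1) = (- x1, 0).
Proof.
move=> y10 by1 Ny1.
have Xn : X (0, 1) = (- de) *: ((0, 1) : R * R) := lv_north _ _.
have Xw : X (-1, 0) = al *: ((-1, 0) : R * R) by rewrite lv_west opprK.
have by1' : boundary N (y1 *: ((0, 1) : R * R)) by rewrite scale_north.
have Ny1' s : 0 <= s <= y1 -> N (s *: ((0, 1) : R * R)) by rewrite scale_north; exact: Ny1.
have [x1 [x10 bx1 Nx1]] := ray_segment blockN (west_neq0 R).
exists x1 => //.
have I1 s : 0 <= s < y1 -> interior N (0, s).
  by move=> ss; rewrite -scale_north; exact: (ray_interior blockN Xn y10 Ny1' ss).
have I2 s : 0 <= s < x1 -> interior N (- s, 0).
  by move=> ss; rewrite -scale_west; exact: (ray_interior blockN Xw x10 Nx1 ss).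
have [U1 [h1 [Up1 hU1 hp1]]] := by1; have [U2 [h2 [Up2 hU2 hp2]]] := bx1.
have d1 : 0 < dsnd h1 (X (0, y1)) (0, y1).
  rewrite -scale_north; apply: (ray_entering blockN Xn y10 by1' Ny1' _ hU1); last by rewrite scale_north.
  by rewrite oppr_lt0.
have d2 : dsnd h2 (X (x1 *: ((-1, 0) : R * R))) (x1 *: ((-1, 0) : R * R)) < 0 := ray_exiting blockN Xw x10 bx1 Nx1 al0 hU2 Up2.
have [r1 r10 W1] := chart_radius_gt0 ctX hU1 Up1 d1.
have [r2 r20 W2] := chart_radius_lt0 ctX hU2 Up2 d2.
rewrite scale_west in hp2 W2.
have ep : entry_set X N (0, y1) := entry_of_transversal lipX solX hU1 Up1 hp1 d1.
have [_ /continuous_withinP/(_ _ ep) cf _] := extf.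
apply/eqP; rewrite -subr_eq0 -normr_le0 leNgt; apply/negP.
set m := `|_| => m0; have m2 : 0 < m / 2 by rewrite divr_gt0.
have [r3 r30 W3] := cf _ m2.
have [r4 [r40 r41 r42]] := pos_lt2 r10 r20.
have [r5 [r50 r51 r52]] := pos_lt2 r30 m2.
have [r [r0 r54 r55]] := pos_lt2 r40 r50.
have [||P [Q [HP HQ eP PQ]]] := @sector_crossing _ al de y1 x1 r N U1 h1 U2 h2 al0 de0 y10 x10 r0 I1 I2 hU1 hp1 _ hU2 hp2.
- by move=> z hz; apply: W1; lra.
- by move=> z hz; apply: W2; lra.
have fP := extension_exit_point lipX extf eP PQ.
have := W3 P eP ltac:(lra); rewrite fP => h.
have : m <= `|Q - f (0, y1)| + `|Q - (- x1, 0)|.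
  rewrite /m -[`|Q - f (0, y1)|]normrN opprB (le_trans _ (ler_normD _ _))//.
  by rewrite addrA subrK.
lra.
Qed.

End SectorPassage.

(** * Non-uniqueness of extensions near asymptotic points *)

Lemma maxr_continuous (R : realType) (T : topologicalType) (f g : T -> R) (x : T) :
  {for x, continuous f} -> {for x, continuous g} ->
  {for x, continuous (fun y => Num.max (f y) (g y))}.
Proof.
have -> : (fun y => Num.max (f y) (g y)) = fun y => (f y + g y + `|f y - g y|) / 2.
  by apply/funext => y; rewrite maxr_absE.
move=> cf cg; apply: cvgM; last exact: cvg_cst.
by apply: cvgD; [exact: cvgD|apply: cvg_norm; exact: cvgB].
Qed.

Lemma minr_continuous (R : realType) (T : topologicalType) (f g : T -> R) (x : T) :
  {for x, continuous f} -> {for x, continuous g} ->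
  {for x, continuous (fun y => Num.min (f y) (g y))}.
Proof.
have -> : (fun y => Num.min (f y) (g y)) = fun y => (f y + g y - `|f y - g y|) / 2.
  by apply/funext => y; rewrite minr_absE.
move=> cf cg; apply: cvgM; last exact: cvg_cst.
by apply: cvgB; [exact: cvgD|apply: cvg_norm; exact: cvgB].
Qed.

Lemma continuous_atP (R : realType) (U V : normedModType R) (f : U -> V) (p : U) :
  {for p, continuous f} <-> forall e : R, 0 < e ->
    exists2 d : R, 0 < d & forall q, `|q - p| < d -> `|f q - f p| < e.
Proof.
split=> [cf e e0|h].
  have /cvgrPdist_lt/(_ _ e0)/nbhs_distP[d d0 hd] : f x @[x --> p] --> f p := cf.
  by exists d => // q /hd; rewrite distrC.
apply/cvgrPdist_lt => e /h[d d0 hd]; apply/nbhs_distP; exists d => // q /hd.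
by rewrite distrC.
Qed.

Lemma first_hit (R : realType) (f : R -> R) (a b : R) : a <= b ->
  (forall t, a <= t <= b -> {for t, continuous f}) -> f a < 0 -> 0 <= f b ->
  exists T, [/\ a < T <= b, f T = 0 & forall s, a <= s < T -> f s < 0].
Proof.
move=> ab cf fa fb; pose A := [set t | a <= t <= b /\ 0 <= f t].
have Ab : A b by split=> //; rewrite ab lexx.
have lbA : lbound A a by move=> t [] /andP[].
have infA : has_inf A by split; [exists b|exists a].
have aT : a <= inf A by apply: lb_le_inf => //; exists b.
have Tb : inf A <= b by apply: ge_inf => //; exists a.
have before s : a <= s < inf A -> f s < 0.
  move=> /andP[as_ sT]; rewrite ltNge; apply/negP => fs.
  have : inf A <= s by apply: ge_inf; [exists a|split=> //; lra].
  lra.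
have cT : {for inf A, continuous f} by apply: cf; rewrite aT.
have fT0 : 0 <= f (inf A).
  rewrite leNgt; apply/negP => fT; have fT' : 0 < - f (inf A) by rewrite oppr_gt0.
  have /continuous_atP/(_ _ fT')[d d0 hd] := cT.
  have [u [uab fu] uT] := inf_adherent d0 infA.
  have Tu : inf A <= u by apply: ge_inf; [exists a|split].
  have : `|f u - f (inf A)| < - f (inf A) by apply: hd; rewrite ltr_norml; lra.
  by rewrite ltr_norml; lra.
have aT' : a < inf A.
  by rewrite lt_neqAle aT andbT; apply/eqP => e; move: fT0; rewrite -e; lra.
exists (inf A); split=> //; first by rewrite aT' Tb.
apply/eqP; rewrite eq_le fT0 andbT leNgt; apply/negP => fT.
have /continuous_atP/(_ _ fT)[d d0 hd] := cT.
have [|m [m0 m1 m2]] := pos_lt2 d0 (_ : 0 < inf A - a); first by rewrite subr_gt0.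
have fs : f (inf A - m) < 0 by apply: before; lra.
have : `|f (inf A - m) - f (inf A)| < f (inf A) by apply: hd; rewrite ltr_norml; lra.
by rewrite ltr_norml; lra.
Qed.

Section ShortTime.
Variables (R : realType) (X : R * R -> R * R).
Hypotheses (lipX : locally_lipschitz X) (solX : locally_solvable X).

(** In the ball of radius [r] the speed is at most [K], and [K * tau <= r / 4] is too short to go
    from distance [r / 2] to distance [r]; this is read off at the first time when distance [r]
    would be reached. *)
Lemma flow_stays_near (p : R * R) (r : R) : 0 < r -> exists2 tau : R, 0 < tau &
  forall (z : R * R) (t : R), `|z - p| < r / 2 -> `|t| <= tau ->
    dom X z t /\ (0 <= t -> `|phi X z t - p| < r).
Proof.
move=> r0; have [L lip] := lipX (`|p| + r).
have [e e0 he] := solX (`|p| + r).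
pose K := `|X p| + `|L| * r + 1.
have K0 : 0 < K by rewrite ltr_wpDl// addr_ge0// mulr_ge0// ltW.
have near_le q : `|q - p| <= r -> `|q| <= `|p| + r.
  by move=> h; rewrite -[q](subrK p) addrC (le_trans (ler_normD _ _))// lerD2l.
have XK q : `|q - p| <= r -> `|X q| <= K.
  move=> h; have := lip q p (near_le _ h); rewrite lerDl => /(_ (ltW r0)) h1.
  have : `|X q| <= `|X p| + `|X q - X p|.
    by rewrite -[X q in leLHS](subrK (X p)) addrC ler_normD.
  have : L * `|q - p| <= `|L| * r.
    by rewrite (le_trans (ler_wpM2r _ (ler_norm L)))// ler_wpM2l.
  by rewrite /K; lra.
pose tau := Num.min (e / 2) (r / (4 * K)).
have tau0 : 0 < tau by rewrite lt_min !divr_gt0// mulr_gt0.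
have tau_e : tau <= e / 2 by rewrite ge_min lexx.
have tau_r : K * tau <= r / 4.
  have : tau <= r / (4 * K) by rewrite ge_min lexx orbT.
  rewrite -(ler_pM2l K0); have -> : K * (r / (4 * K)) = r / 4 by field; rewrite gt_eqF.
  by [].
exists tau => // z t zp tt.
have zr : `|z - p| <= r by lra.
have dz s : `|s| <= tau -> dom X z s.
  rewrite ler_norml => st; have [c c0 hc] := he _ (near_le _ zr).
  by exists (c s), (- e), e, c; split=> //; lra.
split=> [|t0]; first exact: dz.
move: tt; rewrite ger0_norm// => tt.
have {}dz s : 0 <= s <= t -> dom X z s by move=> st; apply: dz; rewrite ger0_norm; lra.
pose f s := `|phi X z s - p| - r.
rewrite ltNge; apply/negP => far.
have [||||T [/andP[T0 Tt] fT before]] := @first_hit R f 0 t; first by lra.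
- move=> s /dz ds; apply: cvgB; last exact: cvg_cst.
  by apply: cvg_norm; apply: cvgB; [exact: phi_continuous|exact: cvg_cst].
- by rewrite /f phi0//; lra.
- by rewrite /f subr_ge0.
have inr s : 0 <= s <= T -> `|phi X z s - p| <= r.
  move=> sT; have [->|sn] := eqVneq s T; first by rewrite -subr_le0 -/(f T) fT.
  by have := before s ltac:(rewrite lt_neqAle sn; lra); rewrite /f; lra.
have D s : 0 <= s <= T -> is_derive s 1 (phi X z) (X (phi X z s)).
  by move=> sT; apply: phi_derive => //; apply: dz; lra.
have mv (g : R * R -> R) : (forall q, `|g q| <= `|q|) ->
    (forall s, 0 <= s <= T -> is_derive s 1 (fun u => g (phi X z u)) (g (X (phi X z s)))) ->
    `|g (phi X z T) - g z| <= K * T.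
  move=> gle gd; rewrite ler_norml.
  have gK s : 0 <= s <= T -> - K <= g (X (phi X z s)) <= K.
    by move=> sT; rewrite -ler_norml (le_trans (gle _))// XK// inr.
  have h1 := @derive_le_slope R _ _ 0 T K (ltW T0) gd (fun s sT => proj2 (andP (gK s sT))).
  have h2 := @derive_ge_slope R _ _ 0 T (- K) (ltW T0) gd (fun s sT => proj1 (andP (gK s sT))).
  by rewrite phi0// in h1 h2; lra.
have m1 : `|(phi X z T).1 - z.1| <= K * T.
  apply: (mv fst) => [q|s /D /is_derive_pairP[]//].
  by rewrite [leRHS]sup_normE le_max lexx.
have m2 : `|(phi X z T).2 - z.2| <= K * T.
  apply: (mv snd) => [q|s /D /is_derive_pairP[]//].
  by rewrite [leRHS]sup_normE le_max lexx orbT.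
have m3 : `|phi X z T - z| <= K * T by rewrite [leLHS]sup_normE ge_max m1 m2.
have m4 : K * T <= K * tau by rewrite ler_pM2l//; lra.
have : `|phi X z T - p| <= `|phi X z T - z| + `|z - p|.
  by rewrite -[X in `|X - p|](subrK z) -addrA ler_normD.
by move: fT; rewrite /f; lra.
Qed.

(** For a short time nearby orbits remain in one ball, where a single Lipschitz constant feeds the
    Gronwall estimate. *)
Lemma flow_continuous_initial (p : R * R) : exists2 tau : R, 0 < tau &
  forall t, 0 <= t <= tau -> {for p, continuous (fun z => phi X z t)}.
Proof.
have [tau tau0 near] := flow_stays_near p ltr01.
exists (tau / 2) => [|t tt]; first by rewrite divr_gt0.
have [L lip] := lipX (`|p| + 1).
apply/continuous_atP => e e0; pose C := 2 * expR (4 * L * t).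
have C0 : 0 < C by rewrite mulr_gt0// expR_gt0.
have sol w : `|w - p| < 1 / 2 -> solution X (- tau) tau (phi X w).
  move=> wp s st; apply: phi_derive => //; apply: (near w s wp _).1.
  by rewrite ler_norml; lra.
have bd w s : `|w - p| < 1 / 2 -> 0 <= s <= t -> `|phi X w s| <= `|p| + 1.
  move=> wp st; rewrite -[phi X w s](subrK p) addrC (le_trans (ler_normD _ _))// lerD2l ltW//.
  by apply: (near w s wp _).2; [rewrite ger0_norm; lra|lra].
have [d [d0 d1 d2]] : exists d, [/\ 0 < d, d < 1 / 2 & d < e / (1 + C)].
  by apply: pos_lt2; rewrite divr_gt0// addr_gt0.
exists d => // z zp.
have zp' : `|z - p| < 1 / 2 by lra.
have pp : `|p - p| < 1 / 2 by rewrite subrr normr0; lra.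
have [||||g _] := @sqdist_gronwall _ X (`|p| + 1) L (- tau) tau (phi X z) (phi X p) 0 t lip (sol _ zp') (sol _ pp); try lra.
  by move=> u ut; rewrite !bd.
have g1 : `|phi X z t - phi X p t| ^+ 2 <= C * `|z - p| ^+ 2.
  rewrite (le_trans (sqdist_ge _ _))// (le_trans g)// !phi0// subr0 /C.
  have := ler_wpM2l (expR_ge0 (4 * L * t)) (sqdist_le z p); lra.
have zd : C * `|z - p| ^+ 2 <= C * d ^+ 2.
  by rewrite ler_pM2l// ler_sqr ?nnegrE// ltW.
have dC : d * (1 + C) < e by rewrite -ltr_pdivlMr// addr_gt0.
have : (d * (1 + C)) ^+ 2 < e ^+ 2 by rewrite ltr_sqr ?nnegrE ?ltW// mulr_gt0// addr_gt0.
have -> : (d * (1 + C)) ^+ 2 = C * d ^+ 2 + d ^+ 2 * (1 + C + C ^+ 2) by ring.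
have : 0 < d ^+ 2 * (1 + C + C ^+ 2) by rewrite mulr_gt0 ?exprn_gt0// addr_gt0 ?exprn_gt0// addr_gt0.
move=> h1 h2; rewrite -ltr_sqr ?nnegrE ?normr_ge0 ?(ltW e0)//.
by rewrite (le_lt_trans (le_trans g1 zd))// (lt_trans _ h2)// ltrDl.
Qed.

End ShortTime.

Section BoundaryArc.
Variables (R : realType) (N : set (R * R)).

(** The inverse chart along the horizontal axis parametrises the boundary near [p], with the first
    chart coordinate as parameter. *)
Lemma boundary_arc U h (p : R * R) : adapted_chart N U h -> U p -> (h p).2 = 0 ->
  exists2 eta : R, 0 < eta & exists u : R -> R * R, [/\ u 0 = p,
    forall s, `|s| < eta -> [/\ U (u s), boundary N (u s), (h (u s)).1 = (h p).1 + s &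
      {for s, continuous u}] &
    forall z, U z -> boundary N z -> u ((h z).1 - (h p).1) = z].
Proof.
move=> hU Up hp; have [V [k [hk Vhp khp nV ck]]] := chart_inverse hU Up.
have [[oU oV] hs ks hUV kVU] := hk.
have [eta eta0 hV] := (nbhs_distP _ _).1 nV.
pose v s := ((h p).1 + s, 0 : R); exists eta => //; exists (k \o v).
have hpE : h p = ((h p).1, 0) by rewrite -hp -surjective_pairing.
split.
- by rewrite /= /v addr0 -hpE.
- move=> s seta; have Vs : V (v s).
    apply: hV; rewrite hpE sup_normE/= [(h p).1 + s]addrC addrK subrr normr0.
    by rewrite gt_max seta.
  have [Uks hks] := kVU _ Vs; split; first exact: Uks.
  + by apply/(boundary_chart hU Uks); rewrite hks.
  + by rewrite /= hks.
  + apply: continuous_comp; last by apply: differentiable_continuous; exact: (ks [::]).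
    apply/continuous_atP => e e0; exists e => // q qs.
    by rewrite sup_normE/= subrr normr0 gt_max e0 andbT opprD addrACA subrr add0r.
- move=> z Uz bz; rewrite /= /v addrC subrK.
  have [_ {2}<-] := hUV _ Uz; congr k.
  by rewrite [RHS]surjective_pairing ((boundary_chart hU Uz).1 bz).
Qed.

End BoundaryArc.

Section ExitPath.
Variables (R : realType) (X : R * R -> R * R).
Hypotheses (lipX : locally_lipschitz X) (solX : locally_solvable X) (ctX : continuous X).
Variables (N I : set (R * R)).
Hypothesis blockN : isolating_block X I N.

(* Orbits starting inside [N] near [c] have to follow the orbit of [c] out of [N]. *)
Lemma exit_arc_sign U h (c : R * R) eta (u : R -> R * R) : adapted_chart N U h -> U c ->
  exit_set X N c -> tangency_set X N c -> 0 < eta ->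
  (forall s, `|s| < eta -> [/\ U (u s), boundary N (u s), (h (u s)).1 = (h c).1 + s &
      {for s, continuous u}]) ->
  (forall z, U z -> boundary N z -> u ((h z).1 - (h c).1) = z) ->
  (forall s, `|s| < eta -> s != 0 -> 0 < dsnd h (X (u s)) (u s)) -> False.
Proof.
move=> hU Uc [bc [t0 t00 out]] tc eta0 hu uh pos.
have [_ _ tcE _] := blockN.
have [[_ [t0' t0'0 out']] _] : (entry_set X N `&` exit_set X N) c by rewrite tcE.
have hc : (h c).2 = 0 by apply/(boundary_chart hU Uc).
have ch := chart_continuous hU Uc.
have : \forall z \near c, U z /\ `|(h z).1 - (h c).1| < eta.
  have h1 : {for c, continuous (fun z => (h z).1)} by exact: cvg_fst_comp.
  have /continuous_atP/(_ _ eta0)[d d0 hd] := h1.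
  near=> z; split; first by near: z; exact: chart_nbhs hU Uc.
  by apply: hd; near: z; apply/nbhs_distP; exists d.
move=> /nbhs_distP[r r0 hr].
have [tau tau0 near] := flow_stays_near lipX solX c r0.
have [tau' tau'0 cont] := flow_continuous_initial lipX solX c.
have [T1 [T10 T1a T1b]] := pos_lt2 tau0 tau'0.
have [T2 [T20 T2a T2b]] := pos_lt2 T10 t00.
have [T [T0 Ta Tb]] := pos_lt2 T20 t0'0.
have stay z t : `|z - c| < r / 2 -> 0 <= t <= T -> dom X z t /\ `|phi X z t - c| < r.
  move=> zc tT; have [t_ge0 tT'] := andP tT.
  have [|? H] := near z t zc; first by rewrite ger0_norm// (le_trans tT')// ltW// (lt_trans Ta)// (lt_trans T2a).
  by split=> //; exact: H.
have cc : `|c - c| < r / 2 by rewrite subrr normr0 divr_gt0.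
have cdom t : 0 <= t <= T -> dom X c t by move=> tT; have [] := stay c t cc tT.
have outside t : 0 < t <= T -> ~ N (phi X c t).
  move=> tT; apply: (out t); first by lra.
  by apply: dom_flow => //; apply: cdom; lra.
have UT : U (phi X c T).
  by have [_ /hr[]] := stay c T cc ltac:(lra).
have hT : (h (phi X c T)).2 < 0.
  by rewrite ltNge; apply/negP => h0; apply: (outside T); [lra|have [_ /(_ _ UT)[]] := hU; auto].
have c2 : {for c, continuous (fun z => (h (phi X z T)).2)}.
  apply: cvg_snd_comp; apply: (continuous_comp (f := fun z => phi X z T)).
    by apply: cont; lra.
  exact: chart_continuous hU UT.
have hT' : 0 < - (h (phi X c T)).2 by rewrite oppr_gt0.
have /continuous_atP/(_ _ hT')[d d0 hd] := c2.
(* A point strictly above the axis in the chart, so close to [c] that at time [T] its orbit is below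
   the axis, as is that of [c]. *)
have [z [zc zd zN hz]] : exists z, [/\ `|z - c| < r / 2, `|z - c| < d, N z & 0 < (h z).2].
  have [V [k [hk Vhc khc nV ck]]] := chart_inverse hU Uc.
  have [_ _ _ _ kV] := hk; have [e1 e10 hV] := (nbhs_distP _ _).1 nV.
  have [m [m0 mr md]] : exists m, [/\ 0 < m, m < r / 2 & m < d] by apply: pos_lt2 => //; rewrite divr_gt0.
  have /continuous_atP/(_ _ m0)[e2 e20 hk2] := ck.
  have [e [e_0 ea eb]] := pos_lt2 e10 e20.
  have close (e' : R) : e < e' -> `|((h c).1, e) - h c| < e'.
    by move=> ee'; rewrite sup_normE/= subrr normr0 hc subr0 gt_max gtr0_norm// ee' (lt_trans e_0 ee').
  have [Uk hkE] := kV _ (hV _ (close _ ea)).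
  have kc : `|k ((h c).1, e) - c| < m by rewrite -[X in _ - X]khc; apply: hk2; exact: close.
  exists (k ((h c).1, e)); rewrite hkE; split=> //; rewrite ?(lt_trans kc)//.
  by have [_ /(_ _ Uk)[_]] := hU; apply; rewrite hkE/= ltW.
pose f t := - (h (phi X z t)).2.
have Uz t : 0 <= t <= T -> U (phi X z t) by move=> tT; have [_ /hr[]] := stay z t zc tT.
have df t : 0 <= t <= T -> is_derive t 1 f (- dsnd h (X (phi X z t)) (phi X z t)).
  move=> tT; apply: is_deriveN; apply: (chart_along lipX hU (stay z t zc tT).1); exact: Uz.
have [||||t1 [t1b ft1 before]] := @first_hit R f 0 T; first exact: ltW.
- by move=> t /df h'; exact: is_derive_continuous h'.
- by rewrite /f phi0// oppr_lt0.
- by have := hd z zd; rewrite /f ltr_norml oppr_ge0 => /andP[_]; rewrite ltrBlDr addNr => /ltW.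
have t1T : 0 <= t1 <= T by case/andP: t1b => /ltW -> ->.
have bz : boundary N (phi X z t1).
  by apply/(boundary_chart hU (Uz _ t1T)); move: ft1; rewrite /f => /eqP; rewrite oppr_eq0 => /eqP.
(* An orbit coming from above the axis meets the boundary with a nonpositive normal derivative,
   while at the arc points other than [c] it is positive. *)
have t1c : phi X z t1 = c.
  have [//|ne] := eqVneq (phi X z t1) c; exfalso.
  have [_ /hr[_ small]] := stay z t1 zc t1T.
  have := uh _ (Uz _ t1T) bz; set s := _ - _ in small * => us.
  have s0 : s != 0.
    apply/eqP => s0; move: ne; rewrite -us s0; have := uh c Uc bc.
    by rewrite subrr => ->; rewrite eqxx.
  have := pos s small s0; rewrite us => pos'.
  have t10 : 0 < t1 by case/andP: t1b.
  have : dsnd h (X (phi X z t1)) (phi X z t1) <= 0.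
    have df' := is_deriveN (df _ t1T).
    rewrite -[leLHS]opprK; apply: (@derive_le0_sign _ _ _ _ t1 df') => //.
    - by rewrite /GRing.opp/= ft1 oppr0.
    - move=> s' s'1; have b : f (t1 - s') < 0.
        by apply: before; rewrite subr_ge0 gtrBl; case/andP: s'1 => -> /ltW ->.
      by rewrite -[leRHS]/(- f (t1 - s')) oppr_ge0 ltW.
  by rewrite leNgt pos'.
(* Being tangent, [c] is also an entry point: shortly before reaching it an orbit is outside [N],
   yet this one came from [z] in [N]. *)
have := flow_opp (dom_flow lipX (stay z t1 zc t1T).1); rewrite t1c => fz.
apply: (out' (- t1) z _ fz zN); rewrite ltrN2 oppr_lt0.
by case/andP: t1b => -> t1T'; rewrite (le_lt_trans t1T').
Unshelve. all: by end_near.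
Qed.

(** If [c] is not tangent, the field points outwards on a whole arc around it. If it is, the
    tangency points are isolated, so the normal derivative has a constant sign on each half of the
    arc, and [exit_arc_sign] excludes that both signs are positive. *)
Lemma exit_path (c : R * R) : exit_set X N c -> exists gamma : R -> R * R,
  [/\ gamma 0 = c, gamma 1 != c &
    forall r, 0 <= r <= 1 -> exit_set X N (gamma r) /\ {for r, continuous gamma}].
Proof.
move=> ec; have bc : boundary N c by case: ec.
have [_ _ tcE tcodim] := blockN.
suff [U [h [eta [u [s [[hU Uc] [u0 hu] s0 se neg]]]]]] : exists U h (eta : R) (u : R -> R * R) (s : R),
    [/\ adapted_chart N U h /\ U c, u 0 = c /\ (forall s, `|s| < eta ->
      [/\ U (u s), boundary N (u s), (h (u s)).1 = (h c).1 + s & {for s, continuous u}]),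
      s != 0, `|s| < eta & forall r, 0 < r <= 1 -> dsnd h (X (u (s * r))) (u (s * r)) < 0].
  have sr r : 0 <= r <= 1 -> `|s * r| < eta.
    move=> r01; rewrite normrM (ger0_norm (_ : 0 <= r)); last by lra.
    by rewrite (le_lt_trans _ se)// ler_piMr//; lra.
  exists (fun r => u (s * r)); split; first by rewrite mulr0.
    apply/eqP; rewrite mulr1 => usc; have [_ _ + _] := hu s se; rewrite usc.
    by move=> /eqP; rewrite addrC -subr_eq subrr eq_sym (negPf s0).
  move=> r r01; have [Uu bu _ cu] := hu _ (sr r r01); split.
    have [->|r0] := eqVneq r 0; first by rewrite mulr0 u0.
    apply: (exit_of_transversal lipX solX hU Uu); first by apply/(boundary_chart hU Uu).
    by apply: neg; rewrite lt0r r0.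
  apply: (continuous_comp (f := fun r => s * r) (g := u)) => //.
  by apply: cvgM; [exact: cvg_cst|exact: cvg_id].
have field_cont U h (u : R -> R * R) (t : R) : adapted_chart N U h -> U (u t) -> {for t, continuous u} ->
    {for t, continuous (fun s => dsnd h (X (u s)) (u s))}.
  move=> hU Ut cu; apply: (continuous_comp (f := u) (g := fun z => dsnd h (X z) z)) => //.
  exact: chart_field_continuous hU Ut (@ctX _).
have [tc|ntc] := pselect (tangency_set X N c).
  have [U [h [Uc hU tU]]] := tcodim _ tc.
  have hc : (h c).2 = 0 by apply/(boundary_chart hU Uc).
  have hc1 : (h c).1 = 0 by have [/(_ tc)[]] := tU c Uc.
  have [eta eta0 [u [u0 hu uh]]] := boundary_arc hU Uc hc.
  have ne s : `|s| < eta -> s != 0 -> dsnd h (X (u s)) (u s) != 0.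
    move=> se s0; have [Uu bu hu1 _] := hu s se; apply/eqP => d0.
    have ts : tangency_set X N (u s).
      by split=> //; apply/(tangent_chart _ hU Uu) => //; exact/(boundary_chart hU Uu).
    have [_] := (tU _ Uu).1 ts; rewrite hu1 hc1 add0r => s00.
    by rewrite s00 eqxx in s0.
  have [s [se s0 neg]] : exists s, [/\ `|s| < eta, s != 0 & dsnd h (X (u s)) (u s) < 0].
    apply: contrapT => no; apply: (exit_arc_sign hU Uc ec tc eta0 hu uh) => s se s0.
    rewrite lt_neqAle eq_sym ne//= leNgt; apply/negP => lt0.
    by apply: no; exists s.
  exists U, h, eta, u, s; split=> // r /andP[r0 r1].
  have sb v : 0 < v <= 1 -> `|s * v| < eta /\ s * v != 0.
    move=> /andP[v0 v1]; split; last by rewrite mulf_neq0// gt_eqF.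
    by rewrite normrM (gtr0_norm v0) (le_lt_trans _ se)// ler_piMr.
  rewrite ltNge; apply/negP => ge0.
  (* A change of sign between parameters [r] and 1 would give a tangency point on the half arc. *)
  have [||v vr] := @ivt_decr R (fun v => dsnd h (X (u (s * v))) (u (s * v))) r 1 0 r1.
  - move=> t tr; have tb : 0 < t <= 1 by rewrite (lt_le_trans r0); case/andP: tr.
    have [Ut _ _ ut] := hu _ (sb t tb).1.
    apply: (field_cont U h (fun v => u (s * v)) t hU Ut).
    apply: (continuous_comp (f := fun r => s * r) (g := u)) => //.
    by apply: cvgM; [exact: cvg_cst|exact: cvg_id].
  - by rewrite mulr1 ge0 ltW.
  - have vb : 0 < v <= 1 by lra.
    have [h1 h2] := sb v vb.
    by move=> h0; move: (ne _ h1 h2); rewrite h0 eqxx.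
have [U [h [Uc hU hc]]] := bc.
have neg : dsnd h (X c) c < 0.
  have ne : dsnd h (X c) c != 0.
    by apply/eqP => d0; apply: ntc; split=> //; apply/(tangent_chart _ hU Uc).
  rewrite lt_neqAle ne/= leNgt; apply/negP => pos.
  have := entry_of_transversal lipX solX hU Uc hc pos => en.
  by apply: ntc; rewrite -tcE.
have [eta eta0 [u [u0 hu uh]]] := boundary_arc hU Uc hc.
have [_ _ _ cu] := hu 0 ltac:(rewrite normr0; lra).
have Uu0 : U (u 0) by rewrite u0.
have := field_cont U h u 0 hU Uu0 cu; rewrite /prop_for/= => cf.
have neg' : 0 < - dsnd h (X (u 0)) (u 0) by rewrite u0 oppr_gt0.
have /continuous_atP/(_ _ neg')[d d0 hd] := cf.
have [s [s0 sa sb]] := pos_lt2 eta0 d0.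
exists U, h, eta, u, s; split=> //; first by rewrite gt_eqF.
  by rewrite gtr0_norm.
move=> r /andP[r0 r1]; have : `|s * r - 0| < d.
  by rewrite subr0 gtr0_norm ?mulr_gt0// (le_lt_trans _ sb)// ger_pMr.
by move=> /hd; rewrite ltr_norml; lra.
Qed.

(** Near [p] the condition on exit points is void, so [f] may be altered there provided it remains
    continuous with values in the exit set. The middle of an arc around [p] is collapsed onto [p],
    and on the freed interval the path [gamma] from [f p] is run forth and back; at [p] itself the
    new value is [gamma 1]. *)
Lemma extension_not_unique (p : R * R) (f : R * R -> R * R) (r0 : R) :
  continuous_extension X N f -> boundary N p -> 0 < r0 ->
  (forall z, boundary N z -> `|z - p| < r0 -> forward_asymptotic X N z) ->
  exists2 g, continuous_extension X N g & g p != f p.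
Proof.
move=> [fexit /continuous_withinP fcont fext] bp r00 asym.
have fasym z : boundary N z -> `|z - p| < r0 -> entry_set X N z by move=> bz /(asym z bz)[].
have ep : entry_set X N p by apply: fasym => //; rewrite subrr normr0.
have [gamma [g0 g1 hg]] := exit_path (fexit p ep).
have [U [h [Up hU hp]]] := bp.
have [eta eta0 [u [u0 hu uh]]] := boundary_arc hU Up hp.
pose s z := (h z).1 - (h p).1.
have sc z : U z -> {for z, continuous s}.
  move=> Uz; apply: cvgB; last exact: cvg_cst.
  by apply: cvg_fst_comp; exact: chart_continuous hU Uz.
have sp : s p = 0 by rewrite /s subrr.
have [r [r_gt0 rr0 hr]] : exists r, [/\ 0 < r, r < r0 &
    forall z, `|z - p| < r -> U z /\ `|s z| < eta].
  have /continuous_atP/(_ _ eta0)[d d0 hd] := sc p Up.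
  have [e e0 he] := (nbhs_distP _ _).1 (chart_nbhs hU Up).
  have [m [m0 m1 m2]] := pos_lt2 d0 e0; have [r [rm0 rm1 rm2]] := pos_lt2 m0 r00.
  exists r; split=> // z zr; split; first by apply: he; lra.
  by rewrite -[s z]subr0 -sp; apply: hd; lra.
have [w [w0 weta hw]] : exists w, [/\ 0 < w, w < eta & forall t, `|t| < w -> `|u t - p| < r / 2].
  have [|_ _ _ /continuous_atP/(_ (r / 2))[|d d0 hd]] := hu 0; first by rewrite normr0.
    by rewrite divr_gt0.
  have [w [w0 w1 w2]] := pos_lt2 d0 eta0; exists w; split=> // t tw.
  by rewrite -u0; apply: hd; rewrite subr0; lra.
(* With this [q], the factor [a] is 0 for [|t| <= w / 2] and 1 for [|t| >= w], whereas [b] is 1 at 0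
   and decreases to 0 at [|t| = w / 2]. *)
pose q (t : R) := 2 * `|t| / w - 1.
pose a (t : R) := Num.min 1 (Num.max 0 (q t)); pose b (t : R) := Num.max 0 (- q t).
have q_cont t : {for t, continuous q}.
  apply: cvgB; last exact: cvg_cst.
  apply: cvgM; last exact: cvg_cst.
  by apply: cvgM; [exact: cvg_cst|exact: cvg_norm].
have a_cont t : {for t, continuous a}.
  apply: minr_continuous; first exact: cvg_cst.
  by apply: maxr_continuous; [exact: cvg_cst|exact: q_cont].
have b_cont t : {for t, continuous b}.
  by apply: maxr_continuous; [exact: cvg_cst|apply: cvgN; exact: q_cont].
have b01 t : 0 <= b t <= 1.
  rewrite le_max lexx ge_max ler01/= /q opprB lerBlDr lerDl.
  by rewrite divr_ge0 ?mulr_ge0// ltW.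
have a01 t : 0 <= a t <= 1 by rewrite le_min ler01 le_max lexx ge_min lexx.
have a_far t : w <= `|t| -> a t = 1.
  move=> wt; have q1 : 1 <= q t.
    by rewrite /q lerBrDr -mulrA -[1 + 1]mulr1 ler_pM2l// ler_pdivlMr// mul1r.
  by rewrite /a max_r ?min_l//; lra.
have ab t : a t = 0 \/ b t = 0.
  have [qt|qt] := leP (q t) 0; [left|right]; rewrite /a /b.
    by rewrite max_l// min_r.
  by rewrite max_l//; lra.
pose P z := u (s z * a (s z)).
have sa z : `|s z| < eta -> `|s z * a (s z)| < eta.
  move=> sz; have /andP[a0 a1] := a01 (s z).
  by rewrite normrM (ger0_norm a0) (le_lt_trans _ sz)// ler_piMr.
have P_in z : boundary N z -> `|z - p| < r -> boundary N (P z) /\ `|P z - p| < r.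
  move=> bz zr; have [Uz sz] := hr z zr; have [_ bP _ _] := hu _ (sa z sz).
  split=> //; have [wz|zw] := leP w `|s z|.
    by rewrite /P a_far// mulr1 uh.
  suff : `|P z - p| < r / 2 by lra.
  apply: hw; have /andP[a0 a1] := a01 (s z).
  by rewrite normrM (ger0_norm a0) (le_lt_trans _ zw)// ler_piMr.
have P_cont z : `|z - p| < r -> {for z, continuous P}.
  move=> zr; have [Uz sz] := hr z zr; have [_ _ _ cu] := hu _ (sa z sz).
  apply: (continuous_comp (f := fun z => s z * a (s z)) (g := u)) => //.
  by apply: cvgM; [exact: sc|apply: (continuous_comp (f := s) (g := a)); [exact: sc|exact: a_cont]].
(* Always one of the two pieces is trivial: where [a] vanishes [P z] is [p] and [H z] is a point of
   [gamma]; elsewhere [b] vanishes and [H z] is [f (P z)]. The sum makes continuity evident. *)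
pose H z := f (P z) + (gamma (b (s z)) - f p).
have H_far z : boundary N z -> `|z - p| < r -> r / 2 <= `|z - p| -> H z = f z.
  move=> bz zr rz; have [Uz sz] := hr z zr.
  have wz : w <= `|s z|.
    rewrite leNgt; apply/negP => /hw; rewrite uh//; lra.
  rewrite /H /P a_far// mulr1 uh//.
  have [|->] := ab (s z); first by rewrite a_far// => /eqP; rewrite oner_eq0.
  by rewrite g0 subrr addr0.
pose g z := if `|z - p| < r then H z else f z.
exists g.
  split.
  - move=> z ez; have bz : boundary N z by case: ez.
    rewrite /g; case: ifP => zr; last exact: fexit.
    have [bP Pr] := P_in z bz zr.
    rewrite /H; have [az|bz0] := ab (s z).
      by rewrite /P az mulr0 u0 addrC subrK; exact: (hg _ (b01 _)).1.
    by rewrite bz0 g0 subrr addr0; apply: fexit; apply: fasym => //; lra.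
  - apply/continuous_withinP => z ez e e0; have bz : boundary N z by case: ez.
    have [zr|zr] := ltP `|z - p| r; last first.
      have [d d0 hd] := fcont z ez e e0.
      have [m [m0 m1 m2]] := pos_lt2 d0 (divr_gt0 r_gt0 (ltr0n R 2)).
      exists m => // y ey yz; have by' : boundary N y by case: ey.
      have yp : r / 2 <= `|y - p|.
        by have := ler_distD y z p; rewrite [`|z - y|]distrC; lra.
      rewrite /g [`|z - p| < r]ltNge zr/=; case: ifP => yr; last by apply: hd => //; lra.
      by rewrite H_far//; apply: hd => //; lra.
    have [bP Pr] := P_in z bz zr.
    have e2 : 0 < e / 2 by rewrite divr_gt0.
    have eP : entry_set X N (P z) by apply: fasym => //; lra.
    have [d1 d10 hd1] := fcont _ eP _ e2.
    have /continuous_atP/(_ _ d10)[d2 d20 hd2] := P_cont z zr.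
    have cg : {for z, continuous (fun y => gamma (b (s y)))}.
      apply: (continuous_comp (f := fun y => b (s y)) (g := gamma)); last exact: (hg _ (b01 _)).2.
      by apply: (continuous_comp (f := s) (g := b)); [exact: sc (hr z zr).1|exact: b_cont].
    have /continuous_atP/(_ _ e2)[d3 d30 hd3] := cg.
    have [m [m0 m1 m2]] := pos_lt2 d20 d30.
    have rz0 : 0 < r - `|z - p| by rewrite subr_gt0.
    have [m' [m'0 m'1 m'2]] := pos_lt2 m0 rz0.
    exists m' => // y ey yz; have by' : boundary N y by case: ey.
    have yr : `|y - p| < r.
      have : `|y - p| <= `|y - z| + `|z - p|.
        by exact: ler_distD.
      lra.
    rewrite /g yr zr /H; have [bP' Pr'] := P_in y by' yr.
    have eP' : entry_set X N (P y) by apply: fasym => //; exact: lt_trans Pr' rr0.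
    have h1 : `|f (P y) - f (P z)| < e / 2 by apply: hd1 => //; apply: hd2; exact: lt_trans (lt_trans yz m'1) m1.
    have h2 : `|gamma (b (s y)) - gamma (b (s z))| < e / 2 by apply: hd3; exact: lt_trans (lt_trans yz m'1) m2.
    have gE : (gamma (b (s y)) - f p) - (gamma (b (s z)) - f p) =
        gamma (b (s y)) - gamma (b (s z)) by rewrite opprB addrA subrK.
    by rewrite opprD addrACA gE; apply: le_lt_trans (ler_normD _ _) _; rewrite [e]splitr ltrD.
  - move=> z [ez nz]; have bz : boundary N z by case: ez.
    rewrite /g; case: ifP => zr; last exact: fext.
    by exfalso; apply: nz; apply: asym => //; lra.
rewrite /g subrr normr0 r_gt0 /H /P sp mul0r u0 /b /q normr0 mulr0 mul0r sub0r opprK.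
by rewrite max_r// addrC subrK.
Qed.

End ExitPath.

Section PlaneLinear.
Variables (R : realType) (a b c d : R).

Definition plane_map (z : R * R) : R * R := (a * z.1 + b * z.2, c * z.1 + d * z.2).

Fact plane_map_linear : linear plane_map.
Proof.
move=> k u v; rewrite /plane_map [RHS]surjective_pairing.
by congr pair; rewrite /= /GRing.scale/=; ring.
Qed.

HB.instance Definition _ :=
  GRing.isLinear.Build R (R * R)%type (R * R)%type _ plane_map plane_map_linear.

End PlaneLinear.

(** * Lotka-Volterra fields with [a] and [d] negative *)

Section NonRegularisable.
Variables (R : realType) (a d : R).
Hypotheses (a0 : a < 0) (d0 : d < 0).

Lemma lv_sector_passage N f (y1 : R) : isolating_block (lv_field a d) [set 0] N ->
  continuous_extension (lv_field a d) N f -> 0 < y1 -> boundary N (0, y1) ->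
  (forall s, 0 <= s <= y1 -> N (0, s)) ->
  exists2 x1, 0 < x1 & f (0, y1) = (- x1, 0).
Proof.
have a0' : 0 < - a by rewrite oppr_gt0.
have d0' : 0 < - d by rewrite oppr_gt0.
by have := @sector_passage R (- a) (- d) a0' d0' N f; rewrite !opprK => + ? ? ? ?; exact.
Qed.

End NonRegularisable.

(** The involution [T] fixes the [y] axis pointwise and exchanges the sectors on its two sides,
    sending the negative [x] axis to the half-diagonal. Passing through both sectors, [f (0, y1)]
    would lie on each of these half-lines. *)
Lemma lv_two_sectors (R : realType) (a d : R) : a < 0 -> d < 0 -> 0 < a + d + 1 ->
  ~ C0_regularisable (lv_field a d).
Proof.
move=> a0 d0 ad0 [N [blockN [f [extf _]]]].
have [y1 [y10 by1 Ny1]] := ray_segment blockN (north_neq0 R).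
rewrite scale_north in by1.
have {}Ny1 s : 0 <= s <= y1 -> N (0, s) by move=> /Ny1; rewrite scale_north.
have [x1 x10 fx1] := lv_sector_passage a0 d0 blockN extf y10 by1 Ny1.
pose T := plane_map (-1 : R) 0 (-1) 1.
have TT : cancel T T by move=> [x y]; rewrite /T /plane_map/=; congr pair; ring.
have blockTN := push_isolating_block TT TT blockN.
have extTf := push_continuous_extension TT TT extf.
have TX : push_field T T (lv_field a d) = lv_field (- (a + d + 1)) d.
  apply/funext => -[x y]; rewrite /push_field /T /lv_field /quadratic_field/= /plane_map/=.
  by congr pair; ring.
rewrite TX in blockTN extTf.
have Tn s : T (0, s) = (0, s) by rewrite /T /plane_map/=; congr pair; ring.
have [||||x2 x20] := @lv_sector_passage _ _ _ _ d0 _ _ y1 blockTN extTf.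
- by rewrite oppr_lt0.
- by [].
- by apply: (proj2 (push_boundaryP TT TT N (0, y1))); rewrite [X in boundary N X]Tn.
- by move=> s ss; rewrite /push_set/= [X in N X]Tn; exact: Ny1.
rewrite /= [X in f X]Tn fx1 /T /plane_map/= => -[h1 h2]; lra.
Qed.

(** The function [(y / x - 1) ^+ 2] decreases along the flow, so thin cones around the half-diagonal
    are forward invariant; inside them the sign of [a + d + 1] makes [x] decrease. Hence the orbit
    is bounded and complete forwards. *)
Lemma lv_diagonal (R : realType) (a d : R) : a < 0 -> d < 0 -> a + d + 1 < 0 ->
  exists2 e0 : R, 0 < e0 & forall e (z : R * R), 0 < e <= e0 -> 0 < z.1 -> 0 < z.2 ->
    `|z.2 - z.1| <= e * z.1 -> forall t, 0 <= t ->
    [/\ dom (lv_field a d) z t, 0 < (phi (lv_field a d) z t).1,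
      `|(phi (lv_field a d) z t).2 - (phi (lv_field a d) z t).1| <=
         e * (phi (lv_field a d) z t).1 &
      forall s, 0 <= s <= t -> (phi (lv_field a d) z t).1 <= (phi (lv_field a d) z s).1].
Proof.
move=> a0 d0 mu0; set X := lv_field a d.
have lipX : locally_lipschitz X := quadratic_field_lipschitz _ _ _ _ _ _.
have solX : locally_solvable X := quadratic_field_solvable _ _ _ _ _ _.
(* In [x' = x * ((a + d + 1) * x + (d + 1) * (y - x))] the first term then outweighs the second. *)
pose e0 := - (a + d + 1) / (`|d + 1| + 1).
have n0 : 0 < `|d + 1| + 1 by rewrite ltr_wpDl.
have e00 : 0 < e0 by rewrite divr_gt0// oppr_gt0.
exists e0 => // e z /andP[e_gt0 ee0] x0 y0 ze.
have ed : `|d + 1| * e < - (a + d + 1).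
  have : (`|d + 1| + 1) * e <= - (a + d + 1) by rewrite mulrC -ler_pdivlMr.
  lra.
have dx s : dom X z s -> 0 < (phi X z s).1 by move=> ds; exact: lv_x_gt0.
have dy s : dom X z s -> 0 < (phi X z s).2 by move=> ds; exact: lv_y_gt0.
pose w (p : R * R) := (p.2 / p.1 - 1) ^+ 2.
have dw s : dom X z s -> is_derive s 1 (fun t => w (phi X z t)) (- 2 * w (phi X z s) * (phi X z s).2).
  move=> ds; have h1 := phi_derive1 ds; have h2 := phi_derive2 ds.
  have x_neq0 : (phi X z s).1 != 0 by rewrite gt_eqF// dx.
  have h3 := is_derive_inv h1 x_neq0.
  rewrite /w; apply: is_derive_eq; rewrite /GRing.scale/= /lv_field /quadratic_field/=.
  by field.
have cone s : 0 <= s -> dom X z s -> `|(phi X z s).2 - (phi X z s).1| <= e * (phi X z s).1.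
  move=> s0 ds; have wle : w (phi X z s) <= w z.
    have dd t : 0 <= t <= s -> dom X z t by move=> ts; apply: (dom_between solX ds); rewrite ts.
    have := @derive_le_slope R _ _ 0 s 0 s0 (fun t ts => dw t (dd t ts)).
    rewrite mul0r addr0 phi0//; apply=> t ts.
    have y_gt0 := dy t (dd t ts); rewrite mulNr mulNr oppr_le0.
    by apply: mulr_ge0; [apply: mulr_ge0 => //; exact: sqr_ge0|exact: ltW].
  have wE (p : R * R) : 0 < p.1 -> (w p <= e ^+ 2) = (`|p.2 - p.1| <= e * p.1).
    move=> p0; have wE' : w p = (`|p.2 - p.1| / p.1) ^+ 2.
      rewrite expr_div_n real_normK ?num_real// /w; field; exact: lt0r_neq0.
    by rewrite wE' ler_sqr ?nnegrE ?divr_ge0 ?(ltW p0) ?(ltW e_gt0)// ler_pdivrMr.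
  by rewrite -wE ?dx// (le_trans wle)// wE.
have x_decr s t : 0 <= s -> s <= t -> dom X z t -> (phi X z t).1 <= (phi X z s).1.
  move=> s0 st dt; have dd u : s <= u <= t -> dom X z u.
    by move=> ut; apply: (dom_between solX dt); apply/orP; left; lra.
  have := @derive_le_slope R _ _ s t 0 st (fun u ut => phi_derive1 (dd u ut)).
  rewrite mul0r addr0; apply=> u ut.
  have u0 : 0 <= u by lra.
  have cu := cone u u0 (dd u ut); have xu := dx u (dd u ut).
  rewrite /lv_field /quadratic_field/=.
  set x := (phi X z u).1 in cu xu *; set y := (phi X z u).2 in cu *.
  have -> : a * x ^+ 2 + (d + 1) * x * y + 0 * y ^+ 2 =
      x * ((a + d + 1) * x + (d + 1) * (y - x)) by ring.
  rewrite pmulr_rle0//.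
  have h1 : (d + 1) * (y - x) <= `|d + 1| * (e * x).
    by rewrite (le_trans (ler_norm _))// normrM ler_wpM2l.
  have h2 : `|d + 1| * e * x < - (a + d + 1) * x by rewrite ltr_pM2r.
  lra.
have glob t : 0 <= t -> dom X z t.
  move=> t0; have := @dom_bounded _ _ lipX solX false z (z.1 + e * z.1) _ t t0.
  rewrite expr0 mul1r; apply => s q s0; rewrite mul1r => fq.
  have ds : dom X z s by exists q.
  have := cone s s0 ds; have := x_decr 0 s (lexx 0) s0 ds; have := dx s ds.
  rewrite phi0// (phiE lipX fq) => q0 qz qe.
  have : e * q.1 <= e * z.1 by rewrite ler_pM2l.
  have ez0 : 0 < e * z.1 by rewrite mulr_gt0.
  by move: qe; rewrite sup_normE ge_max !ler_norml; lra.
move=> t t0; split; [exact: glob|apply: dx; exact: glob|apply: cone => //; exact: glob|].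
by move=> s st; apply: x_decr; [lra|lra|exact: glob].
Qed.

(** At its end point on the half-diagonal the block is entered transversally, and all boundary
    points nearby are shown to be asymptotic, which is the situation of [extension_not_unique]. *)
Lemma lv_attracting_sector (R : realType) (a d : R) : a < 0 -> d < 0 -> a + d + 1 < 0 ->
  ~ C0_regularisable (lv_field a d).
Proof.
move=> a0 d0 mu0 [N [blockN [f [extf uf]]]]; set X := lv_field a d in blockN extf uf.
have lipX : locally_lipschitz X := quadratic_field_lipschitz _ _ _ _ _ _.
have solX : locally_solvable X := quadratic_field_solvable _ _ _ _ _ _.
have ctX : continuous X := @quadratic_field_continuous R _ _ _ _ _ _.
pose v : R * R := (1, 1).
have v0 : v != 0 by apply/eqP => -[/eqP]; rewrite oner_eq0.
have sv s : s *: v = (s, s).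
  by rewrite [LHS]surjective_pairing; congr pair; rewrite /= /GRing.scale/=; ring.
have Xv : X v = (a + d + 1) *: v.
  by rewrite sv /X /lv_field /quadratic_field/=; congr pair; ring.
have [s1 [s10 bs1 Ns1]] := ray_segment blockN v0.
pose p : R * R := (s1, s1).
have bp : boundary N p by move: bs1; rewrite sv.
have [U [h [Up hU hp]]] := bp.
have dp : 0 < dsnd h (X p) p.
  rewrite /p -sv; apply: (ray_entering blockN Xv s10 bs1 Ns1 mu0 hU).
  by rewrite sv.
have [r r0 hr] := chart_radius_gt0 ctX hU Up dp.
have [|e1 e10 tube] := compact_in_interior (N := N) (@segment_scale_compact R v (s1 - r / 2)).
  move=> _ [s /= + <-]; rewrite in_itv/= => ss; apply: (ray_interior blockN Xv s10 Ns1).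
  lra.
have [e0 e00 attr] := lv_diagonal a0 d0 mu0; rewrite -/X in attr.
have c0 : 0 < 1 + s1 by lra.
have c4 : 0 < 4 * (1 + s1) by rewrite mulr_gt0.
have [e2 [e20 e2a e2b]] := pos_lt2 e00 (divr_gt0 e10 c4).
have [e3 [e30 e3a e3b]] := pos_lt2 e20 (divr_gt0 r0 c4).
have [dl' [dl'0 dl'a dl'b]] : exists dl, [/\ 0 < dl, dl < s1 / 2 & dl < e3 * s1 / 8].
  by apply: pos_lt2; rewrite ?divr_gt0 ?mulr_gt0.
have [dl [dl0 dla dlb]] := pos_lt2 dl'0 (divr_gt0 r0 (ltr0n R 2)).
have es1 : 0 < e3 * s1 by rewrite mulr_gt0.
have er : e3 * s1 < r / 4.
  have : e3 * (4 * (1 + s1)) < r by rewrite -ltr_pdivlMr.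
  clear -e30; lra.
have ee1 : e3 * s1 < e1 / 4.
  have : e3 * (4 * (1 + s1)) < e1 by rewrite -ltr_pdivlMr// (lt_trans e3a).
  clear -e30; lra.
have asym z : boundary N z -> `|z - p| < dl -> forward_asymptotic X N z.
  move=> bz zp; have /andP[z1 z2] : (`|z.1 - s1| < dl) && (`|z.2 - s1| < dl).
    by move: zp; rewrite sup_normE gt_max.
  rewrite !ltr_norml in z1 z2.
  have x0 : 0 < z.1 by clear -z1 dla dl'a s10; lra.
  have y0 : 0 < z.2 by clear -z2 dla dl'a s10; lra.
  have zc : `|z.2 - z.1| <= e3 * z.1.
    have : e3 * (s1 / 2) <= e3 * z.1 by rewrite ler_pM2l//; clear -z1 dla dl'a; lra.
    by rewrite ler_norml; clear -z1 z2 dla dl'b es1; lra.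
  have e3e : 0 < e3 <= e0 by clear -e30 e3a e2a; lra.
  have orb t : 0 <= t -> N (phi X z t).
    move=> t0; have [dt q0 qc qdec] := attr e3 z e3e x0 y0 zc t t0.
    have near s : 0 <= s <= t -> dom X z s /\ (s1 - r / 2 < (phi X z s).1 -> `|phi X z s - p| < r).
      move=> /andP[s0 st]; have [ds w0 wc wdec] := attr e3 z e3e x0 y0 zc s s0; split=> // far.
      have := wdec 0; rewrite lexx s0 phi0// => /(_ erefl) wz.
      have : e3 * (phi X z s).1 <= e3 * (s1 * 2).
        by rewrite ler_pM2l//; clear -wz z1 dla dl'a s10; lra.
      move: wc; rewrite sup_normE gt_max !ltr_norml ler_norml/=.
      clear -far wz z1 dlb er; lra.
    (* Either the orbit is already in the tube around the inner segment of the diagonal, or, as [x]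
       decreases, it has so far stayed in the chart near [p], where the second coordinate has
       increased from 0. *)
    have [close|far] := leP (phi X z t).1 (s1 - r / 2).
      apply: interior_subset; apply: (tube ((phi X z t).1 *: v)).
        by exists (phi X z t).1; rewrite //= in_itv/= (ltW q0).
      have : e3 * (phi X z t).1 <= e3 * s1.
        by rewrite ler_pM2l//; clear -close r0; lra.
      rewrite sv sup_normE gt_max/= subrr normr0 e10/=; clear -qc ee1 e10; lra.
    have inU s : 0 <= s <= t -> dom X z s /\ U (phi X z s) /\ 0 < dsnd h (X (phi X z s)) (phi X z s).
      move=> st; have [ds H] := near s st; split=> //; apply: hr; apply: H.
      by rewrite (lt_le_trans far)// qdec.
    have Ut : U (phi X z t) by have [|_ []] := inU t; rewrite ?t0 ?lexx.
    have Uz : U z by have [|_ []] := inU 0; rewrite ?t0 ?lexx// phi0.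
    have [_ /(_ _ Ut)[_]] := hU; apply.
    have := @derive_ge_slope R _ _ 0 t 0 t0 (fun s st => chart_along lipX hU (inU s st).1 (inU s st).2.1).
    rewrite mul0r addr0 phi0// ((boundary_chart hU Uz).1 bz); apply => s st.
    by have [_ [_ /ltW]] := inU s st.
  have ez : entry_set X N z.
    have [|Uz dz] := hr z; first by rewrite (lt_trans zp)//; clear -dlb r0; lra.
    by apply: (entry_of_transversal lipX solX hU Uz _ dz); apply/(boundary_chart hU Uz).
  split=> // t t0; exists (phi X z t); last exact: orb.
  by apply: dom_flow => //; have [] := attr e3 z e3e x0 y0 zc t t0.
have [g extg gp] := extension_not_unique lipX solX ctX blockN extf bp dl0 asym.
have ep : entry_set X N p by exact: (entry_of_transversal lipX solX hU Up hp dp).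
by move: gp; rewrite (uf g extg p ep) eqxx.
Qed.

(** * Charts of the unit disc *)

Section RationalFunctions.
Variables (R : realType) (U : set (R * R)).

(** A class closed under directional derivatives, so that smoothness follows by induction on the
    list of directions. *)
Inductive rational_on : (R * R -> R) -> Prop :=
| rational_cst c : rational_on (fun=> c)
| rational_fst : rational_on fst
| rational_snd : rational_on snd
| rational_add f g : rational_on f -> rational_on g -> rational_on (fun z => f z + g z)
| rational_mul f g : rational_on f -> rational_on g -> rational_on (fun z => f z * g z)
| rational_inv f : rational_on f -> (forall z, U z -> f z != 0) ->
    rational_on (fun z => (f z)^-1).

Lemma rational_differentiable f z : rational_on f -> U z -> differentiable f z.
Proof.
move=> rf Uz; elim: rf => {f} [c|||f g _ df _ dg|f g _ df _ dg|f _ df f0].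
- exact: differentiable_cst.
- by apply: (@linear_differentiable R _ _ fst) => x; exact: cvg_fst_comp.
- by apply: (@linear_differentiable R _ _ snd) => x; exact: cvg_snd_comp.
- exact: differentiableD.
- exact: differentiableM.
- by apply: differentiableV => //; exact: f0.
Qed.

Lemma rational_derive f v : rational_on f ->
  exists2 g, rational_on g & forall z, U z -> is_derive z v f (g z).
Proof.
elim=> {f} [c|||f g rf [f' rf' df] rg [g' rg' dg]|f g rf [f' rf' df] rg [g' rg' dg]|f rf [f' rf' df] f0].
- by exists (fun=> 0); [exact: rational_cst|move=> z _; exact: is_derive_cst].
- exists (fun=> v.1); first exact: rational_cst.
  move=> z _; have /is_derive_pairP[] : is_derive z v id v by exact: is_derive_id.
  by [].
- exists (fun=> v.2); first exact: rational_cst.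
  move=> z _; have /is_derive_pairP[] : is_derive z v id v by exact: is_derive_id.
  by [].
- exists (fun z => f' z + g' z); first exact: rational_add.
  by move=> z Uz; have := df z Uz; have := dg z Uz => h1 h2; exact: is_deriveD.
- exists (fun z => f z * g' z + g z * f' z); first by apply: rational_add; exact: rational_mul.
  by move=> z Uz; have := df z Uz; have := dg z Uz => h1 h2; exact: is_deriveM.
- exists (fun z => (- 1) * ((f z)^-1 * (f z)^-1) * f' z).
    apply: rational_mul => //; apply: rational_mul; first exact: rational_cst.
    by apply: rational_mul; exact: rational_inv.
  move=> z Uz; have dfz := rational_differentiable rf Uz.
  have dV : differentiable (fun y => (f y)^-1) z by apply: differentiableV => //; exact: f0.
  apply: DeriveDef; first exact: diff_derivable.
  have [_ fE] := df z Uz; rewrite deriveE// in fE.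
  rewrite deriveE// diffV ?f0//= fE /GRing.scale/= expr2 invfM; ring.
Qed.

Lemma rational_smooth f1 f2 : open U -> rational_on f1 -> rational_on f2 ->
  smooth_on U (fun z => (f1 z, f2 z)).
Proof.
move=> oU r1 r2 vs; set F := foldr _ _ vs.
have [g1 [g2 [rg1 rg2 FE]]] : exists g1 g2, [/\ rational_on g1, rational_on g2 &
    forall z, U z -> F z = (g1 z, g2 z)].
  rewrite /F {F}; elim: vs => [|v vs [g1 [g2 [rg1 rg2 FE]]]]; first by exists f1, f2.
  have [g1' rg1' d1] := rational_derive v rg1; have [g2' rg2' d2] := rational_derive v rg2.
  exists g1', g2'; split=> // z Uz /=.
  have d12 : is_derive z v (fun z => (g1 z, g2 z)) (g1' z, g2' z).
    by apply/is_derive_pairP; split; [exact: d1|exact: d2].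
  have near_U : \forall w \near z, U w by apply: open_nbhs_nbhs; split.
  have : is_derive z v (foldr (fun v g => 'D_v g) (fun z => (f1 z, f2 z)) vs) (g1' z, g2' z).
    by apply: near_eq_is_derive d12; apply: filterS near_U => w Uw; rewrite FE.
  by move=> [].
move=> z Uz; have near_U : \forall w \near z, U w by apply: open_nbhs_nbhs; split.
apply: (@near_eq_differentiable _ _ _ (fun z => (g1 z, g2 z))).
  by apply: filterS near_U => w Uw; rewrite FE.
by apply: differentiable_pair; apply: rational_differentiable.
Qed.

End RationalFunctions.

Section DiscCharts.
Variable R : realType.

Definition disc : set (R * R) := [set z | z.1 ^+ 2 + z.2 ^+ 2 <= 1].

Lemma sqr_sum_eq0 (x y : R) : x ^+ 2 + y ^+ 2 = 0 -> x = 0 /\ y = 0.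
Proof.
move=> /eqP; rewrite paddr_eq0 ?sqr_ge0// !sqrf_eq0 => /andP[/eqP -> /eqP ->].
by [].
Qed.

Lemma disc_compact : compact disc.
Proof.
pose I : set R := [set` `[-1, 1]].
apply: (@subclosed_compact (R * R)%type disc (I `*` I)).
- have -> : disc = (fun z : R * R => z.1 ^+ 2 + z.2 ^+ 2) @^-1` [set x | x <= 1] by [].
  apply: closed_comp; last exact: closed_le.
  move=> z _; apply: cvgD; rewrite expr2; apply: cvgM; by [exact: cvg_fst_comp|exact: cvg_snd_comp].
- by apply: (@compact_setX R R); exact: segment_compact.
- move=> z /= zz; have h (x y : R) : x ^+ 2 + y ^+ 2 <= 1 -> -1 <= x <= 1.
    move=> xy; rewrite -ler_norml -ler_sqr ?nnegrE// real_normK ?num_real// expr1n.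
    by have := sqr_ge0 y; lra.
  by rewrite /I/= !in_itv/=; split; [exact: h zz|apply: h; rewrite addrC; exact: zz].
Qed.

(* The Cayley transform, [i (1 + z) / (1 - z)], and its inverse: rational maps between the disc
   and the upper half-plane. *)
Definition cayley (z : R * R) : R * R :=
  (- 2 * z.2 * ((z.1 + -1) * (z.1 + -1) + z.2 * z.2)^-1,
   (1 + -1 * (z.1 * z.1 + z.2 * z.2)) * ((z.1 + -1) * (z.1 + -1) + z.2 * z.2)^-1).

Definition cayley_inv (w : R * R) : R * R :=
  ((w.1 * w.1 + w.2 * w.2 + -1) * (w.1 * w.1 + (w.2 + 1) * (w.2 + 1))^-1,
   - 2 * w.1 * (w.1 * w.1 + (w.2 + 1) * (w.2 + 1))^-1).

Lemma punctured_den (z p : R * R) : z != p ->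
  0 < (z.1 - p.1) * (z.1 - p.1) + (z.2 - p.2) * (z.2 - p.2).
Proof.
move=> zp; rewrite -!expr2 lt0r addr_ge0 ?sqr_ge0// andbT; apply: contra zp.
move=> /eqP/sqr_sum_eq0[/eqP + /eqP]; rewrite !subr_eq0 => /eqP h1 /eqP h2.
by rewrite [z]surjective_pairing h1 h2 -surjective_pairing.
Qed.

Lemma punctured_open (p : R * R) : open [set z | z != p].
Proof.
have -> : [set z | z != p] = (fun z => `|z - p|) @^-1` [set x | 0 < x].
  by apply/seteqP; split=> z /=; rewrite normr_gt0 subr_eq0.
apply: open_comp; last exact: open_gt.
by move=> z _; apply: cvg_norm; apply: cvgB; [exact: cvg_id|exact: cvg_cst].
Qed.

Lemma cayley_diffeomorphism :
  diffeomorphism [set z | z != (1, 0)] [set w | w != (0, -1)] cayley cayley_inv.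
Proof.
have D0 (z : R * R) : z != (1, 0) -> 0 < (z.1 + -1) * (z.1 + -1) + z.2 * z.2.
  by move=> zp; have := punctured_den zp; rewrite /= subr0.
have E0 (w : R * R) : w != (0, -1) -> 0 < w.1 * w.1 + (w.2 + 1) * (w.2 + 1).
  by move=> zp; have := punctured_den zp; rewrite /= subr0 opprK.
split.
- by split; exact: punctured_open.
- apply: rational_smooth; first exact: punctured_open.
  + apply: rational_mul; first by apply: rational_mul; [exact: rational_cst|exact: rational_snd].
    apply: rational_inv => [|z /D0 h]; last by rewrite gt_eqF.
    by repeat constructor.
  + apply: rational_mul; first by repeat constructor.
    apply: rational_inv => [|z /D0 h]; last by rewrite gt_eqF.
    by repeat constructor.
- apply: rational_smooth; first exact: punctured_open.
  + apply: rational_mul; first by repeat constructor.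
    apply: rational_inv => [|z /E0 h]; last by rewrite gt_eqF.
    by repeat constructor.
  + apply: rational_mul; first by repeat constructor.
    apply: rational_inv => [|z /E0 h]; last by rewrite gt_eqF.
    by repeat constructor.
- move=> [x y] zp; have := D0 _ zp; rewrite /= => D; set d := (x + -1) * (x + -1) + y * y in D.
  have dn : d != 0 by rewrite gt_eqF.
  (* The squared distance from the image to the excluded point [(0, -1)], which is also the
     denominator of the inverse map. *)
  have E : (- 2 * y * d^-1) * (- 2 * y * d^-1) +
     ((1 + -1 * (x * x + y * y)) * d^-1 + 1) * ((1 + -1 * (x * x + y * y)) * d^-1 + 1) = 4 / d.
    by rewrite /d; field.
  split.
    apply/eqP => cz; have := E; have [-> ->] := cz.
    by rewrite mul0r addNr mul0r addr0 => /esym/eqP; rewrite mulf_eq0 invr_eq0 (negPf dn) orbF pnatr_eq0.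
  by rewrite /cayley_inv /cayley/= -/d E; congr pair; rewrite /d; field.
- move=> [x y] zp; have := E0 _ zp; rewrite /= => D; set d := x * x + (y + 1) * (y + 1) in D.
  have dn : d != 0 by rewrite gt_eqF.
  have E : ((x * x + y * y + -1) * d^-1 + -1) * ((x * x + y * y + -1) * d^-1 + -1) +
     (- 2 * x * d^-1) * (- 2 * x * d^-1) = 4 / d.
    by rewrite /d; field.
  split.
    apply/eqP => cz; have := E; have [-> ->] := cz.
    by rewrite mul0r addrN mul0r addr0 => /esym/eqP; rewrite mulf_eq0 invr_eq0 (negPf dn) orbF pnatr_eq0.
  by rewrite /cayley_inv /cayley/= -/d E; congr pair; rewrite /d; field.
Qed.

Lemma cayley_chart : adapted_chart disc [set z | z != (1, 0)] cayley.
Proof.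
split; first by exists [set w | w != (0, -1)], cayley_inv; exact: cayley_diffeomorphism.
move=> z zp; have := punctured_den zp; rewrite /= subr0 => D.
by rewrite /cayley /disc/= pmulr_lge0 ?invr_gt0//; split=> h; lra.
Qed.

Section Rotation.
Variable p : R * R.
Hypothesis p1 : p.1 ^+ 2 + p.2 ^+ 2 = 1.

Let rot : {linear (R * R)%type -> (R * R)%type} := plane_map p.1 (- p.2) p.2 p.1.
Let rot' : {linear (R * R)%type -> (R * R)%type} := plane_map p.1 p.2 (- p.2) p.1.

Lemma rotK : cancel rot rot'.
Proof.
move=> z; rewrite /rot /rot'/= /plane_map/= [RHS]surjective_pairing.
congr pair; rewrite -[RHS]mul1r -p1; ring.
Qed.

Lemma rot'K : cancel rot' rot.
Proof.
move=> z; rewrite /rot /rot'/= /plane_map/= [RHS]surjective_pairing.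
congr pair; rewrite -[RHS]mul1r -p1; ring.
Qed.

(** The Cayley transform after the rotation that brings [p] to its pole [(1, 0)]; any point of the
    circle can thus be made the only one missed by a chart. *)
Definition disc_chart : R * R -> R * R := cayley \o rot'.

Lemma disc_chartP : adapted_chart disc [set z | z != p] disc_chart.
Proof.
have := push_chart rotK rot'K cayley_chart.
have -> : push_set rot' disc = disc.
  apply/seteqP; split=> z; rewrite /push_set /disc /rot'/= /plane_map/=;
    have -> : (p.1 * z.1 + p.2 * z.2) ^+ 2 + (- p.2 * z.1 + p.1 * z.2) ^+ 2 =
      (p.1 ^+ 2 + p.2 ^+ 2) * (z.1 ^+ 2 + z.2 ^+ 2) by ring.
  - by rewrite p1 mul1r.
  - by rewrite p1 mul1r.
have -> // : push_set rot' [set z | z != (1, 0)] = [set z | z != p].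
have rp : rot' p = (1, 0).
  by rewrite /rot'/= /plane_map/= -p1; congr pair; ring.
by apply/seteqP; split=> z; rewrite /push_set/= -rp (can_eq rot'K).
Qed.

Lemma disc_chartE z : disc_chart z =
  (- 2 * (p.1 * z.2 - p.2 * z.1) / ((z.1 - p.1) ^+ 2 + (z.2 - p.2) ^+ 2),
   (1 - (z.1 ^+ 2 + z.2 ^+ 2)) / ((z.1 - p.1) ^+ 2 + (z.2 - p.2) ^+ 2)).
Proof.
rewrite /disc_chart /rot'/= /cayley /plane_map/=.
set u := p.1 * z.1 + _; set v := - p.2 * z.1 + _.
have uv : u * u + v * v = z.1 ^+ 2 + z.2 ^+ 2.
  by rewrite -[RHS]mul1r -p1 /u /v; ring.
have -> : (u + -1) * (u + -1) + v * v = (z.1 - p.1) ^+ 2 + (z.2 - p.2) ^+ 2.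
  have -> : (u + -1) * (u + -1) + v * v = (u * u + v * v) - 2 * u + 1 by ring.
  by rewrite uv -[X in _ + X = _]p1 /u; ring.
by rewrite uv; congr pair; [congr (_ / _); rewrite /v|congr (_ / _)]; ring.
Qed.

(** The second coordinate is a quotient whose numerator vanishes on the circle, so only the
    derivative of the numerator contributes. *)
Lemma dsnd_disc_chart (z v : R * R) : z != p -> z.1 ^+ 2 + z.2 ^+ 2 = 1 ->
  dsnd disc_chart v z =
    - 2 * (z.1 * v.1 + z.2 * v.2) / ((z.1 - p.1) ^+ 2 + (z.2 - p.2) ^+ 2).
Proof.
move=> zp z1; have dz := dsnd_line v (chart_differentiable disc_chartP zp).
have D : (z.1 - p.1) ^+ 2 + (z.2 - p.2) ^+ 2 != 0.
  by have := punctured_den zp; rewrite -!expr2 => /lt0r_neq0.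
pose A t := 1 - ((z.1 + t * v.1) ^+ 2 + (z.2 + t * v.2) ^+ 2).
pose B t := (z.1 + t * v.1 - p.1) ^+ 2 + (z.2 + t * v.2 - p.2) ^+ 2.
have dA : is_derive (0 : R) 1 A (- 2 * (z.1 * v.1 + z.2 * v.2)).
  by apply: is_derive_eq; rewrite /GRing.scale/=; ring.
have dB : is_derive (0 : R) 1 B (2 * ((z.1 - p.1) * v.1 + (z.2 - p.2) * v.2)).
  by apply: is_derive_eq; rewrite /GRing.scale/=; ring.
have B0 : B 0 = (z.1 - p.1) ^+ 2 + (z.2 - p.2) ^+ 2 by rewrite /B !mul0r !addr0.
have A0 : A 0 = 0 by rewrite /A !mul0r !addr0 z1 subrr.
have dB' := is_derive_inv dB ltac:(by rewrite B0).
have dAB := is_deriveM dA dB'.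
have E : (fun t => (disc_chart (z + t *: v)).2) = A * (fun t => (B t)^-1).
  by apply/funext => t; rewrite disc_chartE.
rewrite E in dz; have [_ <-] := dz; have [_ ->] := dAB.
by rewrite A0 scale0r add0r /GRing.scale/= B0 mulrC.
Qed.

End Rotation.

Lemma circle_avoid (z : R * R) : exists2 p : R * R, p.1 ^+ 2 + p.2 ^+ 2 = 1 & z != p.
Proof.
have [->|zp] := eqVneq z (1, 0); last by exists (1, 0) => //=; ring.
by exists (-1, 0); [rewrite /=; ring|apply/eqP => -[]; lra].
Qed.

Lemma disc_smooth : smooth_domain disc.
Proof.
move=> z _; have [p p1 zp] := circle_avoid z.
by exists [set w | w != p], (disc_chart p); split=> //; exact: disc_chartP.
Qed.

Lemma circle_antipode (z : R * R) : z.1 ^+ 2 + z.2 ^+ 2 = 1 ->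
  (- z).1 ^+ 2 + (- z).2 ^+ 2 = 1 /\ z != - z.
Proof.
move=> z1; split; first by rewrite /= !sqrrN.
apply/eqP => zz; have : z.1 = - z.1 /\ z.2 = - z.2 by split; rewrite {1}zz.
move=> [h1 h2]; have x0 : z.1 = 0 by lra.
have y0 : z.2 = 0 by lra.
by move: z1; rewrite x0 y0 expr0n/= addr0 => /eqP; rewrite eq_sym oner_eq0.
Qed.

Lemma disc_boundary z : boundary disc z <-> z.1 ^+ 2 + z.2 ^+ 2 = 1.
Proof.
have [p p1 zp] := circle_avoid z.
have h2 := boundary_chart (disc_chartP p1) zp; rewrite h2 disc_chartE//=.
have D : (z.1 - p.1) ^+ 2 + (z.2 - p.2) ^+ 2 != 0.
  by have := punctured_den zp; rewrite -!expr2 => /lt0r_neq0.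
split=> [/eqP|->]; last by rewrite subrr mul0r.
by rewrite mulf_eq0 invr_eq0 (negPf D) orbF subr_eq0 => /eqP.
Qed.

Lemma disc_tangent z v : z.1 ^+ 2 + z.2 ^+ 2 = 1 ->
  tangent_to_boundary disc z v <-> z.1 * v.1 + z.2 * v.2 = 0.
Proof.
move=> z1; have [p1 zp] := circle_antipode z1.
have hz : (disc_chart (- z) z).2 = 0 by rewrite disc_chartE// z1 subrr mul0r.
have := tangent_chart v (disc_chartP p1) zp hz => h; rewrite h.
have D : 0 < (z.1 - (- z).1) ^+ 2 + (z.2 - (- z).2) ^+ 2.
  by have := punctured_den zp; rewrite -!expr2.
rewrite dsnd_disc_chart//; split=> [/eqP|->]; last by rewrite mulr0 mul0r.
rewrite mulf_eq0 invr_eq0 (gt_eqF D) orbF mulf_eq0 oppr_eq0 pnatr_eq0/= => /eqP.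
by [].
Qed.

End DiscCharts.

(** * The canonical field on the unit disc *)

(** The points of [K] at distance at least [e] from [f x] form a compact set whose image under [G]
    is closed and misses [G x]; for [y] near [x] the value [G (f y) = G y] avoids that image. *)
Lemma continuous_of_invariant (R : realType) (A K : set (R * R)) (G : R * R -> R) f :
  compact K -> continuous G -> (forall q q', K q -> K q' -> G q = G q' -> q = q') ->
  (forall z, A z -> K (f z) /\ G (f z) = G z) -> {within A, continuous f}.
Proof.
move=> cK cG injG hf; apply/continuous_withinP => x Ax e e0.
pose B := K `&` [set q | e <= `|q - f x|].
have cB : compact B.
  apply: compact_closedI => //.
  apply: (@closed_comp _ _ (fun q : R * R => `|q - f x|) [set t | e <= t]); last exact: closed_ge.
  by move=> q _; apply: cvg_norm; apply: cvgB; [exact: cvg_id|exact: cvg_cst].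
have : open (~` (G @` B)).
  apply: closed_openC; apply: compact_closed; first exact: Rhausdorff.
  by apply: continuous_compact => //; exact: continuous_subspaceT.
have [Kx GE] := hf x Ax.
have nB : ~ (G @` B) (G x).
  move=> [q [Kq eq] Gq]; have qE : q = f x by apply: injG => //; rewrite Gq GE.
  by move: eq; rewrite qE/= subrr normr0; lra.
move=> oB; have : nbhs (G x) (~` (G @` B)) by apply: open_nbhs_nbhs; split.
move=> /nbhs_distP[d d0 hd]; have /continuous_atP/(_ _ d0)[d' d'0 hd'] := cG x.
exists d' => // y Ay yx; have [Ky GEy] := hf y Ay.
rewrite ltNge; apply/negP => far; apply: (hd (G y)); first exact: hd'.
by exists (f y).
Qed.

Section DiscInvariant.
Variable R : realType.
Implicit Types z q : R * R.

(** On the upper half circle it is the exponential of [canonical_integral]; the sign makes it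
    distinguish the two half circles, and gives 0 on the axis whatever [ln 0] and division by 0
    return. *)
Definition disc_invariant (k1 k2 : R) z : R :=
  Num.sg z.2 * expR (- k1 * ln `|z.2| + k2 * atan (z.1 / z.2)).

(** Reflection in the [x] axis turns the parameter [k2] into [- k2], so arguments may be restricted
    to the upper half-plane. *)
Lemma disc_invariant_reflect (k1 k2 : R) z :
  disc_invariant k1 (- k2) (z.1, - z.2) = - disc_invariant k1 k2 z.
Proof.
have aN : atan (z.1 / - z.2) = - atan (z.1 / z.2) by rewrite invrN mulrN atanN.
by rewrite /disc_invariant/= sgrN normrN aN mulrNN mulNr.
Qed.

Lemma disc_invariant_continuous (k1 k2 : R) : k1 < 0 -> continuous (disc_invariant k1 k2).
Proof.
move=> k10 z; have c1 : {for z, continuous (fun w : R * R => w.1)} by exact: cvg_fst_comp.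
have c2 : {for z, continuous (fun w : R * R => w.2)} by exact: cvg_snd_comp.
have [z0|z0] := eqVneq z.2 0.
  apply/continuous_atP => e e0; pose C := `|k2| * (pi / 2).
  (* Chosen so that [d] to the power [- k1] times [expR C] is [e]. The jump of the arctangent across
     the axis is bounded, hence harmless, as [- k1 > 0]. *)
  pose d := expR (ln (e * expR (- C)) / - k1).
  exists d => [|w wz]; first exact: expR_gt0.
  have G0 : disc_invariant k1 k2 z = 0 by rewrite /disc_invariant z0 sgr0 mul0r.
  rewrite G0 subr0 /disc_invariant normrM (gtr0_norm (expR_gt0 _)).
  have [w0|w0] := eqVneq w.2 0; first by rewrite w0 sgr0 normr0 mul0r.
  rewrite normr_sg w0 mul1r expRD.
  have wd : `|w.2| < d by move: wz; rewrite sup_normE gt_max/= z0 subr0 => /andP[].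
  have w_gt0 : 0 < `|w.2| by rewrite normr_gt0.
  have h1 : expR (- k1 * ln `|w.2|) < e * expR (- C).
    have eC : 0 < e * expR (- C) by rewrite mulr_gt0// expR_gt0.
    rewrite -[ltRHS]lnK//.
    rewrite ltr_expR mulrC -ltr_pdivlMr ?oppr_gt0//.
    by rewrite -ltr_expR lnK.
  have h2 : expR (k2 * atan (w.1 / w.2)) <= expR C.
    rewrite ler_expR (le_trans (ler_norm _))// normrM ler_wpM2l// ler_norml.
    exact: atan_bound.
  have : expR (- k1 * ln `|w.2|) * expR (k2 * atan (w.1 / w.2)) < e * expR (- C) * expR C.
    by rewrite (le_lt_trans (ler_wpM2l (expR_ge0 _) h2))// ltr_pM2r ?expR_gt0.
  have EC : expR (- C) * expR C = 1 by rewrite -expRD addNr expR0.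
  by rewrite -[ltRHS]mulrA EC mulr1.
have cE : {for z, continuous (fun w : R * R => expR (- k1 * ln `|w.2| + k2 * atan (w.1 / w.2)))}.
  apply: (continuous_comp (f := fun w : R * R => - k1 * ln `|w.2| + k2 * atan (w.1 / w.2)) (g := expR)).
    apply: cvgD; apply: cvgM; try exact: cvg_cst.
      apply: (continuous_comp (f := fun w : R * R => `|w.2|) (g := @ln R)).
        exact: cvg_norm.
      by apply: continuous_ln; rewrite normr_gt0.
    apply: (continuous_comp (f := fun w : R * R => w.1 / w.2) (g := @atan R)).
      by apply: cvgM => //; exact: cvgV.
    exact: continuous_atan.
  exact: continuous_expR.
have near_sg : \forall w \near z, Num.sg w.2 = Num.sg z.2.
  have y0 : 0 < `|z.2| by rewrite normr_gt0.
  have /continuous_atP/(_ _ y0)[d d0 hd] := c2.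
  apply/nbhs_distP; exists d => // w /hd; rewrite ltr_norml.
  have [zn|zp|ze] := ltrgt0P z.2; last by rewrite ze eqxx in z0.
    by move=> h; rewrite !gtr0_sg//; lra.
  by move=> h; rewrite !ltr0_sg//; lra.
have cM : {for z, continuous (fun w : R * R => Num.sg z.2 * expR (- k1 * ln `|w.2| + k2 * atan (w.1 / w.2)))}.
  by apply: cvgM => //; exact: cvg_cst.
apply: cvg_trans cM; apply: near_eq_cvg.
by apply: filterS near_sg => w; rewrite /disc_invariant => ->.
Qed.

(** On the upper half circle, with [u = x / y], the logarithm of the invariant is [l u], whose
    derivative is [(k1 * u + k2) / (1 + u ^+ 2)]; the exit arc is where the numerator is
    nonnegative, so [l] is strictly increasing there, and [u] determines the point. *)
Lemma disc_invariant_inj (k1 k2 : R) z q : k1 < 0 ->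
  z.1 ^+ 2 + z.2 ^+ 2 = 1 -> 0 <= k1 * z.1 + k2 * z.2 ->
  q.1 ^+ 2 + q.2 ^+ 2 = 1 -> 0 <= k1 * q.1 + k2 * q.2 ->
  disc_invariant k1 k2 z = disc_invariant k1 k2 q -> z = q.
Proof.
wlog : k2 z q / 0 <= z.2 => [wl|z0] k10.
  have [/wl|zn] := leP 0 z.2; first exact.
  move=> z1 mz q1 mq G; have := wl (- k2) (z.1, - z.2) (q.1, - q.2).
  rewrite /= !sqrrN !mulrNN !disc_invariant_reflect G => h.
  have [] : (z.1, - z.2) = (q.1, - q.2) by apply: h => //; lra.
  by move=> h1 /oppr_inj h2; rewrite [z]surjective_pairing h1 h2 -surjective_pairing.
move=> z1 mz q1 mq G.
have sgE : Num.sg z.2 = Num.sg q.2.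
  move: G => /(congr1 Num.sg); rewrite /disc_invariant !sgrM !(gtr0_sg (expR_gt0 _)) !mulr1.
  by rewrite !sgr_id.
have [y0|y0] := eqVneq z.2 0.
  have q0 : q.2 = 0 by apply/eqP; rewrite -sgr_eq0 -sgE y0 sgr0.
  have west (w : R * R) : w.2 = 0 -> w.1 ^+ 2 + w.2 ^+ 2 = 1 -> 0 <= k1 * w.1 + k2 * w.2 -> w.1 = -1.
    move=> w0; rewrite w0 expr0n/= mulr0 !addr0 nmulr_rge0// => w1 wn.
    have wE : (w.1 + 1) * (w.1 - 1) = w.1 ^+ 2 - 1 by ring.
    have /eqP : (w.1 + 1) * (w.1 - 1) = 0 by rewrite wE w1 subrr.
    by rewrite mulf_eq0 => /orP[/eqP|/eqP]; lra.
  by rewrite [z]surjective_pairing [q]surjective_pairing y0 q0 (west z)// (west q).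
have zp : 0 < z.2 by rewrite lt0r y0.
have qp : 0 < q.2 by rewrite -sgr_gt0 -sgE sgr_gt0.
pose l u := k1 / 2 * ln (1 + u ^+ 2) + k2 * atan u.
have lE (w : R * R) : 0 < w.2 -> w.1 ^+ 2 + w.2 ^+ 2 = 1 ->
    disc_invariant k1 k2 w = expR (l (w.1 / w.2)) /\ w.2 ^+ 2 * (1 + (w.1 / w.2) ^+ 2) = 1.
  move=> w0 w1; have uE : w.2 ^+ 2 * (1 + (w.1 / w.2) ^+ 2) = 1.
    by rewrite -[RHS]w1; field; exact: lt0r_neq0.
  have u0 : 0 < 1 + (w.1 / w.2) ^+ 2 by rewrite ltr_wpDr ?sqr_ge0.
  have lnU : ln (1 + (w.1 / w.2) ^+ 2) = - 2 * ln w.2.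
    have := congr1 (@ln R) uE; rewrite lnM ?posrE ?exprn_gt0// ln1 lnXn// mulr2n; lra.
  split=> //; have lnE : - k1 * ln w.2 = k1 / 2 * ln (1 + (w.1 / w.2) ^+ 2).
    by rewrite lnU; field.
  by rewrite /disc_invariant (gtr0_sg w0) mul1r (gtr0_norm w0) lnE.
have [Gz uz] := lE z zp z1; have [Gq uq] := lE q qp q1.
have dl (u : R) : is_derive u 1 l ((k1 * u + k2) / (1 + u ^+ 2)).
  have u0 : 0 < 1 + u ^+ 2 by rewrite ltr_wpDr ?sqr_ge0.
  have d1 : is_derive u 1 (fun u : R => 1 + u ^+ 2) (2 * u).
    by apply: is_derive_eq; rewrite /GRing.scale/=; ring.
  have d2 := is_derive_ln d1 u0; have d3 := is_derive_atan (is_derive_id u 1).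
  apply: is_derive_eq; rewrite /GRing.scale/=; field; exact: lt0r_neq0.
have l_incr (u v : R) : u < v -> 0 <= k1 * v + k2 -> l u < l v.
  move=> uv vk; apply: (derive_gt uv (fun t _ => dl t)) => t /andP[_ tv].
  apply: divr_gt0; last by rewrite ltr_wpDr ?sqr_ge0.
  have : k1 * v < k1 * t by rewrite ltr_nM2l.
  lra.
have mk (w : R * R) : 0 < w.2 -> 0 <= k1 * w.1 + k2 * w.2 -> 0 <= k1 * (w.1 / w.2) + k2.
  move=> w0 mw; have -> : k1 * (w.1 / w.2) + k2 = (k1 * w.1 + k2 * w.2) / w.2.
    by field; exact: lt0r_neq0.
  by rewrite divr_ge0// ltW.
have ll : l (z.1 / z.2) = l (q.1 / q.2) by apply: expR_inj; rewrite -Gz -Gq.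
have uu : z.1 / z.2 = q.1 / q.2.
  have [lt|lt|//] := ltgtP (z.1 / z.2) (q.1 / q.2).
    by have := l_incr _ _ lt (mk q qp mq); rewrite ll ltxx.
  by have := l_incr _ _ lt (mk z zp mz); rewrite ll ltxx.
have yy : z.2 = q.2.
  have u0 : 1 + (q.1 / q.2) ^+ 2 != 0 by rewrite lt0r_neq0// ltr_wpDr ?sqr_ge0.
  have : z.2 ^+ 2 = q.2 ^+ 2 by apply: (mulIf u0); rewrite uq -uu uz.
  by move=> /eqP; rewrite eqrXn2 ?ltW// => /eqP.
rewrite [z]surjective_pairing [q]surjective_pairing yy; congr pair.
by rewrite -[z.1](divfK y0) uu yy divfK// -yy.
Qed.

End DiscInvariant.

Section CanonicalDisc.
Variables (R : realType) (k1 k2 : R).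
Local Notation X := (quadratic_field k1 k2 (-1) 0 (k1 + 1) k2).
Implicit Types p q z : R * R.

Let lipX : locally_lipschitz X := quadratic_field_lipschitz _ _ _ _ _ _.
Let solX : locally_solvable X := quadratic_field_solvable _ _ _ _ _ _.

Definition radius2 z := z.1 ^+ 2 + z.2 ^+ 2.
Definition radial_rate z := k1 * z.1 + k2 * z.2.

Lemma radius2_continuous : continuous radius2.
Proof.
move=> z; have c1 : {for z, continuous (fun w : R * R => w.1)} by exact: cvg_fst_comp.
have c2 : {for z, continuous (fun w : R * R => w.2)} by exact: cvg_snd_comp.
by apply: cvgD; rewrite expr2; exact: cvgM.
Qed.

Lemma radius2_derive p t : dom X p t ->
  is_derive t 1 (fun s => radius2 (phi X p s))
    (2 * radius2 (phi X p t) * radial_rate (phi X p t)).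
Proof.
move=> dt; have h1 := phi_derive1 dt; have h2 := phi_derive2 dt.
rewrite /radius2 /radial_rate; apply: is_derive_eq; rewrite /quadratic_field /GRing.scale/=; ring.
Qed.

Lemma radial_rate_derive p t : dom X p t ->
  is_derive t 1 (fun s => radial_rate (phi X p s))
    (radial_rate (phi X p t) ^+ 2 +
     (phi X p t).2 * (k2 * (phi X p t).1 - k1 * (phi X p t).2)).
Proof.
move=> dt; have h1 := phi_derive1 dt; have h2 := phi_derive2 dt.
rewrite /radial_rate; apply: is_derive_eq; rewrite /quadratic_field /GRing.scale/=; ring.
Qed.

Lemma radius2_phi_continuous p t : dom X p t ->
  {for t, continuous (fun s => radius2 (phi X p s))}.
Proof. by move=> /radius2_derive h; exact: is_derive_continuous h. Qed.

Lemma phi_dom_near p : exists2 e : R, 0 < e & forall t, `|t| < e -> dom X p t.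
Proof.
have /nbhs_distP[e e0 he] := dom_near (dom0 solX p).
by exists e => // t te; apply: he; rewrite subr0.
Qed.

(** Multiplying [r ^+ 2 - 1] by the radial rate at [p] makes its derivative twice a nonzero square,
    which treats both signs at once. *)
Lemma circle_radial_sign p : radius2 p = 1 -> radial_rate p != 0 ->
  exists2 e : R, 0 < e & forall t, 0 < t < e -> [/\ dom X p t, dom X p (- t),
    0 < radial_rate p * (radius2 (phi X p t) - 1) &
    radial_rate p * (radius2 (phi X p (- t)) - 1) < 0].
Proof.
move=> p1 m0; have [e e0 he] := phi_dom_near p.
have d : is_derive (0 : R) 1 (fun s => radial_rate p * (radius2 (phi X p s) - 1))
    (2 * radial_rate p ^+ 2).
  have d1 := radius2_derive (dom0 solX p); rewrite phi0// p1 mulr1 in d1.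
  by apply: is_derive_eq; rewrite /GRing.scale/=; ring.
have [||e' e'0 h] := derive_gt0_sign d; first by rewrite phi0// p1 subrr mulr0.
  by rewrite mulr_gt0// lt0r sqr_ge0 sqrf_eq0 m0.
have [m [m0' m1 m2]] := pos_lt2 e0 e'0.
exists m => // t tm; have [h1 h2] := h t ltac:(lra).
rewrite add0r in h1; rewrite sub0r in h2; split=> //; apply: he; rewrite ?normrN gtr0_norm; lra.
Qed.

Hypothesis k10 : k1 < 0.

(** Where the radial rate vanishes its derivative [curv] is positive: times [k1] it is
    [- (k1 ^+ 2 + k2 ^+ 2) * y ^+ 2], and [y = 0] would also force [x = 0]. So the radius decreases
    before and increases after: the tangency is external. *)
Lemma circle_tangent_outside p : radius2 p = 1 -> radial_rate p = 0 ->
  exists2 e : R, 0 < e & forall t, 0 < `|t| < e -> dom X p t /\ 1 < radius2 (phi X p t).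
Proof.
move=> p1 m0; have [e e0 he] := phi_dom_near p.
have curv : 0 < p.2 * (k2 * p.1 - k1 * p.2).
  have xE : k1 * p.1 = - (k2 * p.2) by move: m0; rewrite /radial_rate; lra.
  have y0 : p.2 != 0.
    apply/eqP => y0; move: xE; rewrite y0 mulr0 oppr0 => /eqP.
    rewrite mulf_eq0 (lt_eqF k10)/= => /eqP x0.
    by move: p1; rewrite /radius2 x0 y0 expr0n/= addr0 => /eqP; rewrite eq_sym oner_eq0.
  rewrite -(nmulr_rlt0 _ k10).
  have -> : k1 * (p.2 * (k2 * p.1 - k1 * p.2)) = - ((k1 ^+ 2 + k2 ^+ 2) * p.2 ^+ 2).
    have -> : k1 * (p.2 * (k2 * p.1 - k1 * p.2)) = p.2 * (k2 * (k1 * p.1) - k1 ^+ 2 * p.2) by ring.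
    by rewrite xE; ring.
  rewrite oppr_lt0 mulr_gt0//; first by rewrite ltr_wpDr ?sqr_ge0// lt0r sqr_ge0 sqrf_eq0 lt_eqF.
  by rewrite lt0r sqr_ge0 sqrf_eq0 y0.
have d : is_derive (0 : R) 1 (fun s => radial_rate (phi X p s)) (p.2 * (k2 * p.1 - k1 * p.2)).
  by have := radial_rate_derive (dom0 solX p); rewrite phi0// m0 expr0n/= add0r.
have [|e' e'0 h] := derive_gt0_sign d _ curv; first by rewrite phi0.
have := radius2_phi_continuous (dom0 solX p); rewrite /= => cr.
have /continuous_atP/(_ _ ltr01)[e2 e20 h2] := cr.
have [m' [m'0 m1 m2]] := pos_lt2 e0 e'0.
have [m [m0' m3 m4]] := pos_lt2 m'0 e20.
have rpos s : `|s| < m -> 0 < radius2 (phi X p s).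
  move=> sm; have : `|s - 0| < e2 by rewrite subr0; lra.
  by move=> /h2; rewrite phi0// p1 ltr_norml; lra.
have dd s : `|s| < m -> dom X p s by move=> sm; apply: he; lra.
exists m => // t /andP[t0 tm]; split; first exact: dd.
have [tp|tn|te] := ltgtP 0 t; last by rewrite -te normr0 ltxx in t0.
- have tt : `|t| = t by rewrite gtr0_norm.
  have sb s : 0 <= s <= t -> `|s| < m by move=> st; rewrite ger0_norm; lra.
  have := @derive_gt R (fun s => radius2 (phi X p s)) _ 0 t tp (fun s st => radius2_derive (dd s (sb s st))).
  rewrite phi0// p1; apply=> s st; have rs := rpos s (sb s ltac:(lra)); apply: mulr_gt0; first by rewrite mulr_gt0.
  by have [] := h s ltac:(lra); rewrite add0r.
- have tt : `|t| = - t by rewrite ltr0_norm.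
  have sb s : t <= s <= 0 -> `|s| < m by move=> st; rewrite ler0_norm; lra.
  have := @derive_lt R (fun s => radius2 (phi X p s)) _ t 0 tn (fun s st => radius2_derive (dd s (sb s st))).
  rewrite phi0// p1; apply=> s st; have rs := rpos s (sb s ltac:(lra)); rewrite pmulr_rlt0 ?mulr_gt0//.
  by have [_] := h (- s) ltac:(lra); rewrite sub0r opprK.
Qed.

Lemma disc_entryP p : entry_set X (@disc R) p <-> radius2 p = 1 /\ radial_rate p <= 0.
Proof.
rewrite /entry_set/= disc_boundary -/(radius2 p); split=> [[p1 [t t0 H]]|[p1 mp]]; split=> //.
  rewrite leNgt; apply/negP => m0.
  have [|e e0 h] := circle_radial_sign p1; first by rewrite gt_eqF.
  have [s [s0 st se]] := pos_lt2 t0 e0.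
  have [_ ds _] := h s ltac:(lra); rewrite pmulr_rlt0// subr_lt0 => lt1.
  by apply: (H (- s) _ _ (dom_flow lipX ds)); [lra|exact: ltW].
have [m0|m0] := eqVneq (radial_rate p) 0.
  have [e e0 h] := circle_tangent_outside p1 m0; exists e => // s q se fq.
  have [|_] := h s; first by rewrite ltr0_norm; lra.
  by rewrite (phiE lipX fq) ltNge => /negP.
have [e e0 h] := circle_radial_sign p1 m0; exists e => // s q se fq.
have [_ _ _] := h (- s) ltac:(lra); rewrite opprK (phiE lipX fq).
have mn : radial_rate p < 0 by rewrite lt_neqAle m0.
by rewrite nmulr_rlt0// subr_gt0 ltNge => /negP.
Qed.

Lemma disc_exitP p : exit_set X (@disc R) p <-> radius2 p = 1 /\ 0 <= radial_rate p.
Proof.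
rewrite /exit_set/= disc_boundary -/(radius2 p); split=> [[p1 [t t0 H]]|[p1 mp]]; split=> //.
  rewrite leNgt; apply/negP => m0.
  have [|e e0 h] := circle_radial_sign p1; first by rewrite lt_eqF.
  have [s [s0 st se]] := pos_lt2 t0 e0.
  have [ds _ + _] := h s ltac:(lra); rewrite nmulr_rgt0// subr_lt0 => lt1.
  by apply: (H s _ _ (dom_flow lipX ds)); [lra|exact: ltW].
have [m0|m0] := eqVneq (radial_rate p) 0.
  have [e e0 h] := circle_tangent_outside p1 m0; exists e => // s q se fq.
  have [|_] := h s; first by rewrite gtr0_norm; lra.
  by rewrite (phiE lipX fq) ltNge => /negP.
have [e e0 h] := circle_radial_sign p1 m0; exists e => // s q se fq.
have [_ _ + _] := h s se; rewrite (phiE lipX fq).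
by rewrite pmulr_rgt0 ?subr_gt0 ?lt0r ?m0// ltNge => /negP.
Qed.

Lemma disc_tangencyP p : tangency_set X (@disc R) p <-> radius2 p = 1 /\ radial_rate p = 0.
Proof.
rewrite /tangency_set/= disc_boundary -/(radius2 p); split=> -[p1]; rewrite disc_tangent//.
  have -> : p.1 * (X p).1 + p.2 * (X p).2 = radius2 p * radial_rate p.
    by rewrite /quadratic_field /radius2 /radial_rate/=; ring.
  by rewrite p1 mul1r.
have -> : p.1 * (X p).1 + p.2 * (X p).2 = radius2 p * radial_rate p.
  by rewrite /quadratic_field /radius2 /radial_rate/=; ring.
by rewrite p1 mul1r.
Qed.

(** The tangency points are [p] and [- p]. In the chart with pole [- p] the first coordinate
    vanishes exactly on the line through both, which meets the rest of the circle only at [p]. *)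
Lemma disc_tangency_codim1 : codim1_in_boundary (@disc R) (tangency_set X (@disc R)).
Proof.
move=> p /disc_tangencyP[p1 mp]; have [np1 pN] := circle_antipode p1.
exists [set w | w != - p], (disc_chart (- p)); split=> //; first exact: disc_chartP.
move=> q qN; rewrite disc_tangencyP disc_boundary disc_chartE//= -/(radius2 q).
have D : (q.1 - - p.1) ^+ 2 + (q.2 - - p.2) ^+ 2 != 0.
  by have := punctured_den qN; rewrite -!expr2 => /lt0r_neq0.
have crossE : (- p.1 * q.2 - - p.2 * q.1) = p.2 * q.1 - p.1 * q.2 by ring.
rewrite crossE; split=> -[q1 h]; split=> //.
  have c0 : k1 * (p.2 * q.1 - p.1 * q.2) = 0.
    have -> : k1 * (p.2 * q.1 - p.1 * q.2) = p.2 * radial_rate q - q.2 * radial_rate p.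
      by rewrite /radial_rate; ring.
    by rewrite h mp !mulr0 subrr.
  move/eqP: c0; rewrite mulf_eq0 (lt_eqF k10)/= => /eqP ->.
  by rewrite mulr0 mul0r.
have c0 : p.2 * q.1 - p.1 * q.2 = 0.
  move/eqP: h; rewrite mulf_eq0 invr_eq0 (negPf D) orbF mulf_eq0 oppr_eq0 pnatr_eq0/=.
  by move=> /eqP.
have xE : p.2 * q.1 = p.1 * q.2 by lra.
have : radius2 p * radial_rate q = (p.1 * q.1 + p.2 * q.2) * radial_rate p +
   (p.2 * q.1 - p.1 * q.2) * (k1 * p.2 - k2 * p.1).
  by rewrite /radius2 /radial_rate; ring.
by rewrite p1 mul1r mp c0 mulr0 mul0r addr0.
Qed.

Lemma disc_exit_point p : radius2 p <= 1 ->
  (exists2 t : R, 0 <= t & dom X p t /\ ~ (@disc R) (phi X p t)) ->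
  exists2 T : R, dom X p T & exit_point X (@disc R) p (phi X p T) /\ exit_set X (@disc R) (phi X p T).
Proof.
move=> p1 [t t0 [dt nt]].
pose A := [set s | 0 <= s <= t /\ ~ (@disc R) (phi X p s)].
have infA : has_inf A by split; [exists t; split=> //; rewrite t0 lexx|exists 0 => s [] /andP[]].
set T := inf A.
have T0 : 0 <= T by apply: lb_le_inf; [case: infA|move=> s [] /andP[]].
have Tt : T <= t by apply: ge_inf; [case: infA|split=> //; rewrite t0 lexx].
have dd s : 0 <= s <= t -> dom X p s by move=> st; apply: (dom_between solX dt); rewrite st.
have dT : dom X p T by apply: dd; rewrite T0.
have before s : 0 <= s < T -> (@disc R) (phi X p s).
  move=> st; apply: contrapT => ns.
  have : T <= s by apply: ge_inf; [case: infA|split=> //; lra].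
  by lra.
have cT := radius2_phi_continuous dT.
have after e : 0 < e -> exists s, [/\ T <= s < T + e, dom X p s & ~ (@disc R) (phi X p s)].
  move=> e0; have [u [ut nu] uT] := inf_adherent e0 infA.
  exists u; split=> //; last exact: dd.
  by rewrite uT andbT; apply: ge_inf; [case: infA|split].
have rT1 : radius2 (phi X p T) <= 1.
  have [T0'|Tn] := eqVneq T 0; first by rewrite T0' phi0.
  have Tp : 0 < T by rewrite lt0r Tn.
  rewrite leNgt; apply/negP; rewrite -subr_gt0 => far.
  have /continuous_atP/(_ _ far)[d d0 hd] := cT.
  have [m [m0 m1 m2]] := pos_lt2 d0 Tp.
  have : `|T - m - T| < d by rewrite ltr_norml; lra.
  move=> /hd; have := before (T - m) ltac:(lra); rewrite /disc/= -/(radius2 _) ltr_norml; lra.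
have rT : radius2 (phi X p T) = 1.
  apply/eqP; rewrite eq_le rT1/= leNgt; apply/negP; rewrite -subr_gt0 => far.
  have /continuous_atP/(_ _ far)[d d0 hd] := cT.
  have [s [sT ds ns]] := after d d0; apply: ns; rewrite /disc/= -/(radius2 _).
  have : `|s - T| < d by rewrite ltr_norml; lra.
  by move=> /hd; rewrite ltr_norml; lra.
have strict e : 0 < e -> exists s, [/\ T < s < T + e, dom X p s & ~ (@disc R) (phi X p s)].
  move=> e0; have [s [sT ds ns]] := after e e0; exists s; split=> //.
  have [sE|sn] := eqVneq s T; last by rewrite lt_neqAle eq_sym sn.
  by exfalso; apply: ns; rewrite sE /disc/= -/(radius2 _) rT.
exists T => //; split.
  exists T; split=> //; first exact: dom_flow.
    move=> s r sT fr; rewrite -(phiE lipX fr).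
    by have [->|sn] := eqVneq s T; [rewrite /disc/= -/(radius2 _) rT|apply: before; rewrite lt_neqAle sn; lra].
  move=> e /strict[s [sT ds ns]]; exists s, (phi X p s); split=> //; exact: dom_flow.
apply/disc_exitP; split=> //; rewrite leNgt; apply/negP => m0.
have [|e e0 h] := circle_radial_sign rT; first by rewrite lt_eqF.
have [s [sT ds ns]] := strict e e0.
have [dsT _ + _] := h (s - T) ltac:(lra); have [_ <-] := phiD lipX dT dsT.
by rewrite [T + _]addrC subrK nmulr_rgt0// subr_lt0 => lt1; apply: ns; exact: ltW.
Qed.

End CanonicalDisc.

Section CanonicalReflection.
Variables (R : realType) (k1 k2 : R).
Implicit Types p q z : R * R.
Local Notation field k := (quadratic_field k1 k (-1) 0 (k1 + 1) k).

Lemma canonical_reflect_flow p t q :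
  flow (field k2) p t q -> flow (field (- k2)) (p.1, - p.2) t (q.1, - q.2).
Proof.
pose T : {linear (R * R)%type -> (R * R)%type} := plane_map (1 : R) 0 0 (-1).
have TE (z : R * R) : T z = (z.1, - z.2) by rewrite /T/= /plane_map; congr pair; ring.
have TT : cancel T T by move=> z; rewrite !TE/= opprK -surjective_pairing.
move=> /(push_flow TT); rewrite !TE; congr flow.
apply/funext => z; rewrite /push_field !TE /quadratic_field/=; congr pair; ring.
Qed.

End CanonicalReflection.

Section CanonicalLeaves.
Variables (R : realType) (k1 : R).
Hypothesis k10 : k1 < 0.
Implicit Types (k : R) (p q z : R * R).
Local Notation field k := (quadratic_field k1 k (-1) 0 (k1 + 1) k).

Let lipX k : locally_lipschitz (field k) := quadratic_field_lipschitz _ _ _ _ _ _.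
Let solX k : locally_solvable (field k) := quadratic_field_solvable _ _ _ _ _ _.

Lemma canonical_integralE k z : 0 < z.2 -> canonical_integral k1 k z =
  ln (radius2 z) / 2 + k1 / 2 * ln (1 + (z.1 / z.2) ^+ 2) + k * atan (z.1 / z.2).
Proof.
move=> z0; rewrite /canonical_integral -/(radius2 z).
have r0 : 0 < radius2 z by rewrite ltr_wpDl ?sqr_ge0// exprn_gt0.
have -> : 1 + (z.1 / z.2) ^+ 2 = radius2 z / z.2 ^+ 2.
  by rewrite /radius2; field; exact: lt0r_neq0.
by rewrite ln_div ?posrE ?exprn_gt0// lnXn// mulr2n; field.
Qed.

Lemma disc_sup_norm q : radius2 q <= 1 -> `|q| <= 1.
Proof.
rewrite /radius2 => h; have h1 := sqr_ge0 q.1; have h2 := sqr_ge0 q.2.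
rewrite sup_normE ge_max -[`|q.1| <= 1]ler_sqr ?nnegrE// -[`|q.2| <= 1]ler_sqr ?nnegrE//.
by rewrite !real_normK ?num_real// expr1n; apply/andP; split; lra.
Qed.

(** If the orbit stayed in the disc, it would be complete forwards, and the integral would bound
    [r ^+ 2] below by [rho] and [u = x / y] below by [- E]. But [u' = - r ^+ 2 / y <= - rho], as
    [y <= 1], so [u] passes [- E] in finite time. *)
Lemma canonical_leaves_upper k p : 0 < p.2 -> radius2 p <= 1 ->
  exists2 t : R, 0 <= t & dom (field k) p t /\ ~ disc (phi (field k) p t).
Proof.
move=> p0 p1; apply: contrapT => no; set X := field k in no.
have lX : locally_lipschitz X := lipX k.
have sX : locally_solvable X := solX k.
have inD t : 0 <= t -> dom X p t -> radius2 (phi X p t) <= 1.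
  by move=> t0 dt; apply: contrapT => nd; apply: no; exists t.
have glob t : 0 <= t -> dom X p t.
  move=> t0; have := @dom_bounded _ _ lX sX false p 1 _ t t0.
  rewrite expr0 mul1r; apply => s q s0; rewrite mul1r => fq.
  apply: disc_sup_norm; have ds : dom X p s by exists q.
  by have := inD s s0 ds; rewrite (phiE lX fq).
pose c := canonical_integral k1 k p; pose C := `|k| * (pi / 2).
pose u t := (phi X p t).1 / (phi X p t).2.
have y0 t : 0 <= t -> 0 < (phi X p t).2.
  by move=> t0; apply: canonical_upper_half => //; exact: glob.
pose rho := expR (2 * (c - C)); have rho0 : 0 < rho := expR_gt0 _.
pose E := expR ((C - c) / (- k1 / 2)).
have bounds t : 0 <= t -> rho <= radius2 (phi X p t) /\ - E <= u t.
  move=> t0; have yt := y0 t t0; have rt := inD t t0 (glob t t0).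
  have r0 : 0 < radius2 (phi X p t) by rewrite ltr_wpDl ?sqr_ge0// exprn_gt0.
  have cE : c = canonical_integral k1 k (phi X p t).
    by rewrite canonical_integral_const//; exact: glob.
  rewrite canonical_integralE// -/(u t) in cE.
  have u1 : 1 <= 1 + u t ^+ 2 by rewrite lerDl sqr_ge0.
  have lnu0 : 0 <= ln (1 + u t ^+ 2) by rewrite ln_ge0.
  have kln : k1 / 2 * ln (1 + u t ^+ 2) <= 0 by apply: mulr_le0_ge0 => //; rewrite ler_pdivrMr// mul0r ltW.
  have lnr0 : ln (radius2 (phi X p t)) <= 0 by rewrite ln_le0.
  have ka : k * atan (u t) <= C.
    by rewrite (le_trans (ler_norm _))// normrM ler_wpM2l// ler_norml atan_bound.
  split.
    by rewrite /rho -[leRHS]lnK// ler_expR; lra.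
  have : 1 + u t ^+ 2 <= E.
    have kpos : 0 < - k1 / 2 by rewrite divr_gt0 ?oppr_gt0.
    rewrite /E -[leLHS]lnK ?posrE ?ltr_wpDr ?sqr_ge0// ler_expR ler_pdivlMr//.
    have -> : ln (1 + u t ^+ 2) * (- k1 / 2) = - (k1 / 2 * ln (1 + u t ^+ 2)) by ring.
    lra.
  (* From [1 + u ^+ 2 <= E] to [- E <= u] without a square root. *)
  by have := sqr_ge0 (u t + 1 / 2); rewrite sqrrD; lra.
have du (t : R) : 0 <= t -> is_derive t 1 u (- (radius2 (phi X p t) / (phi X p t).2)).
  move=> t0; have dt := glob t t0.
  have h1 := phi_derive1 dt; have h2 := phi_derive2 dt.
  have y_neq0 : (phi X p t).2 != 0 by rewrite gt_eqF// y0.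
  have h3 := is_derive_inv h2 y_neq0.
  rewrite /u; apply: is_derive_eq.
  by rewrite /GRing.scale/= /X /quadratic_field /radius2/=; field.
pose t := (`|u 0| + E + 1) / rho.
have E0 : 0 < E := expR_gt0 _.
have t0 : 0 <= t by rewrite divr_ge0 ?addr_ge0// ltW.
have := @derive_le_slope R u _ 0 t (- rho) t0 (fun s st => du s (proj1 (andP st))).
have tE : - rho * (t - 0) = - (`|u 0| + E + 1) by rewrite /t; field; exact: lt0r_neq0.
rewrite tE => h; have {}h : u t <= u 0 - (`|u 0| + E + 1).
  apply: h => s /andP[s0 _]; rewrite lerN2 ler_pdivlMr ?y0//.
  have [h1 _] := bounds s s0; apply: le_trans h1; rewrite ger_pMr//.
  have := disc_sup_norm (inD s s0 (glob s s0)); rewrite sup_normE ge_max => /andP[_].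
  by rewrite ler_norml => /andP[].
have [_ h2] := bounds t t0; have := ler_norm (u 0); lra.
Qed.

Lemma canonical_leaves k p : p.2 != 0 -> radius2 p <= 1 ->
  exists2 t : R, 0 <= t & dom (field k) p t /\ ~ disc (phi (field k) p t).
Proof.
move=> p0 p1; have [pn|pp|pe] := ltgtP p.2 0; last by rewrite pe eqxx in p0.
  have [||t t0 [dt nt]] := @canonical_leaves_upper (- k) (p.1, - p.2).
  - by rewrite oppr_gt0.
  - by rewrite /radius2 sqrrN.
  have := canonical_reflect_flow (dom_flow (lipX _) dt); rewrite opprK/= opprK -surjective_pairing => ft.
  exists t => //; split; first by eexists; exact: ft.
  by rewrite (phiE (lipX k) ft) /disc/= sqrrN.
exact: canonical_leaves_upper.
Qed.

Lemma disc_invariant_upper k p t : 0 < p.2 -> radius2 p = 1 ->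
  dom (field k) p t -> radius2 (phi (field k) p t) = 1 ->
  disc_invariant k1 k (phi (field k) p t) = disc_invariant k1 k p.
Proof.
move=> p0 p1 dt q1; have q0 := canonical_upper_half dt p0.
have := canonical_integral_const dt p0.
rewrite /canonical_integral -!/(radius2 _) q1 p1 ln1 mulr0 !sub0r => h.
by rewrite /disc_invariant !gtr0_sg// !gtr0_norm// !mulNr h.
Qed.

Lemma disc_invariant_const k p t q : p.2 != 0 -> radius2 p = 1 -> radius2 q = 1 ->
  flow (field k) p t q -> disc_invariant k1 k q = disc_invariant k1 k p.
Proof.
move=> p0 p1 q1 fq; have dt : dom (field k) p t by exists q.
have [pn|pp|pe] := ltgtP p.2 0; last by rewrite pe eqxx in p0.
  have fq' := canonical_reflect_flow fq; apply: oppr_inj.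
  rewrite -!disc_invariant_reflect -(phiE (lipX _) fq').
  apply: disc_invariant_upper; rewrite /radius2/= ?sqrrN ?oppr_gt0//.
    by eexists; exact: fq'.
  by rewrite (phiE (lipX _) fq')/= sqrrN.
by rewrite -(phiE (lipX _) fq) disc_invariant_upper// (phiE (lipX _) fq).
Qed.

End CanonicalLeaves.

Section CanonicalRegularisable.
Variables (R : realType) (k1 k2 : R).
Hypothesis k10 : k1 < 0.
Implicit Types p q z : R * R.
Local Notation X := (quadratic_field k1 k2 (-1) 0 (k1 + 1) k2).

Let lipX : locally_lipschitz X := quadratic_field_lipschitz _ _ _ _ _ _.
Let solX : locally_solvable X := quadratic_field_solvable _ _ _ _ _ _.

Lemma canonical_axis_flow (s t : R) : k1 * s * t < 1 ->
  flow X (s, 0) t (s / (1 - k1 * s * t), 0).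
Proof.
have sE (r : R) : r *: ((1, 0) : R * R) = (r, 0).
  by rewrite [LHS]surjective_pairing; congr pair; rewrite /= /GRing.scale/=; ring.
have Xe : X (1, 0) = k1 *: ((1, 0) : R * R).
  by rewrite sE /quadratic_field/=; congr pair; ring.
by move=> /(ray_flow Xe); rewrite !sE.
Qed.

Lemma disc_maximal_invariant : maximal_invariant X (@disc R) [set 0].
Proof.
split.
- by move=> _ ->; rewrite /disc/= expr0n/= addr0.
- move=> _ -> t; exists 0 => //.
  by have := @canonical_axis_flow 0 t; rewrite !mulr0 !mul0r; apply.
- move=> S SD iS p Sp; apply: contrapT => pn0.
  have pD : radius2 p <= 1 := SD p Sp.
  have [p0|p0] := eqVneq p.2 0; last first.
    have [t t0 [dt]] := canonical_leaves k10 k2 p0 pD; apply.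
    by have [q fq /SD] := iS p Sp t; rewrite (phiE lipX fq).
  have s0 : p.1 != 0.
    by apply/eqP => s0; apply: pn0; rewrite [p]surjective_pairing s0 p0.
  have ns0 : 0 < `|p.1| by rewrite normr_gt0.
  (* The time at which the orbit on the axis, forwards or backwards, is at distance 2 from the
     origin. *)
  pose t := (1 - `|p.1| / 2) / (k1 * p.1).
  have ksn : k1 * p.1 != 0 by rewrite mulf_neq0// lt_eqF.
  have kst : k1 * p.1 * t = 1 - `|p.1| / 2 by rewrite /t mulrC divfK.
  have [q fq Sq] := iS p Sp t.
  have := @canonical_axis_flow p.1 t; rewrite kst gtrBl divr_gt0// => /(_ erefl).
  rewrite -[in X in flow _ X]p0 -surjective_pairing => /(flow_unique lipX fq) qE.
  have := SD q Sq; rewrite qE /disc/= expr0n/= addr0 opprB addrCA subrr addr0.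
  have -> : (p.1 / (`|p.1| / 2)) ^+ 2 = 4.
    by rewrite expr_div_n -(real_normK (num_real p.1)); field; rewrite gt_eqF.
  lra.
Qed.

Lemma disc_isolating_block : isolating_block X [set 0] (@disc R).
Proof.
split.
- by split; [exact: disc_compact|exact: disc_smooth].
- exact: disc_maximal_invariant.
- apply/seteqP; split=> p.
    move=> [/(disc_entryP k2 k10)[p1 h1] /(disc_exitP k2 k10)[_ h2]].
    by apply/disc_tangencyP; split=> //; apply/eqP; rewrite eq_le h1.
  move=> /disc_tangencyP[p1 h]; split.
    by apply/disc_entryP => //; rewrite h.
  by apply/disc_exitP => //; rewrite h.
- exact: disc_tangency_codim1.
Qed.

Lemma axis_entry p : entry_set X (@disc R) p -> p.2 = 0 -> p = (1, 0).
Proof.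
move=> /(disc_entryP k2 k10)[+ +] p0; rewrite /radius2 /radial_rate p0 expr0n/= mulr0 !addr0.
move=> p1; rewrite nmulr_rle0// => pge.
have : (p.1 + 1) * (p.1 - 1) = 0.
  have -> : (p.1 + 1) * (p.1 - 1) = p.1 ^+ 2 - 1 by ring.
  by rewrite p1 subrr.
move=> /eqP; rewrite mulf_eq0 => /orP[/eqP h|/eqP h]; first by exfalso; lra.
by rewrite [p]surjective_pairing p0; congr pair; lra.
Qed.

Lemma axis_asymptotic p : entry_set X (@disc R) p -> p.2 = 0 ->
  forward_asymptotic X (@disc R) p.
Proof.
move=> ep p0; split=> // t t0; rewrite (axis_entry ep p0).
have kt : k1 * 1 * t <= 0 by rewrite mulr1 nmulr_rle0.
exists (1 / (1 - k1 * 1 * t), 0); first by apply: canonical_axis_flow; lra.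
have d1 : 1 <= 1 - k1 * 1 * t by lra.
rewrite /disc/= expr0n/= addr0 div1r expr_le1// ?invr_ge0 ?invf_le1//; lra.
Qed.

(** Rational parametrisation of the circle by the tangent [h] of the half angle. At [(1, 0)] the
    radial rate is [k1 < 0], and the bound on [h] keeps the contribution of [k2] from reversing this
    sign. *)
Lemma circle_entry_near_axis (d : R) : 0 < d -> exists z, [/\ radius2 z = 1,
  radial_rate k1 k2 z <= 0, z.2 != 0 & `|z - (1, 0)| < d].
Proof.
move=> d0.
have K0 : 0 < 8 * (`|k2| + 1) by rewrite mulr_gt0// ltr_wpDl.
have c0 : 0 < - (3 * k1) / (8 * (`|k2| + 1)).
  by rewrite divr_gt0// oppr_gt0 pmulr_rlt0.
have [d4 [d40 d4d d4c]] := pos_lt2 d0 c0.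
have [h [h0 hd h12]] := pos_lt2 (divr_gt0 d40 (ltr0n R 2)) (divr_gt0 (ltr01 : 0 < (1 : R)) (ltr0n R 2)).
pose D := 1 + h ^+ 2; have D1 : 1 < D by rewrite ltrDl exprn_gt0.
have D0 : 0 < D by lra.
pose z : R * R := ((1 - h ^+ 2) / D, 2 * h / D).
have z1 : radius2 z = 1 by rewrite /radius2 /z/= /D; field; exact: lt0r_neq0.
have hh : h ^+ 2 <= h / 2 by rewrite expr2; nra.
have mz : radial_rate k1 k2 z <= 0.
  have -> : radial_rate k1 k2 z = (k1 * (1 - h ^+ 2) + 2 * (k2 * h)) / D.
    by rewrite /radial_rate /z/= /D; field; exact: lt0r_neq0.
  rewrite ler_pdivrMr// mul0r.
  have b1 : k1 * (1 - h ^+ 2) <= k1 * (3 / 4) by rewrite ler_nM2l//; lra.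
  have b2 : k2 * h <= `|k2| * h by rewrite ler_wpM2r ?ler_norm// ltW.
  have b3 : h * (8 * (`|k2| + 1)) < - (3 * k1) by rewrite -ltr_pdivlMr//; lra.
  lra.
have z20 : z.2 != 0 by rewrite /z/= mulf_neq0 ?invr_eq0 ?gt_eqF// mulr_gt0.
exists z; split=> //.
have z1E : z.1 - 1 = - (2 * h ^+ 2) / D by rewrite /z/= /D; field; exact: lt0r_neq0.
have a1 : - (2 * h) <= z.1 - 1 <= 2 * h.
  by rewrite z1E ler_pdivlMr// ler_pdivrMr//; nra.
have a2 : - (2 * h) <= z.2 <= 2 * h by rewrite /z/= ler_pdivlMr// ler_pdivrMr//; nra.
have -> : z - (1, 0) = (z.1 - 1, z.2) by rewrite [LHS]surjective_pairing /= subr0.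
by apply: pair_norm_lt; lra.
Qed.

Lemma canonical_regularisable : C0_regularisable X.
Proof.
exists (@disc R); split; first exact: disc_isolating_block.
have /choice[f hf] : forall p, exists q, entry_set X (@disc R) p ->
    [/\ exit_set X (@disc R) q, disc_invariant k1 k2 q = disc_invariant k1 k2 p &
       p.2 != 0 -> exit_point X (@disc R) p q].
  move=> p; have [ep|nep] := pselect (entry_set X (@disc R) p); last by exists 0.
  have [p1 mp] := (disc_entryP k2 k10 p).1 ep.
  have [p0|p0] := eqVneq p.2 0.
    (* The exit point of the axis, where the invariant is 0 as it is at [(1, 0)]: the value dictated
       by continuity. *)
    exists (-1, 0) => _; split=> //.
      apply/disc_exitP => //; rewrite /radius2 /radial_rate/= sqrrN expr1n expr0n/= addr0.
      by rewrite mulr0 addr0 mulrN1 oppr_ge0 ltW.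
    by rewrite /disc_invariant p0 !sgr0 !mul0r.
  have pD : radius2 p <= 1 by rewrite p1.
  have [T dT [eT exT]] := disc_exit_point k10 pD (canonical_leaves k10 k2 p0 pD).
  exists (phi X p T) => _; split=> //.
  have [q1 _] := (disc_exitP k2 k10 _).1 exT.
  exact: (disc_invariant_const p0 p1 q1 (dom_flow lipX dT)).
have fext : continuous_extension X (@disc R) f.
  split.
  - by move=> p /hf[].
  - apply: (@continuous_of_invariant _ _ (exit_set X (@disc R)) (disc_invariant k1 k2)).
    + have -> : exit_set X (@disc R) =
          @disc R `&` (radius2 (R := R) @^-1` [set x | 1 <= x] `&` radial_rate k1 k2 @^-1` [set x | 0 <= x]).
        apply/seteqP; split=> [p /(disc_exitP k2 k10)[p1 mp]|p [pD [/= rp mp]]].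
          by rewrite /disc/= -/(radius2 p) p1 lexx.
        by apply/disc_exitP => //; split=> //; apply/eqP; rewrite eq_le rp andbT.
      apply: compact_closedI; first exact: disc_compact.
      apply: closedI; apply: closed_comp; try exact: closed_ge.
        by move=> z _; exact: radius2_continuous.
      by move=> z _; exact: lin_continuous.
    + exact: disc_invariant_continuous.
    + move=> q q' /(disc_exitP k2 k10)[q1 mq] /(disc_exitP k2 k10)[q1' mq'].
      exact: disc_invariant_inj.
    + by move=> z /hf[].
  - move=> p [ep np]; have [_ _] := hf p ep; apply.
    by apply/eqP => p0; apply: np; exact: axis_asymptotic.
exists f; split=> // g gext.
have off p : entry_set X (@disc R) p -> p.2 != 0 -> g p = f p.
  by move=> ep p0; have [_ _ /(_ p0)] := hf p ep; exact: (extension_exit_point lipX gext ep).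
move=> p ep; have [p0|] := eqVneq p.2 0; last exact: off.
have pE := axis_entry ep p0.
have [_ /continuous_withinP/(_ p ep) cf _] := fext.
have [_ /continuous_withinP/(_ p ep) cg _] := gext.
apply/eqP; rewrite -subr_eq0 -normr_le0 leNgt; apply/negP => e0.
have e2 : 0 < `|g p - f p| / 2 by rewrite divr_gt0.
have [d1 d10 h1] := cf _ e2; have [d2 d20 h2] := cg _ e2.
have [d3 [d30 d31 d32]] := pos_lt2 d10 d20.
have [z [z1 mz z20 zp]] := circle_entry_near_axis d30; rewrite -pE in zp.
have ez : entry_set X (@disc R) z by apply/disc_entryP.
have := h1 z ez (lt_trans zp d31); have := h2 z ez (lt_trans zp d32); rewrite (off z ez z20).
have := ler_distD (f z) (g p) (f p); rewrite [`|g p - f z|]distrC; lra.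
Qed.

End CanonicalRegularisable.

(** * Normal forms *)

Section LotkaVolterraCases.
Variable R : realType.
Implicit Types a d : R.

Lemma lv_swap_regularisable a d : C0_regularisable (lv_field a d) -> C0_regularisable (lv_field d a).
Proof.
pose T : {linear (R * R)%type -> (R * R)%type} := plane_map (0 : R) 1 1 0.
have TT : cancel T T by move=> [x y]; rewrite /T/= /plane_map/=; congr pair; ring.
move=> /(push_regularisable TT TT); have -> // : push_field T T (lv_field a d) = lv_field d a.
apply/funext => -[x y]; rewrite /push_field /lv_field /quadratic_field /T/= /plane_map/=.
by congr pair; ring.
Qed.

Lemma lv_shear_regularisable a d : C0_regularisable (lv_field a d) ->
  C0_regularisable (lv_field a (- (a + d + 1))).
Proof.
pose T : {linear (R * R)%type -> (R * R)%type} := plane_map (1 : R) (-1) 0 (-1).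
have TT : cancel T T by move=> [x y]; rewrite /T/= /plane_map/=; congr pair; ring.
move=> /(push_regularisable TT TT).
have -> // : push_field T T (lv_field a d) = lv_field a (- (a + d + 1)).
apply/funext => -[x y]; rewrite /push_field /lv_field /quadratic_field /T/= /plane_map/=.
by congr pair; ring.
Qed.

Lemma lv_same_sign a d : 0 < a * d -> a + d + 1 != 0 -> ~ C0_regularisable (lv_field a d).
Proof.
move=> ad ad1; have [a0|a0|a0] := ltgtP a 0; last by rewrite a0 mul0r ltxx in ad.
  have d0 : d < 0 by rewrite nmulr_rgt0 in ad.
  have [s0|s0|s0] := ltgtP (a + d + 1) 0; last by rewrite s0 eqxx in ad1.
  - exact: lv_attracting_sector.
  - exact: lv_two_sectors.
have d0 : 0 < d by rewrite pmulr_rgt0 in ad.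
by move=> [N [/(lv_elliptic a0 d0)]].
Qed.

(* [a], [d] and [- (a + d + 1)] are permuted by the linear symmetries of the family. *)
Lemma lv_not_regularisable a d : a != 0 -> d != 0 -> a + d + 1 != 0 ->
  ~ C0_regularisable (lv_field a d).
Proof.
move=> a0 d0 s0 reg; pose c := - (a + d + 1).
have c0 : c != 0 by rewrite oppr_eq0.
(* Two of [a], [d], [c] have the same sign. As the three add up to -1, one plus the sum of two of
   them is minus the third, hence nonzero. *)
have [ad|ad|/eqP] := ltgtP (a * d) 0; last by rewrite mulf_eq0 (negPf a0) (negPf d0).
  have [ac|ac|/eqP] := ltgtP (a * c) 0; last by rewrite mulf_eq0 (negPf a0) (negPf c0).
    apply: (@lv_same_sign d c _ _ _); last first.
    - have -> : c = - (d + a + 1) by rewrite /c; ring.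
      by apply: lv_shear_regularisable; exact: lv_swap_regularisable.
    - have -> : d + c + 1 = - a by rewrite /c; ring.
      by rewrite oppr_eq0.
    - have : 0 < (a * d) * (a * c) by rewrite nmulr_rgt0.
      have -> : (a * d) * (a * c) = a ^+ 2 * (d * c) by ring.
      by rewrite pmulr_rgt0// exprn_even_gt0.
  apply: (lv_same_sign ac); last exact: lv_shear_regularisable.
  have -> : a + c + 1 = - d by rewrite /c; ring.
  by rewrite oppr_eq0.
exact: (lv_same_sign ad).
Qed.

End LotkaVolterraCases.

Section NormalForms.
Variable R : realType.
Implicit Types (X : R * R -> R * R) (w v z : R * R).

(* The last clause says that the differential of the directional polynomial [F] does not vanish
   at its zeros, as [F (w + v) - F (w - v) = 2 dF_w v + 2 F v] for a cubic form [F]. *)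
Definition nondegenerate X := [/\
  exists p0 p1 p2 q0 q1 q2, X = quadratic_field p0 p1 p2 q0 q1 q2,
  forall z, z != 0 -> X z != 0 &
  forall w, w != 0 -> directional_polynomial X w = 0 ->
    exists v, directional_polynomial X (w + v) - directional_polynomial X (w - v) !=
      2 * directional_polynomial X v].

(** The directional polynomial at [z] is the determinant of [z] and [X z], so it is multiplied by
    the determinant of the map. *)
Lemma plane_map_det (a b c d a' b' c' d' : R) X z :
  cancel (plane_map a b c d) (plane_map a' b' c' d') ->
  directional_polynomial (push_field (plane_map a b c d) (plane_map a' b' c' d') X)
    (plane_map a b c d z) = (a * d - b * c) * directional_polynomial X z.
Proof.
move=> TK; rewrite /directional_polynomial /push_field /= TK /plane_map/=; ring.
Qed.

Lemma nondegenerate_push (a b c d a' b' c' d' : R) X :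
  cancel (plane_map a b c d) (plane_map a' b' c' d') ->
  cancel (plane_map a' b' c' d') (plane_map a b c d) -> a * d - b * c != 0 ->
  nondegenerate X -> nondegenerate (push_field (plane_map a b c d) (plane_map a' b' c' d') X).
Proof.
move=> TK T'K D [[p0 [p1 [p2 [q0 [q1 [q2 XE]]]]]] X0 Xs].
have T'0 z : z != 0 -> plane_map a' b' c' d' z != 0.
  by apply: contra => /eqP z0; rewrite -[z]T'K z0 linear0.
split.
- rewrite XE.
  exists (a * (p0 * a' ^+ 2 + p1 * a' * c' + p2 * c' ^+ 2) + b * (q0 * a' ^+ 2 + q1 * a' * c' + q2 * c' ^+ 2)).
  exists (a * (2 * p0 * a' * b' + p1 * (a' * d' + b' * c') + 2 * p2 * c' * d') +
          b * (2 * q0 * a' * b' + q1 * (a' * d' + b' * c') + 2 * q2 * c' * d')).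
  exists (a * (p0 * b' ^+ 2 + p1 * b' * d' + p2 * d' ^+ 2) + b * (q0 * b' ^+ 2 + q1 * b' * d' + q2 * d' ^+ 2)).
  exists (c * (p0 * a' ^+ 2 + p1 * a' * c' + p2 * c' ^+ 2) + d * (q0 * a' ^+ 2 + q1 * a' * c' + q2 * c' ^+ 2)).
  exists (c * (2 * p0 * a' * b' + p1 * (a' * d' + b' * c') + 2 * p2 * c' * d') +
          d * (2 * q0 * a' * b' + q1 * (a' * d' + b' * c') + 2 * q2 * c' * d')).
  exists (c * (p0 * b' ^+ 2 + p1 * b' * d' + p2 * d' ^+ 2) + d * (q0 * b' ^+ 2 + q1 * b' * d' + q2 * d' ^+ 2)).
  apply/funext => -[x y]; rewrite /push_field /quadratic_field/= /plane_map/=.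
  by congr pair; ring.
- move=> z /T'0/X0; apply: contra => /eqP Tz; rewrite -[X _]TK.
  by rewrite [plane_map a b c d _]Tz linear0.
- move=> w w0; rewrite -[w]T'K plane_map_det// => /eqP; rewrite mulf_eq0 (negPf D)/= => /eqP Fw.
  have [v hv] := Xs _ (T'0 w w0) Fw; exists (plane_map a b c d v).
  rewrite -linearD -linearB !plane_map_det// -mulrBr mulrCA.
  by apply: contra hv => /eqP/(mulfI D) ->.
Qed.

Lemma directional_polynomialE (p0 p1 p2 q0 q1 q2 x y : R) :
  directional_polynomial (quadratic_field p0 p1 p2 q0 q1 q2) (x, y) =
  q0 * x ^+ 3 + (q1 - p0) * x ^+ 2 * y + (q2 - p1) * x * y ^+ 2 - p2 * y ^+ 3.
Proof. rewrite /directional_polynomial /quadratic_field/=; ring. Qed.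

(** A cubic form takes opposite values at [(1, 0)] and [(-1, 0)]; the arc [z] joins them while
    avoiding the origin. *)
Lemma directional_root X : nondegenerate X -> exists2 w, w != 0 & directional_polynomial X w = 0.
Proof.
move=> [[p0 [p1 [p2 [q0 [q1 [q2 ->]]]]]] _ _].
pose z (t : R) : R * R := (1 - t, t * (2 - t)).
have z0 t : z t != 0.
  apply/eqP => -[h]; have -> : t = 1 by lra.
  by move=> h2; lra.
pose f t := directional_polynomial (quadratic_field p0 p1 p2 q0 q1 q2) (z t).
have fE t : f t = q0 * (1 - t) ^+ 3 + (q1 - p0) * (1 - t) ^+ 2 * (t * (2 - t)) +
    (q2 - p1) * (1 - t) * (t * (2 - t)) ^+ 2 - p2 * (t * (2 - t)) ^+ 3.
  exact: directional_polynomialE.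
have cf t : {for t, continuous f}.
  have -> : f = _ := funext fE.
  apply: differentiable_continuous; apply/derivable1_diffP; exact: ex_derive.
have f0 : f 0 = q0 by rewrite fE; ring.
have f2 : f 2 = - q0 by rewrite fE; ring.
have [q0n|q0p] := leP q0 0.
  have [|t _ ft] := @ivt_incr R f 0 2 0 (ler0n R 2) (fun t _ => cf t).
    by rewrite f0 f2 q0n oppr_ge0.
  by exists (z t).
have [|t _ ft] := @ivt_decr R f 0 2 0 (ler0n R 2) (fun t _ => cf t).
  by rewrite f0 f2 oppr_le0 (ltW q0p).
by exists (z t).
Qed.

Lemma class_V_nondegenerate X : class_V X -> nondegenerate X.
Proof.
move=> [[[f fE] [g gE]] [_ iso] simple].
have XE : X = quadratic_field (f 0%N) (f 1%N) (f 2%N) (g 0%N) (g 1%N) (g 2%N).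
  apply/funext => z; rewrite [LHS]surjective_pairing fE gE !big_ord_recr !big_ord0/=.
  by rewrite /quadratic_field; congr pair; ring.
split.
- by do 6 eexists; exact: XE.
- move=> z z0; apply/eqP => Xz.
  have /nbhs_distP[e e0 he] := iso.
  have nz : 0 < `|z| by rewrite normr_gt0.
  (* By homogeneity a zero of the field gives a whole line of zeros, which enters the neighbourhood
     where the origin is the only one. *)
  pose s := e / (2 * `|z|); have s0 : 0 < s by rewrite divr_gt0// mulr_gt0.
  have sz : s *: z = 0.
    apply: he; last by rewrite XE quadratic_fieldZ -XE Xz scaler0.
    rewrite subr0 normrZ gtr0_norm// /s.
    have -> : e / (2 * `|z|) * `|z| = e / 2 by field; rewrite gt_eqF.
    lra.
  by move/eqP: sz; rewrite scaler_eq0 gt_eqF// (negPf z0).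
- move=> w w0 Fw; have [_ [k [[c kE] kw FE]]] := simple w w0 Fw.
  (* The vector orthogonal to [w]. By the parallelogram identity for the quadratic cofactor, the
     difference is twice the squared length of [w] times the cofactor at [w]. *)
  exists (w.2, - w.1); rewrite !FE !kE !big_ord_recr !big_ord0/=.
  move: kw; rewrite kE !big_ord_recr !big_ord0/= => kw.
  rewrite -subr_eq0; set G := (X in X != 0) in kw.
  set Y := (X in X != 0).
  have -> : Y = 2 * (w.1 ^+ 2 + w.2 ^+ 2) * G by rewrite /Y /G; ring.
  rewrite mulf_neq0// mulf_neq0//; apply: contra w0 => /eqP/sqr_sum_eq0[h1 h2].
  by rewrite [w]surjective_pairing h1 h2.
Qed.

Let pairD (x y x' y' : R) : (x, y) + (x', y') = (x + x', y + y') :> R * R.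
Proof. by []. Qed.

Let pairB (x y x' y' : R) : (x, y) - (x', y') = (x - x', y - y') :> R * R.
Proof. by []. Qed.

(** With [q0 = 0] the directional polynomial is [y * (b * x ^+ 2 + c * x * y - p2 * y ^+ 2)]. It has
    a multiple root at [(1, 0)] if [b = 0], and at [(- c, 2 * b)] if the discriminant vanishes. *)
Lemma nondegenerate_axis (p0 p1 p2 q0 q1 q2 : R) :
  nondegenerate (quadratic_field p0 p1 p2 q0 q1 q2) -> q0 = 0 ->
  let b := q1 - p0 in let c := q2 - p1 in b != 0 /\ c ^+ 2 + 4 * b * p2 != 0.
Proof.
move=> [_ _ simple] q00 b c; have b0 : b != 0.
  apply/eqP => b0; have [||[x y]] := simple (1, 0).
  - by apply/eqP => -[/eqP]; rewrite oner_eq0.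
  - by rewrite directional_polynomialE q00; ring.
  move=> /eqP; apply; rewrite pairD pairB !directional_polynomialE -/b -/c b0 q00; ring.
split=> //; apply/eqP => D0; have [||[x y]] := simple (- c, 2 * b).
- by apply/eqP => -[_ /eqP]; rewrite mulf_eq0 pnatr_eq0 (negPf b0).
- rewrite directional_polynomialE q00 -/b -/c.
  have -> : 0 * (- c) ^+ 3 + b * (- c) ^+ 2 * (2 * b) + c * - c * (2 * b) ^+ 2 - p2 * (2 * b) ^+ 3 =
     - 2 * b ^+ 2 * (c ^+ 2 + 4 * b * p2) by ring.
  by rewrite D0 mulr0.
move=> /eqP; apply; have eE : p2 = - c ^+ 2 / (4 * b).
  have h : c ^+ 2 = - (4 * b * p2) by lra.
  by rewrite h; field.
rewrite pairD pairB !directional_polynomialE -/b -/c q00 eE.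
by field.
Qed.

(** The directional polynomial determines a quadratic field up to the two parameters [p0] and [p1],
    which is why the normal forms have two parameters. *)
Lemma quadratic_field_directional (p0 p1 p2 q0 q1 q2 c0 c1 c2 c3 : R) :
  (forall x y, directional_polynomial (quadratic_field p0 p1 p2 q0 q1 q2) (x, y) =
     c0 * x ^+ 3 + c1 * x ^+ 2 * y + c2 * x * y ^+ 2 + c3 * y ^+ 3) ->
  [/\ q0 = c0, q1 = p0 + c1, q2 = p1 + c2 & p2 = - c3].
Proof.
move=> h; have h1 := h 1 0; have h2 := h 0 1; have h3 := h 1 1; have h4 := h 1 (-1).
rewrite !directional_polynomialE in h1 h2 h3 h4; split; lra.
Qed.

Definition linearly_equivalent X Y := exists T T' : {linear (R * R)%type -> (R * R)%type},
  [/\ cancel T T', cancel T' T & push_field T T' X = Y].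

Lemma linearly_equivalent_trans X Y Z : linearly_equivalent X Y -> linearly_equivalent Y Z ->
  linearly_equivalent X Z.
Proof.
move=> [T [T' [TK T'K <-]]] [S [S' [SK S'K <-]]].
exists (S \o T), (T' \o S'); split=> [z|z|]; rewrite /= ?SK ?TK ?T'K ?S'K//.
Qed.

(** Completing the square and rescaling [y] by [dl] brings the directional polynomial to
    [y * (x ^+ 2 + y ^+ 2)]; the fields with this polynomial are the canonical ones, and [k1 = 0]
    would make the field vanish at [(1, 0)]. *)
Lemma canonical_equivalent (p0 p1 p2 q1 q2 : R) (b := q1 - p0) (c := q2 - p1) :
  nondegenerate (quadratic_field p0 p1 p2 0 q1 q2) -> c ^+ 2 + 4 * b * p2 < 0 ->
  exists k1 k2, k1 != 0 /\
    linearly_equivalent (quadratic_field p0 p1 p2 0 q1 q2) (canonical_field k1 k2).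
Proof.
move=> nd D; have [b0 _] := nondegenerate_axis nd erefl; rewrite -/b in b0.
pose dl := Num.sqrt (- (c ^+ 2 + 4 * b * p2)) / 2.
have dl2 : dl ^+ 2 = - (c ^+ 2 + 4 * b * p2) / 4.
  by rewrite expr_div_n sqr_sqrtr ?oppr_ge0 ?(ltW D)//; field.
have dl0 : dl != 0.
  by rewrite -sqrf_eq0 dl2 mulf_neq0 ?invr_eq0 ?oppr_eq0 ?pnatr_eq0// lt_eqF.
pose T := plane_map b (c / 2) 0 dl; pose T' := plane_map b^-1 (- c / (2 * b * dl)) 0 dl^-1.
have TK : cancel T T'.
  by move=> [x y]; rewrite /T /T' /plane_map/=; congr pair; field; rewrite ?b0 ?dl0.
have T'K : cancel T' T.
  by move=> [x y]; rewrite /T /T' /plane_map/=; congr pair; field; rewrite ?b0 ?dl0.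
have detT : b * dl - c / 2 * 0 != 0 by rewrite mulr0 subr0 mulf_neq0.
have ndT := nondegenerate_push TK T'K detT nd.
have [[P0 [P1 [P2 [Q0 [Q1 [Q2 XE]]]]]] nz _] := ndT.
have F x y : directional_polynomial (quadratic_field P0 P1 P2 Q0 Q1 Q2) (x, y) =
    0 * x ^+ 3 + 1 * x ^+ 2 * y + 0 * x * y ^+ 2 + 1 * y ^+ 3.
  rewrite -XE -[(x, y)]T'K plane_map_det// directional_polynomialE -/b -/c.
  have p2E : p2 = - (4 * dl ^+ 2 + c ^+ 2) / (4 * b) by rewrite dl2; field.
  by rewrite p2E /=; field; rewrite dl0 b0.
have [q0E q1E q2E p2E] := quadratic_field_directional F.
exists P0, P1; split.
  have e0 : ((1, 0) : R * R) != 0 by apply/eqP => -[/eqP]; rewrite oner_eq0.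
  apply/eqP => P00; have /eqP := nz _ e0; apply.
  by rewrite XE /quadratic_field/= q0E P00; congr pair; ring.
exists T, T'; split=> //; rewrite [LHS]XE canonical_fieldE.
by rewrite q0E q1E q2E p2E addr0.
Qed.

(** The map sends the three invariant lines to the axes and the diagonal, scaled so that the
    directional polynomial is [x * y * (x - y)]. The three numbers are nonzero because the field
    does not vanish at [(1, 0)], [(0, 1)] and [(1, 1)]. *)
Lemma lv_equivalent (p0 p1 p2 q1 q2 : R) (b := q1 - p0) (c := q2 - p1) :
  nondegenerate (quadratic_field p0 p1 p2 0 q1 q2) -> 0 < c ^+ 2 + 4 * b * p2 ->
  exists a d, [/\ a != 0, d != 0, a + d + 1 != 0 &
    linearly_equivalent (quadratic_field p0 p1 p2 0 q1 q2) (lv_field a d)].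
Proof.
move=> nd D; have [b0 _] := nondegenerate_axis nd erefl; rewrite -/b in b0.
pose s := Num.sqrt (c ^+ 2 + 4 * b * p2).
have s2 : s ^+ 2 = c ^+ 2 + 4 * b * p2 by rewrite sqr_sqrtr// ltW.
have s0 : s != 0 by rewrite -sqrf_eq0 s2 gt_eqF.
(* [x = r y] and [x = (r + s / b) y] are the invariant lines other than [y = 0]. *)
pose r := (- c - s) / (2 * b).
pose T := plane_map b (- b * r) 0 s; pose T' := plane_map b^-1 (r / s) 0 s^-1.
have TK : cancel T T'.
  by move=> [x y]; rewrite /T /T' /plane_map/=; congr pair; field; rewrite ?b0 ?s0.
have T'K : cancel T' T.
  by move=> [x y]; rewrite /T /T' /plane_map/=; congr pair; field; rewrite ?b0 ?s0.
have detT : b * s - (- b * r) * 0 != 0 by rewrite mulr0 subr0 mulf_neq0.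
have ndT := nondegenerate_push TK T'K detT nd.
have [[P0 [P1 [P2 [Q0 [Q1 [Q2 XE]]]]]] nz _] := ndT.
have F x y : directional_polynomial (quadratic_field P0 P1 P2 Q0 Q1 Q2) (x, y) =
    0 * x ^+ 3 + 1 * x ^+ 2 * y + (-1) * x * y ^+ 2 + 0 * y ^+ 3.
  rewrite -XE -[(x, y)]T'K plane_map_det// directional_polynomialE -/b -/c.
  have p2E : p2 = (s ^+ 2 - c ^+ 2) / (4 * b) by rewrite s2; field.
  by rewrite p2E /r /=; field; rewrite s0 b0.
have [q0E q1E q2E p2E] := quadratic_field_directional F.
have nonzero (x y : R) : (x != 0) || (y != 0) -> ((x, y) : R * R) != 0.
  by move=> xy; apply/eqP => -[x0 y0]; rewrite x0 y0 !eqxx in xy.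
have one0 : (1 : R) != 0 := oner_neq0 R.
exists P0, Q2; split.
- apply/eqP => P00; have /eqP := nz (1, 0) (nonzero 1 0 ltac:(by rewrite one0)); apply.
  by rewrite XE /quadratic_field/= q0E P00; congr pair; ring.
- apply/eqP => P00; have /eqP := nz (0, 1) (nonzero 0 1 ltac:(by rewrite one0 orbT)); apply.
  by rewrite XE /quadratic_field/= p2E P00; congr pair; ring.
- apply/eqP => P00; have /eqP := nz (1, 1) (nonzero 1 1 ltac:(by rewrite one0)); apply.
  have p1E : P1 = - P0 by lra.
  by rewrite XE /quadratic_field/= q0E p2E q1E q2E p1E; congr pair; lra.
exists T, T'; split=> //; rewrite [LHS]XE /lv_field q0E q1E p2E oppr0.
by have -> : P1 = Q2 + 1 by lra.
Qed.

Lemma nondegenerate_cases X : nondegenerate X ->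
  (exists k1 k2, k1 != 0 /\ linearly_equivalent X (canonical_field k1 k2)) \/
  (exists a d, [/\ a != 0, d != 0, a + d + 1 != 0 & linearly_equivalent X (lv_field a d)]).
Proof.
move=> nd; have [w w0 Fw] := directional_root nd.
pose n := w.1 ^+ 2 + w.2 ^+ 2.
have n0 : n != 0.
  apply: contra w0 => /eqP/sqr_sum_eq0[h1 h2].
  by rewrite [w]surjective_pairing h1 h2.
(* A map of determinant 1 that sends the root [w] to [(1, 0)], so that the coefficient [q0] becomes
   0. *)
pose T := plane_map (w.1 / n) (w.2 / n) (- w.2) w.1.
pose T' := plane_map w.1 (- w.2 / n) w.2 (w.1 / n).
have TK : cancel T T'.
  by move=> [x y]; rewrite /T /T' /plane_map/=; congr pair; rewrite /n; field; rewrite -/n.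
have T'K : cancel T' T.
  by move=> [x y]; rewrite /T /T' /plane_map/=; congr pair; rewrite /n; field; rewrite -/n.
have detT : w.1 / n * w.1 - w.2 / n * - w.2 = 1 by rewrite /n; field; rewrite -/n.
have ndT : nondegenerate (push_field T T' X).
  by apply: nondegenerate_push => //; rewrite detT oner_neq0.
have eqT : linearly_equivalent X (push_field T T' X) by exists T, T'.
have [[p0 [p1 [p2 [q0 [q1 [q2 XE]]]]]] _ _] := ndT.
have Tw : T w = (1, 0).
  by rewrite /T /plane_map; congr pair; rewrite /n; field; rewrite -/n.
have q00 : q0 = 0.
  have : directional_polynomial (push_field T T' X) (1, 0) = 0.
    by rewrite -Tw plane_map_det// Fw mulr0.
  by rewrite XE directional_polynomialE => <-; ring.
rewrite XE q00 in ndT eqT.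
have [b0 D0] := nondegenerate_axis ndT erefl.
have [D|D|D] := ltgtP ((q2 - p1) ^+ 2 + 4 * (q1 - p0) * p2) 0; last by rewrite D eqxx in D0.
- left; have [k1 [k2 [k10 e]]] := canonical_equivalent ndT D.
  by exists k1, k2; split=> //; exact: linearly_equivalent_trans e.
- right; have [a [d [a0 d0 ad0 e]]] := lv_equivalent ndT D.
  by exists a, d; split=> //; exact: linearly_equivalent_trans e.
Qed.

End NormalForms.

Theorem proposition6p3 (R : realType) (X : R * R -> R * R) (hX : class_V X) :
  C0_regularisable X <->
  exists (T T' : {linear (R * R)%type -> (R * R)%type}) (k1 k2 : R),
    [/\ cancel T T' /\ cancel T' T,
        k1 < 0 &
        forall z, push_field T T' X z = canonical_field k1 k2 z].
Proof.
split=> [reg|[T [T' [k1 [k2 [[TK T'K] k10 XE]]]]]]; last first.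
  rewrite -(push_fieldK X TK); apply: push_regularisable => //.
  by rewrite (funext XE) canonical_fieldE; exact: canonical_regularisable.
have [[k1 [k2 [k10 [T [T' [TK T'K XE]]]]]]|[a [d [a0 d0 ad0 [T [T' [TK T'K XE]]]]]]] :=
  nondegenerate_cases (class_V_nondegenerate hX).
  have := push_regularisable TK T'K reg; rewrite XE => regc.
  exists T, T', k1, k2; split=> [||z]; [by []| |by rewrite XE].
  rewrite lt_neqAle k10 leNgt; apply/negP => k1p.
  have [N [+ _]] := regc; rewrite canonical_fieldE; exact: canonical_elliptic k1p.
have := push_regularisable TK T'K reg; rewrite XE => regl.
by have := lv_not_regularisable a0 d0 ad0 regl.
Qed.
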